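(* If $\eta\ge\eta_*$, then there exists a unique $u_h\in V_h^g$ such that $\langle\mathcal A_h(u_h),v\rangle=0$ for all $v\in V_h^0$.
   Context: Data. $\mathcal S_d^{++}$ is the set of symmetric positive definite real $d\times d$ matrices; matrices carry the Frobenius norm $|\cdot|$ and inner product $M:N$. $\Omega\subset\mathbb R^d$ is a bounded convex polytope; $\Lambda_1,\Lambda_2$ are compact metric spaces; $A\colon\Lambda_1\times\Lambda_2\times\Omega\to\mathcal S_d^{++}$, $b\colon\Lambda_1\times\Lambda_2\times\Omega\to\mathbb R^d$, $c\colon\Lambda_1\times\Lambda_2\times\Omega\to[0,\infty)$, $f\colon\Lambda_1\times\Lambda_2\times\Omega\to\mathbb R$ are Carathéodory functions (measurable in $x$ for every $(\alpha,\beta)$, continuous in $(\alpha,\beta)$ for a.e. $x$). Cordes condition, in the following form: $\lambda\ge0$, $\kappa\in(0,1]$ and a Carathéodory function $\gamma\colon\Lambda_1\times\Lambda_2\times\Omega\to(0,\infty)$ are fixed such that for all $\alpha,\beta,x$, $$\lambda^2|\gamma^{\alpha,\beta}A^{\alpha,\beta}-I_d|^2+\tfrac\lambda2|\gamma^{\alpha,\beta}b^{\alpha,\beta}|^2+|\gamma^{\alpha,\beta}c^{\alpha,\beta}-\lambda|^2\le\lambda^2(1-\kappa)^2,$$ and, if $\lambda=0$, also $|\gamma^{\alpha,\beta}A^{\alpha,\beta}-I_d|^2\le(1-\kappa)^2$, $b^{\alpha,\beta}=0$, $c^{\alpha,\beta}=0$. Moreover $x\mapsto\sup_{\alpha,\beta}\gamma^{\alpha,\beta}(x)|f^{\alpha,\beta}(x)|$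 belongs to $L^2(\Omega)$. Discrete setting. $\mathcal K_h$ is a polytopal mesh of $\Omega$, shape-regular with parameter $\rho\in(0,1)$: each face $F$ (of any dimension $0\le d'\le d$, cells included) of each $K\in\mathcal K_h$ is star-shaped with respect to a $d'$-dimensional ball of diameter $\rho\operatorname{diam}(K)$ and has a characteristic length $h_F$ with $\rho\operatorname{diam}(K)\le h_F\le\rho^{-1}\operatorname{diam}(K)$. $m\ge2$ is an integer, $j\in\{0,1,2\}$. $\mathbb P_{k,h}(\Omega)$ is the space of (discontinuous) piecewise polynomials of degree at most $k$ on $\mathcal K_h$ and $\Pi_h^k$ the $L^2(\Omega)$-orthogonal projection onto it (componentwise for vectors and matrices). $V_h\subset H^2(\Omega)$ is a finite-dimensional linear subspace, $V_h^0:=V_h\cap H_0^1(\Omega)$, $g_I\in V_h$, $V_h^g:=g_I+V_h^0$. $s_{0,h},s_{2,h}$ are symmetric bilinear forms on $V_h+\mathbb P_{m,h}(\Omega)$ with, for all $v$ in this space, $s_{0,h}(v,v)\simeq\|v\|_0^2$, and $s_{2,h}(v,v)\simeq|v|_{2,h}^2$ if $\Pi_h^1v=0$. With broken derivatives, $$\mathcal L_h^{\alpha,\beta}v:=A^{\alpha,\beta}:\Pi_h^{m-j}\nabla^2v+b^{\alpha,\beta}\cdot\Pi_h^{m-j}\nabla v-c^{\alpha,\beta}\Pi_h^{m-j}v,\qquad \mathcal L_{\lambda,h}v:=\Pi_h^{m-j}(\Delta v-\lambda v),$$ $$F_{\gamma,h}[v]:=\inf_{\alpha\in\Lambda_1}\sup_{\beta\in\Lambda_2}[\gamma^{\alpha,\beta}(\mathcal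 L_h^{\alpha,\beta}v-f^{\alpha,\beta})],$$ and for $v\in V_h+\mathbb P_{m,h}(\Omega)$, $w\in V_h$, with a stabilization factor $\eta>0$, $$\langle\mathcal A_h(v),w\rangle:=\int_\Omega F_{\gamma,h}[v]\,\mathcal L_{\lambda,h}w\,dx+\eta\left[s_{2,h}(v-\Pi_h^mv,w-\Pi_h^mw)+\lambda^2s_{0,h}(v-\Pi_h^{m-j}v,w-\Pi_h^{m-j}w)\right].$$ Norms: $\|\cdot\|_0$ is the $L^2(\Omega)$ norm; $|v|_1=\|\nabla v\|_0$, $|v|_2=\|\nabla^2v\|_0$; $|\cdot|_{2,h}$ is the broken version of $|\cdot|_2$; $|v|_{*,\lambda}^2:=|v|_2^2+2\lambda|v|_1^2+\lambda^2\|v\|_0^2$. Convention: $a\lesssim b$ means $a\le Cb$ with $C>0$ depending only on $d,\Omega,m,\rho$; $a\simeq b$ means $a\lesssim b$ and $b\lesssim a$. This applies to the assumptions (their constants being fixed as functions of $d,\Omega,m,\rho$) and to the conclusions alike. The threshold $\eta_*$: $\eta_*\simeq1$ denotes a constant such that, whenever $\eta\ge\eta_*$, one has $\langle\mathcal A_h(v_1)-\mathcal A_h(v_2),v_1-v_2\rangle\ge\kappa|v_1-v_2|_{*,\lambda}^2$ for all $v_1,v_2\in V_h^g$ (such a constant exists). *)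

(* Defs.v *)
From HB Require Import structures.
From mathcomp Require Import all_boot all_order all_algebra.
From mathcomp Require Import all_classical all_reals all_analysis.

Set Implicit Arguments.
Unset Strict Implicit.
Unset Printing Implicit Defensive.

Import Order.TTheory GRing.Theory Num.Theory.
Import numFieldNormedType.Exports.

Local Open Scope classical_set_scope.
Local Open Scope ring_scope.

(* Points of R^d are row vectors 'rV[R]_d.  Functions on Omega are total
   functions 'rV[R]_d -> R of which only the values on Omega matter, and an
   L^2 class is represented by any of its elements, so that equality of such
   functions reads "almost everywhere on Omega". *)

(** * Lebesgue measure on R^d *)

Definition rV_display : measure_display -> measure_display.
Proof. exact. Qed.

Section rV_measurable.
Context {R : realType} {n : nat}.

Let coors : 'I_n -> 'rV[R]_n -> R := fun i x => x 0 i.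

Let rV_set0 : g_sigma_preimage coors set0.
Proof. exact: sigma_algebra0. Qed.

Let rV_setC A : g_sigma_preimage coors A -> g_sigma_preimage coors (~` A).
Proof. exact: sigma_algebraC. Qed.

Let rV_bigcup (F : (set 'rV[R]_n)^nat) :
  (forall i, g_sigma_preimage coors (F i)) ->
  g_sigma_preimage coors (\bigcup_i (F i)).
Proof. exact: sigma_algebra_bigcup. Qed.

(* The sigma-algebra generated by the coordinates: the Borel sets. *)
HB.instance Definition _ :=
  @isMeasurable.Build (rV_display default_measure_display)
    'rV[R]_n (g_sigma_preimage coors) rV_set0 rV_setC rV_bigcup.

End rV_measurable.

Section lebesgue_rV.
Context {R : realType}.

Definition rV_cons n (p : 'rV[R]_n * R) : 'rV[R]_n.+1 :=
  \row_i oapp (fun k => p.1 0 k) p.2 (unlift ord0 i).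

Lemma measurable_coord n (i : 'I_n) :
  measurable_fun [set: 'rV[R]_n] (fun x : 'rV[R]_n => x 0 i).
Proof.
move=> _ Y mY; rewrite setTI; apply: sub_sigma_algebra => /=.
rewrite -bigcup_seq/=; exists i => /=; first by rewrite mem_index_enum.
by exists Y => //; rewrite setTI.
Qed.

Lemma measurable_rV_cons n : measurable_fun [set: 'rV[R]_n * R] (@rV_cons n).
Proof.
apply: (measurability
  (\big[setU/set0]_(i < n.+1) preimage_set_system setT
     (fun x : 'rV[R]_n.+1 => x 0 i) measurable)) => //.
move=> _ [B +] <-; rewrite -bigcup_seq/= => -[i _] [C mC] <-.
rewrite !setTI.
have mi : measurable_fun [set: 'rV[R]_n * R] (fun p => rV_cons p 0 i).
  rewrite /rV_cons; case: (unliftP ord0 i) => [k ->|->].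
    under eq_fun do rewrite mxE liftK /=.
    by apply: (measurableT_comp (measurable_coord k)); exact: measurable_fst.
  by under eq_fun do rewrite mxE unlift_none /=; exact: measurable_snd.
by have := mi measurableT C mC; rewrite setTI.
Qed.

Section step.
Context (n : nat) (mu : {measure set 'rV[R]_n -> \bar R}).

Definition lebesgue_succ : set 'rV[R]_n.+1 -> \bar R :=
  pushforward (mu \x (@lebesgue_measure R))%E (@rV_cons n).

Let succ0 : lebesgue_succ set0 = 0%E.
Proof. by rewrite /lebesgue_succ /pushforward preimage_set0 measure0. Qed.

Let succ_ge0 A : (0 <= lebesgue_succ A)%E.
Proof. by rewrite /lebesgue_succ /pushforward measure_ge0. Qed.

Let succ_sigma_additive : semi_sigma_additive lebesgue_succ.
Proof.
move=> F mF tF mUF; rewrite /lebesgue_succ /pushforward preimage_bigcup.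
have mf A : measurable A -> measurable (@rV_cons n @^-1` A).
  by move=> mA; rewrite -[X in measurable X]setTI; exact: measurable_rV_cons.
apply: measure_semi_sigma_additive.
- by move=> k; exact: mf.
- apply/trivIsetP => /= i k _ _ ik; rewrite -preimage_setI.
  by move/trivIsetP : tF => /(_ _ _ _ _ ik) ->//; rewrite preimage_set0.
- by rewrite -preimage_bigcup; exact: mf.
Qed.

HB.instance Definition _ := isMeasure.Build _ _ _ lebesgue_succ
  succ0 succ_ge0 succ_sigma_additive.

End step.

Fixpoint lebesgue_rV n : {measure set 'rV[R]_n -> \bar R} :=
  if n is n'.+1 then lebesgue_succ (lebesgue_rV n') else \d_(0 : 'rV[R]_0).

End lebesgue_rV.

(** * Function spaces *)

Section function_spaces.
Context {R : realType} {d : nat}.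
Local Notation E := 'rV[R]_d.
Local Notation leb := (@lebesgue_rV R d).
Implicit Types (D U : set E) (u v w g p q phi : E -> R).

Definition ae_eq_on D u v := {ae leb, forall x, D x -> u x = v x}.

(* Lebesgue measurability, the measurable sets of 'rV[R]_d being Borel. *)
Definition leb_measurable D v :=
  exists2 g, measurable_fun [set: E] g & ae_eq_on D v g.

Definition L2 D v :=
  leb_measurable D v /\ (\int[leb]_(x in D) ((v x ^+ 2)%:E) < +oo)%E.

Definition norm0_sq D v : R := \int[leb]_(x in D) (v x ^+ 2).

Definition partial (i : 'I_d) v : E -> R := 'D_(delta_mx 0 i) v.

Definition partials (s : seq 'I_d) v : E -> R := foldr partial v s.

Definition smooth v := forall s,
  continuous (partials s v) /\
  forall (i : 'I_d) (x : E), derivable (partials s v) x (delta_mx 0 i).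

Definition test_function U phi :=
  [/\ smooth phi, compact (closure [set x | phi x != 0])
    & closure [set x | phi x != 0] `<=` U].

Definition is_weak_partial U (i : 'I_d) v g := forall phi,
  test_function U phi ->
  \int[leb]_(x in U) (v x * partial i phi x) =
  - \int[leb]_(x in U) (g x * phi x).

Definition weak_partial U (i : 'I_d) v : E -> R :=
  xget (fun=> 0) [set g | L2 U g /\ is_weak_partial U i v g].

Definition H1 U v :=
  L2 U v /\ forall i, exists2 g, L2 U g & is_weak_partial U i v g.

Definition H2 U v :=
  L2 U v /\ forall i, exists2 g, H1 U g & is_weak_partial U i v g.

Definition H1_0 U v := H1 U v /\
  exists phi : nat -> E -> R,
    [/\ forall n, test_function U (phi n),
        (fun n => norm0_sq U (v - phi n)) @ \oo --> (0 : R)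
      & forall i, (fun n => norm0_sq U (weak_partial U i v - partial i (phi n)))
          @ \oo --> (0 : R)].

Definition norm1_sq U v : R := \sum_i norm0_sq U (weak_partial U i v).

Definition norm2_sq U v : R :=
  \sum_i \sum_k norm0_sq U (weak_partial U i (weak_partial U k v)).

Definition norm_star_sq U (lambda : R) v : R :=
  norm2_sq U v + 2 * lambda * norm1_sq U v + lambda ^+ 2 * norm0_sq U v.

Definition linear_subspace (V : set (E -> R)) :=
  V 0 /\ forall (a : R) u v, V u -> V v -> V (a *: u + v).

Definition finite_dim D (V : set (E -> R)) :=
  exists n (e : 'I_n -> E -> R), (forall i, V (e i)) /\
    forall v, V v -> exists c : 'I_n -> R, ae_eq_on D v (\sum_i c i *: e i).

(* The first clause says that s is defined on classes modulo a.e. equality. *)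
Definition symmetric_bilinear_on D (V : set (E -> R))
    (s : (E -> R) -> (E -> R) -> R) :=
  [/\ forall u v w, V u -> V v -> V w -> ae_eq_on D u v -> s u w = s v w,
      forall u v, V u -> V v -> s u v = s v u
    & forall (a : R) u v w, V u -> V v -> V w ->
        s (a *: u + v) w = a * s u w + s v w].

End function_spaces.

(** * Polytopes and meshes *)

Section meshes.
Context {R : realType} {d : nat}.
Local Notation E := 'rV[R]_d.
Implicit Types (F G K Omega : set E).

(* The norm `|x| of 'rV[R]_d is the maximum norm. *)
Definition enorm (x : E) : R := Num.sqrt (\sum_i x 0 i ^+ 2).

Definition diam F : R := sup [set enorm (p.1 - p.2) | p in F `*` F].

Definition hull n (p : 'I_n -> E) : set E :=
  [set x | exists t : 'I_n -> R,
    [/\ forall i, 0 <= t i, \sum_i t i = 1 & x = \sum_i t i *: p i]].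

Definition affine_hull F : set E :=
  [set x | exists n (p : 'I_n -> E) (t : 'I_n -> R),
    [/\ forall i, F (p i), \sum_i t i = 1 & x = \sum_i t i *: p i]].

(* Omega is a domain: an open set. *)
Definition convex_polytope Omega :=
  Omega !=set0 /\ exists n (p : 'I_n -> E), Omega = (hull p)°.

Definition has_dim (k : nat) F :=
  F !=set0 /\ exists (a : E) (M : 'M[R]_d),
    \rank M = k /\ affine_hull F = [set x | (x - a <= M)%MS].

Definition rel_interior F : set E :=
  [set x | F x /\ exists2 e : R, 0 < e &
    forall y, affine_hull F y -> enorm (y - x) < e -> F y].

(* [faces k] is the collection of the k-dimensional faces of K.  K need not
   be convex and two (k-1)-faces of the same k-face may be coplanar, which
   allows for hanging nodes. *)
Definition polytope_with_faces K (faces : nat -> set (set E)) :=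
  [/\ faces d = [set K],
      forall k, finite_set (faces k),
      forall k F, faces k F -> [/\ compact F, has_dim k F,
        F = closure (rel_interior F)
        & F `\` rel_interior F =
          \bigcup_(G in [set G | G `<=` F /\
                                 exists2 l, k = l.+1 & faces l G]) G],
      forall k F, faces k F -> (k < d)%N -> exists2 G, faces k.+1 G & F `<=` G
    & forall k F G, faces k F -> faces k G -> F <> G ->
        rel_interior F `&` rel_interior G = set0].

Record mesh := Mesh {
  cells : set (set E) ;
  faces : set E -> nat -> set (set E) ;
  face_size : set E -> R }.

Definition polytopal_mesh Omega (Kh : mesh) :=
  [/\ finite_set (cells Kh),
      forall K, cells Kh K -> polytope_with_faces K (faces Kh K),
      \bigcup_(K in cells Kh) K = closure Omega
    & forall K K', cells Kh K -> cells Kh K' -> K <> K' ->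
        K° `&` K'° = set0].

(* Star-shapedness with respect to a ball of the affine hull of F. *)
Definition star_shaped_ball F (diameter : R) :=
  exists2 z, affine_hull F z &
    forall y x (t : R), affine_hull F y -> enorm (y - z) <= diameter / 2 ->
      F x -> 0 <= t <= 1 -> F (t *: y + (1 - t) *: x).

Definition shape_regular (rho : R) (Kh : mesh) :=
  forall K k F, cells Kh K -> faces Kh K k F ->
    star_shaped_ball F (rho * diam K) /\
    rho * diam K <= face_size Kh F <= rho^-1 * diam K.

End meshes.

Section broken.
Context {R : realType} {d : nat}.
Local Notation E := 'rV[R]_d.
Local Notation leb := (@lebesgue_rV R d).
Context (Omega : set E) (Kh : @mesh R d).
Implicit Types (v w p q : E -> R).

Definition poly_deg_le (k : nat) p :=
  exists a : {ffun 'I_d -> 'I_k.+1} -> R, forall x : E,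
    p x = \sum_(e : {ffun 'I_d -> 'I_k.+1} | (\sum_i e i <= k)%N)
            a e * \prod_i x 0 i ^+ e i.

Definition pw_poly (k : nat) : set (E -> R) :=
  [set v | forall K, cells Kh K ->
     exists2 p, poly_deg_le k p & ae_eq_on K v p].

Definition L2_proj (k : nat) v : E -> R :=
  xget (fun=> 0) [set p | pw_poly k p /\
    forall q, pw_poly k q -> \int[leb]_(x in Omega) ((v x - p x) * q x) = 0].

Definition broken_partial (i : 'I_d) v : E -> R :=
  xget (fun=> 0) [set g | L2 Omega g /\
    forall K, cells Kh K -> is_weak_partial K° i v g].

Definition broken_norm2_sq v : R :=
  \sum_i \sum_k norm0_sq Omega (broken_partial i (broken_partial k v)).

Definition broken_laplacian v : E -> R :=
  \sum_i broken_partial i (broken_partial i v).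

Definition set_sum (V W : set (E -> R)) : set (E -> R) :=
  [set u | exists v w, [/\ V v, W w & u = v + w]].

End broken.

(** * The discretized Isaacs operator *)

Section isaacs.
Context {R : realType} {d : nat} {Lam1 Lam2 : metricType R}.
Local Notation E := 'rV[R]_d.
Local Notation leb := (@lebesgue_rV R d).

Definition frob (M N : 'M[R]_d) : R := \sum_i \sum_k M i k * N i k.

Definition spd (M : 'M[R]_d) :=
  M^T = M /\ forall x : E, x != 0 -> 0 < (x *m M *m x^T) 0 0.

Definition caratheodory (Omega : set E) (g : Lam1 -> Lam2 -> E -> R) :=
  (forall a b, leb_measurable Omega (g a b)) /\
  {ae leb, forall x, Omega x ->
    continuous (fun ab : Lam1 * Lam2 => g ab.1 ab.2 x)}.

Context (Omega : set E).
Context (A : Lam1 -> Lam2 -> E -> 'M[R]_d) (b : Lam1 -> Lam2 -> E -> 'rV[R]_d)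
  (c f gamma : Lam1 -> Lam2 -> E -> R) (lambda kappa : R).

Definition isaacs_data :=
  [/\ forall i k, caratheodory Omega (fun al be x => A al be x i k),
      forall i, caratheodory Omega (fun al be x => b al be x 0 i),
      caratheodory Omega c /\ caratheodory Omega f,
      forall al be x, Omega x -> spd (A al be x)
    & forall al be x, Omega x -> 0 <= c al be x].

Definition sq_dist_id (M : 'M[R]_d) : R := frob (M - 1%:M) (M - 1%:M).

Definition cordes :=
  [/\ 0 <= lambda, 0 < kappa <= 1, caratheodory Omega gamma,
      forall al be x, Omega x -> 0 < gamma al be x
    & forall al be x, Omega x ->
      lambda ^+ 2 * sq_dist_id (gamma al be x *: A al be x)
        + lambda / 2 * enorm (gamma al be x *: b al be x) ^+ 2
        + `|gamma al be x * c al be x - lambda| ^+ 2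
        <= lambda ^+ 2 * (1 - kappa) ^+ 2
      /\ (lambda = 0 ->
          [/\ sq_dist_id (gamma al be x *: A al be x) <= (1 - kappa) ^+ 2,
              b al be x = 0 & c al be x = 0])].

Definition source_in_L2 :=
  L2 Omega (fun x => sup (range (fun ab : Lam1 * Lam2 =>
    gamma ab.1 ab.2 x * `|f ab.1 ab.2 x|))).

Context (Kh : @mesh R d) (m j : nat) (s0 s2 : (E -> R) -> (E -> R) -> R)
  (eta : R).

Local Notation Pi := (L2_proj Omega Kh).
Local Notation D := (broken_partial Omega Kh).

Definition Lh (al : Lam1) (be : Lam2) (v : E -> R) (x : E) : R :=
  frob (A al be x) (\matrix_(i, k) Pi (m - j) (D i (D k v)) x)
  + \sum_i b al be x 0 i * Pi (m - j) (D i v) x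
  - c al be x * Pi (m - j) v x.

Definition Llambdah (v : E -> R) : E -> R :=
  Pi (m - j) (broken_laplacian Omega Kh v - lambda *: v).

(* For almost every x the expression is continuous on the compact set
   Lam1 * Lam2, so that inf and sup are those of bounded sets. *)
Definition Fgammah (v : E -> R) (x : E) : R :=
  inf (range (fun al : Lam1 => sup (range (fun be : Lam2 =>
    gamma al be x * (Lh al be v x - f al be x))))).

Definition Ah (v w : E -> R) : R :=
  \int[leb]_(x in Omega) (Fgammah v x * Llambdah w x)
  + eta * (s2 (v - Pi m v) (w - Pi m w)
           + lambda ^+ 2 * s0 (v - Pi (m - j) v) (w - Pi (m - j) w)).

End isaacs.

(** * Discrete spaces *)

Section spaces.
Context {R : realType} {d : nat}.
Local Notation E := 'rV[R]_d.
Context (Omega : set E) (Vh : set (E -> R)).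

Definition fe_space :=
  [/\ linear_subspace Vh, finite_dim Omega Vh & Vh `<=` H2 Omega].

Definition Vh_zero : set (E -> R) := Vh `&` H1_0 Omega.

Definition Vh_affine (gI : E -> R) : set (E -> R) :=
  [set gI + w | w in Vh_zero].

End spaces.

(* Main.v *)
Require Import Defs.
From HB Require Import structures.
From mathcomp Require Import all_boot all_order all_algebra.
From mathcomp Require Import all_classical all_reals all_analysis.
From mathcomp Require Import measurable_realfun ring lra.

Set Implicit Arguments.
Unset Strict Implicit.
Unset Printing Implicit Defensive.

Import Order.TTheory GRing.Theory Num.Theory.
Import numFieldNormedType.Exports.

Local Open Scope classical_set_scope.
Local Open Scope ring_scope.
Import HBNNSimple.

(** The discrete problem is a finite system of nonlinear equations for a strongly
    monotone Lipschitz map, and such a map has exactly one zero.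

    Choose [e_1, ..., e_n] in [V_h^0] forming a basis modulo almost everywhere
    equality ([ae_basis]) and write an element of [V_h^g] as [g_I] plus the
    combination of the [e_k] with coordinates [x].  The equations are [G x = 0],
    the [i]-th component of [G x] being the value of the operator at this element,
    tested with [e_i].  A Galerkin solution is the same as a zero of [G], since
    the operator is linear in the test function ([Ah_linear_form]).

    Strong monotonicity is the inequality that defines the threshold.  The lower
    bound in it is a quadratic form of the coordinates ([norm_star_sq_quad]), positive
    definite because the norm separates the classes of [V_h^0] ([norm_star_eq0]):
    a function of H^1_0 with vanishing second derivatives vanishes, as one sees by
    integrating by parts twice ([H1_0_hessian_eq0]).

    The Lipschitz property ([Ah_lipschitz]) comes from the Cordes condition, which
    bounds the rescaled coefficients uniformly in the controls ([cordes_bound]),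
    since an inf-sup is nonexpansive ([Fgammah_lipschitz]).  The integral that
    defines the operator makes sense because the inf-sup of the payoff is
    measurable, by density of countably many controls ([inf_sup_measurable]), and
    square integrable ([Fgammah_L2]).

    A zero of [G] is obtained by minimizing [|G|^2]: a minimum exists by coercivity,
    and at a point where [G] does not vanish a small step along [- G] decreases
    [|G|] ([strongly_monotone_zero]).  Uniqueness follows from the threshold
    inequality applied to two solutions.

    Weak and broken derivatives and the projections are chosen within their
    classes, so they are linear only modulo almost everywhere equality; this is
    recorded by [L2_linear].  Their existence and uniqueness properties rest on the
    fundamental lemma of the calculus of variations ([variational_eq0]), on the
    nullity of cell boundaries ([cell_boundary_null]) and on Gram-Schmidt
    orthogonalization ([orthogonal_projection]). *)

(** * Almost everywhere equal functions and the L2 scalar product *)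

Section ae_integral.
Local Open Scope ereal_scope.
Context d (T : measurableType d) (R : realType) (mu : {measure set T -> \bar R}).

Let nnintegral_ae_le (f g : T -> \bar R) : (forall x, 0 <= f x) ->
  (forall x, 0 <= g x) -> {ae mu, forall x, f x = g x} ->
  \int[mu]_x f x <= \int[mu]_x g x.
Proof.
move=> f0 g0 [N [mN N0 subN]].
rewrite (ge0_integralTE _ f0) (ge0_integralTE _ g0).
apply: ge_ereal_sup => _ /= [h hf <-]; apply: le_ereal_sup_tmp.
have mCN : measurable (~` N) by exact: measurableC.
pose h' : {nnsfun T >-> R} := mul_nnsfun h (indic_nnsfun R mCN).
exists (sintegral mu h'); last first.
  rewrite -!integralT_nnsfun; rewrite le_eqVlt; apply/orP; left; apply/eqP.
  apply: ge0_ae_eq_integral => //.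
  - by apply/measurable_EFinP.
  - by apply/measurable_EFinP.
  - by move=> x _; rewrite lee_fin.
  - by move=> x _; rewrite lee_fin.
  - exists N; split => // x /= hx; apply: contrapT => Nx; apply: hx => _ /=.
    by rewrite (_ : mindic R mCN x = \1_(~` N) x)// indicE mem_set ?mulr1.
exists h' => // x /=.
rewrite (_ : mindic R mCN x = \1_(~` N) x)// indicE.
case: (pselect (N x)) => Nx.
  by rewrite memNset ?mulr0//= => /(_ Nx).
rewrite mem_set// mulr1.
have <- : f x = g x by apply: contrapT => fg; exact: Nx (subN _ fg).
exact: hf.
Qed.

(** Neither function has to be measurable: the integral of a nonnegative function
    is the supremum of the integrals of the simple functions below it, and a
    simple function may be set to zero on a null set.  Integrals can thus be
    computed on arbitrary representatives of a class. *)
Lemma ae_eq_integral_any (D : set T) (f g : T -> \bar R) :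
  {ae mu, forall x, D x -> f x = g x} ->
  \int[mu]_(x in D) f x = \int[mu]_(x in D) g x.
Proof.
move=> fg.
have E (h : T -> \bar R) : \int[mu]_(x in D) h x =
    \int[mu]_x (h \_ D)^\+ x - \int[mu]_x (h \_ D)^\- x.
  by rewrite integral_mkcond integralE.
have fgD : {ae mu, forall x, (f \_ D) x = (g \_ D) x}.
  apply: filterS fg => x fg; rewrite !patchE; case: ifPn => // /set_mem Dx.
  exact: fg.
rewrite !E; congr (_ - _); apply/eqP; rewrite eq_le; apply/andP; split;
  apply: nnintegral_ae_le => //; apply: filterS fgD => x;
  by rewrite ?funeposE ?funenegE => ->.
Qed.

End ae_integral.

Section L2_calculus.
Context {R : realType} {d : nat}.
Local Notation E := 'rV[R]_d.
Local Notation leb := (@lebesgue_rV R d).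
Implicit Types (D U : set E) (u v w g p q phi : E -> R).

Lemma ae_eq_on_refl D u : ae_eq_on D u u.
Proof. by apply: aeW. Qed.

Lemma ae_eq_on_eq D u v : (forall x, D x -> u x = v x) -> ae_eq_on D u v.
Proof. by move=> uv; apply: aeW. Qed.

Lemma ae_eq_on_sym D u v : ae_eq_on D u v -> ae_eq_on D v u.
Proof. by apply: filterS => x uv Dx; rewrite uv. Qed.

Lemma ae_eq_on_trans D u v w :
  ae_eq_on D u v -> ae_eq_on D v w -> ae_eq_on D u w.
Proof. by apply: filterS2 => x uv vw Dx; rewrite uv// vw. Qed.

Lemma ae_eq_on_sub D U u v : U `<=` D -> ae_eq_on D u v -> ae_eq_on U u v.
Proof. by move=> UD; apply: filterS => x uv /UD; exact: uv. Qed.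

Lemma ae_eq_on_lin D (a : R) u u' v v' :
  ae_eq_on D u u' -> ae_eq_on D v v' -> ae_eq_on D (a *: u + v) (a *: u' + v').
Proof. by apply: filterS2 => x uv vw Dx; rewrite !fctE uv// vw. Qed.

Lemma ae_eq_on_sum D n (u v : 'I_n -> E -> R) :
  (forall i, ae_eq_on D (u i) (v i)) -> ae_eq_on D (\sum_i u i) (\sum_i v i).
Proof.
move=> uv; have : {ae leb, forall x, forall i, D x -> u i x = v i x}.
  exact: filter_forall.
apply: filterS => x H Dx; rewrite !fct_sumE; apply: eq_bigr => i _; exact: H.
Qed.

Lemma Rintegral_ae D u v : ae_eq_on D u v ->
  \int[leb]_(x in D) u x = \int[leb]_(x in D) v x.
Proof.
move=> uv; rewrite /Rintegral; congr fine; apply: ae_eq_integral_any.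
by apply: filterS uv => x uv Dx; rewrite uv.
Qed.

Lemma norm0_sq_ae D u v : ae_eq_on D u v -> norm0_sq D u = norm0_sq D v.
Proof. by move=> uv; apply: Rintegral_ae; apply: filterS uv => x uv Dx; rewrite uv. Qed.

Lemma L2_ae D u v : ae_eq_on D u v -> L2 D u -> L2 D v.
Proof.
move=> uv [[g mg ug] u2]; split.
  by exists g => //; apply: ae_eq_on_trans ug; exact: ae_eq_on_sym.
apply: le_lt_trans u2; rewrite le_eqVlt; apply/orP; left; apply/eqP.
by apply: ae_eq_integral_any; apply: filterS uv => x uv Dx; rewrite uv.
Qed.

Lemma leb_measurable2 D (op : R -> R -> R) u v :
  measurable_fun setT (fun p : R * R => op p.1 p.2) ->
  leb_measurable D u -> leb_measurable D v ->
  leb_measurable D (fun x => op (u x) (v x)).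
Proof.
move=> mop [g mg ug] [h mh vh]; exists (fun x => op (g x) (h x)).
  exact: (measurableT_comp mop (measurable_fun_pair mg mh)).
by apply: filterS2 ug vh => x ug vh Dx; rewrite ug// vh.
Qed.

(** A product of representatives of L2 classes need not be Borel, so that
    integrability is asked of some Borel representative. *)
Definition ae_integrable D u :=
  exists g, [/\ measurable_fun setT g, ae_eq_on D u g
    & leb.-integrable D (EFin \o g)].

Lemma ae_integrable_ae D u v :
  ae_eq_on D u v -> ae_integrable D u -> ae_integrable D v.
Proof.
move=> uv [g [mg ug ig]]; exists g; split=> //.
by apply: ae_eq_on_trans ug; exact: ae_eq_on_sym.
Qed.

Section fixed_domain.
Variables (D : set E) (mD : measurable D).

Lemma Rintegral_lin (a : R) u v : ae_integrable D u -> ae_integrable D v ->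
  \int[leb]_(x in D) (a * u x + v x) =
  a * \int[leb]_(x in D) u x + \int[leb]_(x in D) v x.
Proof.
move=> [g [mg ug ig]] [h [mh vh ih]].
rewrite (Rintegral_ae ug) (Rintegral_ae vh).
rewrite (Rintegral_ae (ae_eq_on_lin a ug vh)) -RintegralZl// -RintegralD//.
by apply: eq_integrable (integrableZl mD a ig).
Qed.

Lemma L2_repr u : L2 D u ->
  exists g, [/\ measurable_fun setT g, ae_eq_on D u g & L2 D g].
Proof.
move=> /[dup] Lu [[g mg ug] _]; exists g; split=> //; exact: L2_ae Lu.
Qed.

Lemma L2_sq_integrable g : measurable_fun setT g -> L2 D g ->
  leb.-integrable D (fun x => (g x ^+ 2)%:E).
Proof.
move=> mg [_ g2]; apply/integrableP; split.
  apply/measurable_EFinP; apply: (@measurable_funS _ _ _ _ setT) => //.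
  exact: measurable_funX.
under eq_integral do rewrite gee0_abs ?lee_fin ?sqr_ge0//.
exact: g2.
Qed.

Lemma L2_mul u v : L2 D u -> L2 D v -> ae_integrable D (u * v).
Proof.
move=> /L2_repr [g [mg ug Lg]] /L2_repr [h [mh vh Lh]]; exists (g * h).
have mgh : measurable_fun setT (g * h) by exact: measurable_funM.
split=> //.
- by apply: filterS2 ug vh => x ug vh Dx; rewrite !fctE ug// vh.
- have i := integrableD mD (L2_sq_integrable mg Lg) (L2_sq_integrable mh Lh).
  apply: le_integrable i => //.
    by apply/measurable_EFinP; exact: measurable_funS mgh.
  move=> x Dx /=; rewrite lee_fin (_ : (g * h) x = g x * h x)// normrM.
  rewrite (ger0_norm (addr_ge0 _ _)) ?sqr_ge0//.
  rewrite -(real_normK (num_real (g x))) -(real_normK (num_real (h x))).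
  have := sqr_ge0 (`|g x| - `|h x|); have := sqr_ge0 (`|g x| + `|h x|); nra.
Qed.

Lemma L2_intro g u : measurable_fun setT g -> ae_eq_on D u g ->
  leb.-integrable D (fun x => (g x ^+ 2)%:E) -> L2 D u.
Proof.
move=> mg ug ig; apply: (L2_ae (ae_eq_on_sym ug)); split.
  by exists g => //; exact: ae_eq_on_refl.
move/integrableP : ig => [_]; under eq_integral do rewrite gee0_abs ?lee_fin ?sqr_ge0//.
by [].
Qed.

Lemma L2_lin (a : R) u v : L2 D u -> L2 D v -> L2 D (a *: u + v).
Proof.
move=> /[dup] Lu /L2_repr [g [mg ug Lg]] /[dup] Lv /L2_repr [h [mh vh Lh]].
have mgh : measurable_fun setT (a *: g + h).
  by apply: measurable_funD => //; exact: measurable_funM.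
apply: (L2_intro mgh); first exact: ae_eq_on_lin.
have i := integrableD mD (integrableZl mD (2 * a ^+ 2) (L2_sq_integrable mg Lg))
  (integrableZl mD 2 (L2_sq_integrable mh Lh)).
apply: le_integrable i => //.
  apply/measurable_EFinP; apply: (@measurable_funS _ _ _ _ setT) => //.
  exact: measurable_funX.
move=> x Dx /=; rewrite lee_fin !ger0_norm ?sqr_ge0//.
  by rewrite !fctE; have := sqr_ge0 (a *: g x - h x); rewrite /GRing.scale /=; nra.
by rewrite addr_ge0// mulr_ge0 ?sqr_ge0// mulr_ge0 ?sqr_ge0.
Qed.

Lemma L2_0 : L2 D 0.
Proof.
split; first by exists 0 => //; [exact: measurable_cst|exact: ae_eq_on_refl].
rewrite (eq_integral (cst 0%E)) ?integral0// => x _ /=.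
by rewrite (_ : (0 : E -> R) x = 0)// expr0n.
Qed.

Lemma L2_scale (a : R) u : L2 D u -> L2 D (a *: u).
Proof. by move=> Lu; rewrite -[_ *: _]addr0; apply: L2_lin => //; exact: L2_0. Qed.

Lemma L2_add u v : L2 D u -> L2 D v -> L2 D (u + v).
Proof. by move=> Lu Lv; rewrite -[u]scale1r; exact: L2_lin. Qed.

Lemma L2_sub u v : L2 D u -> L2 D v -> L2 D (u - v).
Proof. by move=> Lu Lv; rewrite addrC -scaleN1r; exact: L2_lin. Qed.

Lemma L2_sum n (u : 'I_n -> E -> R) : (forall i, L2 D (u i)) -> L2 D (\sum_i u i).
Proof.
by move=> Lu; elim/big_ind : _ => //; [exact: L2_0|exact: L2_add].
Qed.

Lemma L2_dominated u v : leb_measurable D u -> L2 D v ->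
  {ae leb, forall x, D x -> `|u x| <= `|v x|} -> L2 D u.
Proof.
move=> [g mg ug] /L2_repr [h [mh vh Lh]] uv; apply: (L2_intro mg) => //.
have mh' : measurable_fun setT (fun x => h x ^+ 2) by exact: measurable_funX.
have mg' : measurable_fun setT (fun x => g x ^+ 2) by exact: measurable_funX.
apply/integrableP; split.
  by apply/measurable_EFinP; exact: measurable_funS mg'.
move/integrableP : (L2_sq_integrable mh Lh) => [_]; apply: le_lt_trans.
(* taking the minimum with [h x ^+ 2] turns the bound valid almost everywhere
   into one valid everywhere *)
rewrite (@ae_eq_integral_any _ _ _ _ _ (fun x => `|(g x ^+ 2)%:E|)%E
  (fun x => (Num.min (g x ^+ 2) (h x ^+ 2))%:E)); last first.
  apply: filterS3 ug vh uv => x ug vh uv Dx.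
  rewrite gee0_abs ?lee_fin ?sqr_ge0//; congr EFin; apply/esym/min_idPl.
  move: (uv Dx); rewrite ug// vh// => gh.
  rewrite -(real_normK (num_real (g x))) -(real_normK (num_real (h x))).
  by rewrite lerXn2r ?nnegrE.
apply: ge0_le_integral => //.
- by move=> x Dx; rewrite lee_fin le_min !sqr_ge0.
- by apply/measurable_EFinP; apply: (@measurable_funS _ _ _ _ setT) => //; exact: measurable_minr.
- apply: measurableT_comp => //.
  by apply/measurable_EFinP; exact: measurable_funS mh'.
- by move=> x Dx; rewrite gee0_abs ?lee_fin ?sqr_ge0// ge_min lexx orbT.
Qed.

Definition ip u v := \int[leb]_(x in D) (u x * v x).

Lemma norm0_sqE u : norm0_sq D u = ip u u.
Proof. by apply: eq_Rintegral => x _; rewrite expr2. Qed.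

Lemma ipC u v : ip u v = ip v u.
Proof. by apply: eq_Rintegral => x _; rewrite mulrC. Qed.

Lemma ip_ae u u' v v' : ae_eq_on D u u' -> ae_eq_on D v v' -> ip u v = ip u' v'.
Proof.
by move=> uu vv; apply: Rintegral_ae; apply: filterS2 uu vv => x uu vv Dx; rewrite uu// vv.
Qed.

Lemma ip_lin (a : R) u v w : L2 D u -> L2 D v -> L2 D w ->
  ip (a *: u + v) w = a * ip u w + ip v w.
Proof.
move=> Lu Lv Lw; rewrite /ip -Rintegral_lin; try exact: (L2_mul (v := w)).
by apply: eq_Rintegral => x _; rewrite !fctE mulrDl mulrA.
Qed.

Lemma ip_linr (a : R) u v w : L2 D u -> L2 D v -> L2 D w ->
  ip w (a *: u + v) = a * ip w u + ip w v.
Proof. by move=> Lu Lv Lw; rewrite ipC ip_lin// !(ipC w). Qed.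

Lemma ip0 u : ip 0 u = 0.
Proof.
transitivity (\int[leb]_(x in D) (0 : R)); last by rewrite Rintegral_cst// mul0r.
by apply: eq_Rintegral => x _; exact: mul0r.
Qed.

Lemma ip_subl u v w : L2 D u -> L2 D v -> L2 D w -> ip (u - v) w = ip u w - ip v w.
Proof. by move=> *; rewrite addrC -scaleN1r ip_lin// mulN1r addrC. Qed.

Lemma ip_suml n (c : 'I_n -> R) (u : 'I_n -> E -> R) w :
  (forall i, L2 D (u i)) -> L2 D w ->
  ip (\sum_i c i *: u i) w = \sum_i c i * ip (u i) w.
Proof.
move=> Lu Lw; suff [] : L2 D (\sum_i c i *: u i) /\
  ip (\sum_i c i *: u i) w = \sum_i c i * ip (u i) w by [].
apply: (big_ind2 (fun f r => L2 D f /\ ip f w = r)) => [|f r g s [Lf <-] [Lg <-]|i _].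
- by rewrite ip0; split=> //; exact: L2_0.
- split; first exact: L2_add.
  by rewrite -[f]scale1r ip_lin// mul1r scale1r.
- split; first exact: L2_scale.
  by rewrite -[_ *: _]addr0 ip_lin// ?ip0 ?addr0//; exact: L2_0.
Qed.

Lemma norm0_sq_ge0 u : 0 <= norm0_sq D u.
Proof. by apply: Rintegral_ge0 => x _; exact: sqr_ge0. Qed.

Lemma norm0_sq_eq0 u : L2 D u -> norm0_sq D u = 0 -> ae_eq_on D u 0.
Proof.
move=> /L2_repr [g [mg ug Lg]]; rewrite (norm0_sq_ae ug) => g0.
apply: (ae_eq_on_trans ug).
have ig := L2_sq_integrable mg Lg.
have : (\int[leb]_(x in D) `|(g x ^+ 2)%:E| = 0)%E.
  under eq_integral do rewrite gee0_abs ?lee_fin ?sqr_ge0//.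
  by rewrite -[LHS]fineK ?integrable_fin_num//; congr EFin.
have mg' : measurable_fun setT (fun x => g x ^+ 2) by exact: measurable_funX.
have mg2 : measurable_fun D (fun x => (g x ^+ 2)%:E).
  by apply/measurable_EFinP; exact: measurable_funS mg'.
move/(ae_eq_integral_abs leb mD mg2); apply: filterS => x H Dx.
by have /= [/eqP] := H Dx; rewrite sqrf_eq0 => /eqP.
Qed.

Lemma ip_CauchySchwarz u v : L2 D u -> L2 D v ->
  ip u v ^+ 2 <= norm0_sq D u * norm0_sq D v.
Proof.
move=> Lu Lv; rewrite !norm0_sqE.
have H (t : R) : 0 <= t ^+ 2 * ip u u + 2 * t * ip u v + ip v v.
  have := norm0_sq_ge0 (t *: u + v); rewrite norm0_sqE.
  have Lw : L2 D (t *: u + v) by exact: L2_lin.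
  rewrite ip_lin// !ip_linr// (ipC v u) => /le_trans; apply.
  by rewrite le_eqVlt; apply/orP; left; apply/eqP; ring.
have p0 : 0 <= ip u u by rewrite -norm0_sqE norm0_sq_ge0.
have := p0; rewrite le_eqVlt => /predU1P[p0'|p_gt0].
  rewrite -p0' mul0r; have [->|q0] := eqVneq (ip u v) 0; first by rewrite expr0n.
  have := H (- (ip v v + 1) / (2 * ip u v)); rewrite -p0' mulr0 add0r.
  rewrite (_ : 2 * _ * _ = - (ip v v + 1)); first by lra.
  by field.
have := H (- ip u v / ip u u).
rewrite (_ : _ + _ = (ip u u * ip v v - ip u v ^+ 2) / ip u u); last first.
  by field; rewrite gt_eqF.
by rewrite pmulr_lge0 ?invr_gt0// subr_ge0.
Qed.

Lemma norm0_sq_add u v : L2 D u -> L2 D v ->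
  norm0_sq D (u + v) <= 2 * norm0_sq D u + 2 * norm0_sq D v.
Proof.
move=> Lu Lv; rewrite !norm0_sqE.
have := norm0_sq_ge0 (-1 *: u + v); rewrite norm0_sqE.
have L1 : L2 D (-1 *: u + v) by exact: L2_lin.
have L3 : L2 D (1 *: u + v) by exact: L2_lin.
rewrite -{3 4}[u]scale1r; rewrite !ip_lin// !ip_linr// (ipC v u); lra.
Qed.

Lemma norm0_sqZ (a : R) u : L2 D u -> norm0_sq D (a *: u) = a ^+ 2 * norm0_sq D u.
Proof.
move=> Lu; have L0 := L2_0; have Lau := L2_lin a Lu L0.
rewrite !norm0_sqE -[_ *: _]addr0 ip_lin// !ip_linr// (ipC _ 0) !ip0.
by rewrite mulr0 !addr0 mulrA expr2.
Qed.

End fixed_domain.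
End L2_calculus.

(** * Boxes, Borel sets and null sets *)

Section rV_geometry.
Context {R : realType}.

Lemma nbhs_rVP d (x : 'rV[R]_d) (A : set 'rV[R]_d) :
  nbhs x A <->
  exists2 e : R, 0 < e &
    forall y : 'rV[R]_d, (forall i, `|y 0 i - x 0 i| < e) -> A y.
Proof.
split.
  move=> /nbhs_ballP [e e0 xeA]; exists e => // y yx; apply: xeA.
  by split=> // i j; rewrite ord1 /ball /= distrC.
move=> [e e0 H]; apply/nbhs_ballP; exists e => // y [_ xy]; apply: H => i.
by have := xy 0 i; rewrite /ball /= distrC.
Qed.

Lemma rV_norm_ltP d (x : 'rV[R]_d) (e : R) : 0 < e ->
  (`|x| < e) <-> (forall i, `|x 0 i| < e).
Proof.
move=> e0; have := @mx_norm_ball R 1 d.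
move=> /(congr1 (fun B => B 0 e x)); rewrite /ball_ /= sub0r normrN => E.
split => [|H].
  rewrite -[is_true _]E.
  by move=> [_ H] i; have := H 0 i; rewrite /ball/= mxE sub0r normrN.
rewrite -[is_true _]E.
by split=> // i j; rewrite ord1 /ball/= mxE sub0r normrN.
Qed.

Lemma rV_norm_coord d (x : 'rV[R]_d) i : `|x 0 i| <= `|x|.
Proof.
apply/ler_addgt0Pr => e e0; apply: ltW; move: i.
by apply/rV_norm_ltP; [rewrite ltr_wpDl|rewrite ltrDl].
Qed.

Definition obox d (a b : 'rV[R]_d) : set 'rV[R]_d :=
  [set x | forall i, a 0 i < x 0 i < b 0 i].

Definition cbox d (a b : 'rV[R]_d) : set 'rV[R]_d :=
  [set x | forall i, a 0 i <= x 0 i <= b 0 i].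

Lemma obox_cbox d (a b : 'rV[R]_d) : obox a b `<=` cbox a b.
Proof. by move=> x H i; have /andP[/ltW -> /ltW ->] := H i. Qed.

Lemma measurable_coords d (F : 'I_d -> set R) : (forall i, measurable (F i)) ->
  measurable [set x : 'rV[R]_d | forall i, F i (x 0 i)].
Proof.
move=> mF.
rewrite (_ : [set x : 'rV[R]_d | _] =
  \bigcap_(i in [set: 'I_d]) [set x : 'rV[R]_d | F i (x 0 i)]).
  apply: fin_bigcap_measurable; first exact: finite_finset.
  move=> i _; rewrite -[X in measurable X]setTI.
  exact: (measurable_coord i measurableT (mF i)).
by apply/seteqP; split => x /= H i; [move=> _|]; apply: H.
Qed.

Lemma measurable_obox d (a b : 'rV[R]_d) : measurable (obox a b).
Proof.
rewrite (_ : obox a b = [set x | forall i, `]a 0 i, b 0 i[%classic (x 0 i)]).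
  by apply: (@measurable_coords d (fun i => `]a 0 i, b 0 i[%classic)).
by apply/seteqP; split => x /= H i; have := H i; rewrite /= in_itv.
Qed.

Definition ratV d (q : 'rV[rat]_d) : 'rV[R]_d := map_mx ratr q.

Lemma rat_between d (x y : 'rV[R]_d) : (forall i, x 0 i < y 0 i) ->
  exists q : 'rV[rat]_d, forall i, x 0 i < ratV q 0 i < y 0 i.
Proof.
move=> xy; have /choice[f Hf] : forall i, exists q : rat, x 0 i < ratr q < y 0 i.
  move=> i; have [q] := rat_in_itvoo (xy i); rewrite in_itv/= => ?; by exists q.
by exists (\row_i f i) => i; rewrite !mxE.
Qed.

(** Rational boxes being countably many, open sets are Borel, and an assertion
    that holds almost everywhere on each of them does so on their union. *)
Lemma rat_obox_nbhs d (x : 'rV[R]_d) (A : set 'rV[R]_d) : nbhs x A ->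
  exists ab : 'rV[rat]_d * 'rV[rat]_d,
    obox (ratV ab.1) (ratV ab.2) x /\ cbox (ratV ab.1) (ratV ab.2) `<=` A.
Proof.
move=> /nbhs_rVP [e e0 H].
have [a Ha] : exists q : 'rV[rat]_d, forall i,
    (x - const_mx e) 0 i < ratV q 0 i < x 0 i.
  by apply: rat_between => i; rewrite !mxE ltrBlDr ltrDl.
have [b Hb] : exists q : 'rV[rat]_d, forall i,
    x 0 i < ratV q 0 i < (x + const_mx e) 0 i.
  by apply: rat_between => i; rewrite !mxE ltrDl.
exists (a, b) => /=; split=> [i|y Hy].
  by have /andP[_ ->] := Ha i; have /andP[-> _] := Hb i.
apply: H => i; have /andP[+ _] := Ha i; have /andP[_] := Hb i; have := Hy i.
rewrite (_ : (x - const_mx e) 0 i = x 0 i - e); last by rewrite !mxE.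
rewrite (_ : (x + const_mx e) 0 i = x 0 i + e); last by rewrite !mxE.
by move=> /andP[h1 h2] h3 h4; rewrite ltr_norml; apply/andP; split; lra.
Qed.

Lemma open_measurable_rV d (U : set 'rV[R]_d) : open U -> measurable U.
Proof.
move=> oU.
rewrite (_ : U = \bigcup_(ab in [set: 'rV[rat]_d * 'rV[rat]_d])
  if pselect (cbox (ratV ab.1) (ratV ab.2) `<=` U)
  then obox (ratV ab.1) (ratV ab.2) else set0).
  apply: countable_bigcupT_measurable => // ab.
  by case: (pselect _) => /= _; [exact: measurable_obox|exact: measurable0].
apply/seteqP; split => [x Ux|x [ab _]].
  have /rat_obox_nbhs [ab [xab abU]] : nbhs x U.
    by move: oU; rewrite openE => /(_ _ Ux).
  by exists ab => //; case: pselect.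
by case: (pselect _) => //= abU xab; apply: abU; exact: obox_cbox.
Qed.

Lemma closed_measurable_rV d (U : set 'rV[R]_d) : closed U -> measurable U.
Proof.
move=> cU; rewrite -[U]setCK; apply: measurableC; apply: open_measurable_rV.
exact: closed_openC.
Qed.

Lemma continuous_measurable_rV d (f : 'rV[R]_d -> R) :
  continuous f -> measurable_fun setT f.
Proof.
move=> cf; apply: (measurability _ (RGenOpens.measurableE R)) => //.
move=> _ [_ [x [y ->]] <-]; rewrite setTI; apply: open_measurable_rV.
by move/continuousP : cf; apply; exact: interval_open.
Qed.

Lemma rV_cons0 n (p : 'rV[R]_n * R) : rV_cons p 0 ord0 = p.2.
Proof. by rewrite mxE unlift_none. Qed.

Lemma rV_consS n (p : 'rV[R]_n * R) k : rV_cons p 0 (lift ord0 k) = p.1 0 k.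
Proof. by rewrite mxE liftK. Qed.

Lemma obox_finite d (a b : 'rV[R]_d) : (lebesgue_rV d (obox a b) < +oo)%E.
Proof.
elim: d a b => [|d IHd] a b.
  by rewrite /= diracE; case: (_ \in _) => /=; rewrite ?ltry.
pose a' : 'rV[R]_d := \row_k a 0 (lift ord0 k).
pose b' : 'rV[R]_d := \row_k b 0 (lift ord0 k).
rewrite /= /lebesgue_succ /pushforward.
rewrite (_ : _ @^-1` _ = obox a' b' `*` `]a 0 ord0, b 0 ord0[%classic); last first.
  apply/seteqP; split => [p /= H|p /= [H1 H2] i].
    split=> [k|]; first by have := H (lift ord0 k); rewrite rV_consS !mxE.
    by have := H ord0; rewrite rV_cons0 in_itv.
  case: (unliftP ord0 i) => [k ->|->]; last by rewrite rV_cons0; rewrite in_itv in H2.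
  by have := H1 k; rewrite rV_consS !mxE.
rewrite product_measure1E//; last exact: measurable_obox.
apply: lte_mul_pinfty => //; first by rewrite ge0_fin_numE.
have := lebesgue_measure_itv `]a 0 ord0, b 0 ord0[ => /= ->.
by case: ifP => // _; rewrite -EFinB ltry.
Qed.

Lemma bounded_finite_measure d (D : set 'rV[R]_d) (M : R) : measurable D ->
  (forall x, D x -> forall i, `|x 0 i| < M) -> (lebesgue_rV d D < +oo)%E.
Proof.
move=> mD DM; apply: le_lt_trans (obox_finite (const_mx (- M)) (const_mx M)).
apply: le_measure; rewrite ?inE//; first exact: measurable_obox.
by move=> x Dx i; rewrite !mxE -ltr_norml; exact: DM.
Qed.

(** The sections of a hyperplane along the first coordinate are points, unless
    its equation does not involve that coordinate; it is then a cylinder over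
    a hyperplane of lower dimension. *)
Lemma hyperplane_null d (n : 'I_d -> R) (c : R) : (exists i, n i != 0) ->
  (lebesgue_rV d).-negligible
    [set x : 'rV[R]_d | (\sum_i n i * x 0 i) = c].
Proof.
have mH k (l : 'I_k -> R) : measurable
    [set x : 'rV[R]_k | (\sum_i l i * x 0 i) = c].
  rewrite (_ : mkset _ =
      (fun x : 'rV[R]_k => \sum_i l i * x 0 i) @^-1` [set c])//.
  rewrite -[X in measurable X]setTI.
  have mf : measurable_fun setT (fun x : 'rV[R]_k => \sum_i l i * x 0 i).
    apply: measurable_sum => i; apply: measurable_funM => //.
    exact: measurable_coord.
  exact: mf.
elim: d n => [n [[]]//|d IHd n [i ni]].
apply/negligibleP; first exact: mH.
rewrite /= /lebesgue_succ /pushforward /product_measure1 /=.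
set S := (X in X @^-1` _ ) .
set P := (_ @^-1` _).
have PE p t : P (p, t) <->
    (n ord0 * t + \sum_k n (lift ord0 k) * p 0 k) = c.
  rewrite /P /= big_ord_recl rV_cons0.
  rewrite (eq_bigr (fun k => n (lift ord0 k) * p 0 k)) // => k _.
  by congr (_ * _); exact: rV_consS.
rewrite -[RHS](integral0 (lebesgue_rV d) setT).
have [n0|n0] := eqVneq (n ord0) 0; last first.
  apply: eq_integral => p _ /=.
  pose t0 : R := ((c - \sum_k n (lift ord0 k) * p 0 k) / n ord0).
  apply/eqP; rewrite -measure_le0 -(lebesgue_measure_set1 t0).
  apply: le_measure; rewrite ?inE//.
    apply: measurable_xsection; rewrite -[X in measurable X]setTI.
    by apply: measurable_rV_cons => //; exact: mH.
  move=> t /xsectionP /PE H /=; rewrite /t0 -H addrK mulrC mulKf//.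
have {ni} nk : exists k, n (lift ord0 k) != 0.
  case: (unliftP ord0 i) ni => [k ->|->]; first by exists k.
  by rewrite n0 eqxx.
apply: ae_eq_integral_any.
have [N [mN N0 subN]] := IHd _ nk; exists N; split => //.
move=> p /=; apply: contra_notP => Np _; apply/eqP.
rewrite (_ : xsection _ _ = set0) ?measure0//.
apply/seteqP; split => // t /xsectionP /PE; rewrite n0 mul0r add0r => H.
by exfalso; apply: Np; exact: subN.
Qed.

Lemma oboxI d (a b a' b' : 'rV[R]_d) : exists a2 b2 : 'rV[R]_d,
  obox a b `&` obox a' b' = obox a2 b2.
Proof.
exists (\row_i Num.max (a 0 i) (a' 0 i)), (\row_i Num.min (b 0 i) (b' 0 i)).
apply/seteqP; split => [x [H1 H2] i|x H].
  by have := H1 i; have := H2 i; rewrite !mxE gt_max lt_min => /andP[-> ->] /andP[-> ->].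
by split => i; have := H i;
  rewrite !mxE gt_max lt_min => /andP[/andP[h1 h2] /andP[h3 h4]]; apply/andP.
Qed.

Definition oboxes d := [set A : set 'rV[R]_d | exists a b, A = obox a b].

Lemma measurable_oboxes d : (@measurable _ 'rV[R]_d) = <<s @oboxes d >>.
Proof.
apply/seteqP; split; last first.
  apply: smallest_sub; first exact: sigma_algebra_measurable.
  by move=> _ [a [b ->]]; exact: measurable_obox.
apply: smallest_sub; first exact: smallest_sigma_algebra.
move=> A; rewrite -bigcup_seq => -[i _] /= [B mB <-]; rewrite setTI.
have mi : measurable_fun setT
    ((fun x : g_sigma_algebraType (@oboxes d) => (x : 'rV[R]_d) 0 i) : _ -> R).
  apply: (measurability _ (RGenOpens.measurableE R)) => //.
  move=> _ [_ [s [t ->]] <-]; rewrite setTI.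
  rewrite (_ : _ @^-1` _ = \bigcup_n obox
    (\row_k (if k == i then s else - n%:R)) (\row_k (if k == i then t else n%:R))).
    by apply: bigcupT_measurable => n; apply: sub_sigma_algebra; eexists; eexists.
  apply/seteqP; split => [x /=|x [n _] /(_ i)]; last by rewrite !mxE eqxx /= in_itv.
  rewrite in_itv/= => xst; exists (Num.truncn `|x|).+1 => // k; rewrite !mxE.
  case: eqP => [->//|_]; rewrite -ltr_norml.
  apply: le_lt_trans (rV_norm_coord _ _) _.
  exact: truncnS_gt.
by have := mi measurableT _ mB; rewrite setTI.
Qed.

(** The sets over which [g] has integral zero form a Dynkin system, so that
    it is enough to know the integrals over boxes. *)
Lemma obox_integral_eq0 d (U : set 'rV[R]_d) (g : 'rV[R]_d -> R) :
  open U -> measurable_fun setT g -> (lebesgue_rV d).-integrable U (EFin \o g) ->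
  (forall a b, cbox a b `<=` U ->
    (\int[lebesgue_rV d]_(x in obox a b) (g x)%:E = 0)%E) ->
  ae_eq_on U g 0.
Proof.
move=> oU mg ig g0; have mU := open_measurable_rV oU.
have H a b : cbox a b `<=` U -> ae_eq_on (obox a b) g 0.
  move=> abU; set Q := obox a b; have mQ : measurable Q by exact: measurable_obox.
  have QU : Q `<=` U by apply: subset_trans abU; exact: obox_cbox.
  have igQ : (lebesgue_rV d).-integrable Q (EFin \o g) by exact: integrableS ig.
  have ih : (lebesgue_rV d).-integrable setT ((EFin \o g) \_ Q).
    exact: (integrable_mkcond _ mQ).1.
  have P0 S : measurable S ->
      (\int[lebesgue_rV d]_(x in S) ((EFin \o g) \_ Q) x = 0)%E.
    rewrite measurable_oboxes => mS; move: S mS.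
    apply: (dynkin_induction (@measurable_oboxes d)).
    - by move=> _ _ [a1 [b1 ->]] [a2 [b2 ->]]; exact: oboxI.
    - by rewrite -integral_mkcond; exact: g0.
    - move=> _ [a1 [b1 ->]]; rewrite -integral_mkcondr.
      have [a2 [b2 E]] := oboxI a1 b1 a b; rewrite /Q E.
      have [/eqP e|/set0P [y0 yE]] := boolP (obox a2 b2 == set0).
        by rewrite e integral_set0.
      apply: g0 => x xab; apply: abU => i.
      have yE0 := yE; have := yE; rewrite -E => -[_ yab].
      (* the corners of a nonempty box contained in [Q] lie in its closure *)
      suff : (a 0 i <= a2 0 i) /\ (b2 0 i <= b 0 i).
        by have := xab i => /andP[h1 h2] [h3 h4]; rewrite (le_trans h3 h1) (le_trans h2 h4).
      have key t : (a2 0 i < t < b2 0 i -> a 0 i < t < b 0 i).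
        move=> ht; have : obox a2 b2 (\row_k if k == i then t else y0 0 k).
          by move=> k; rewrite mxE; case: eqP => [->//|_]; exact: yE0.
        by rewrite -E => -[_ /(_ i)]; rewrite mxE eqxx.
      have /andP[y1 y2] := yE0 i.
      split; rewrite leNgt; apply/negP => lt.
        have := key (Num.min ((a2 0 i + a 0 i) / 2) ((a2 0 i + y0 0 i) / 2)).
        by rewrite !lt_min !gt_min; move: (yab i); lra.
      have := key (Num.max ((b2 0 i + b 0 i) / 2) ((b2 0 i + y0 0 i) / 2)).
      by rewrite !lt_max !gt_max; move: (yab i); lra.
    - move=> S mS S0.
      have : (\int[lebesgue_rV d]_(x in setT) ((EFin \o g) \_ Q) x = 0)%E.
        by rewrite -integral_mkcond; exact: g0.
      rewrite -(setUv S) integral_setU//; first by rewrite S0 add0e.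
      + exact: measurableC.
      + by rewrite setUv; case/integrableP : ih.
      + by apply/disj_setPS; rewrite setICr.
    - move=> F mF tF F0.
      have := @charge_semi_sigma_additive _ _ _ (induced_charge ih) F mF tF
        (bigcupT_measurable _ mF).
      rewrite /induced_charge => /(cvg_unique _); apply => //.
      rewrite (_ : (fun n => _) = cst 0%E); first exact: cvg_cst.
      by apply/funext => n /=; apply: big1 => k _; exact: F0.
  have : ae_eq (lebesgue_rV d) setT ((EFin \o g) \_ Q) (cst 0%E).
    apply: integral_ae_eq => // S _ mS.
    by rewrite P0// integral0.
  apply: filterS => x /(_ I) /=; rewrite patchE => + Qx.
  by rewrite mem_set// => -[].
pose Q (ab : 'rV[rat]_d * 'rV[rat]_d) := obox (ratV ab.1) (ratV ab.2).
pose P k x := forall ab, unpickle k = Some ab ->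
  cbox (ratV ab.1) (ratV ab.2) `<=` U -> Q ab x -> g x = 0.
have : forall k, \forall x \ae lebesgue_rV d, P k x.
  move=> k; rewrite /P; case: unpickle => [ab|]; last exact: aeW.
  have [abU|nabU] := pselect (cbox (ratV ab.1) (ratV ab.2) `<=` U).
    by apply: filterS (H _ _ abU) => x Hx _ [<-] _; exact: Hx.
  by apply: aeW => x _ [<-].
move/ae_foralln; apply: filterS => x Hx Ux.
have /rat_obox_nbhs [ab [xab abU]] : nbhs x U.
  by move: oU; rewrite openE => /(_ _ Ux).
exact: (Hx (pickle ab) ab (pickleK ab)).
Qed.

End rV_geometry.

(** * A smooth function vanishing on the negative half-line *)

Section smooth1.
Context {R : realType}.

Definition derivation_stable1 (S : set (R -> R)) := forall f, S f ->
  continuous f /\ exists2 g, S g & forall x : R, is_derive x 1 f (g x).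

(** The derivatives of exp (- 1 / t), extended by zero, are combinations of these
    functions. *)
Definition bump_term (k : nat) (t : R) : R :=
  if 0 < t then t^-1 ^+ k * expR (- t^-1) else 0.

(** This is [y ^ (k + 1) / (k + 1)! <= exp y] at [y = 1 / t]; applied to [k + 1] it
    gives the derivative zero of [bump_term k] at the origin. *)
Lemma bump_term_le k t : `|bump_term k t| <= (k.+1)`!%:R * `|t|.
Proof.
rewrite /bump_term; case: ifPn => [t0|_]; last by rewrite normr0 mulr_ge0.
have y0 : 0 < t^-1 by rewrite invr_gt0.
rewrite ger0_norm ?mulr_ge0 ?expR_ge0 ?exprn_ge0 ?(ltW y0)// gtr0_norm//.
have := expR_ge1Dxn k (ltW y0).
rewrite expRN => H.
have f0 : 0 < (k.+1)`!%:R :> R by rewrite ltr0n fact_gt0.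
rewrite ler_pdivrMr ?expR_gt0//.
have : t^-1 ^+ k.+1 / (k.+1)`!%:R <= expR t^-1 by apply: le_trans H; rewrite lerDr.
rewrite ler_pdivrMr// exprSr => H2.
have -> : t^-1 ^+ k = t * (t^-1 ^+ k * t^-1) by rewrite mulrCA mulfV ?mulr1// gt_eqF.
have -> : (k.+1)`!%:R * t * expR t^-1 = t * (expR t^-1 * (k.+1)`!%:R) by ring.
by rewrite ler_pM2l.
Qed.

Lemma bump_term_derive k (t : R) :
  is_derive t 1 (bump_term k) (bump_term k.+2 t - k%:R * bump_term k.+1 t).
Proof.
have [t0|t0|->] := ltgtP t 0.
- rewrite !/bump_term ltNge (ltW t0) /= mulr0 subr0.
  have d0 : is_derive t 1 (cst 0 : R -> R) 0 by exact: is_derive_cst.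
  apply: near_eq_is_derive d0.
  near=> s; rewrite /bump_term ifF//; apply/negbTE; rewrite -leNgt ltW//.
  by near: s; exact: lt_nbhsl.
- apply: (@near_eq_is_derive _ _ _
      ((fun s : R => s^-1) ^+ k * (fun s : R => expR (- s^-1)))).
    near=> s; have s0 : 0 < s by near: s; exact: lt_nbhsr.
    rewrite /bump_term s0 exprfctE//.
  have tn0 : t != 0 by rewrite gt_eqF.
  have d1 : is_derive t 1 (fun s : R => s^-1) (- t ^- 2).
    by have := is_deriveV tn0 (is_derive_id t 1) => /is_derive_eq; apply; rewrite [LHS]mulr1.
  have d2 : is_derive t 1 (fun s : R => expR (- s^-1)) (t ^- 2 * expR (- t^-1)).
    have := @is_derive1_comp _ expR (fun s : R => - s^-1) t _ _ (is_derive_expR _) (is_deriveN d1).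
    by move=> /is_derive_eq; apply; rewrite opprK mulrC.
  have := is_deriveM (is_deriveX k d1) d2.
  move=> /is_derive_eq; apply; rewrite !/bump_term t0 !fctE /GRing.scale /=.
  by case: k => [|k] /=; rewrite ?expr0 ?mul0r ?exprSr; field.
- rewrite [bump_term k.+2 0]/bump_term [bump_term k.+1 0]/bump_term ltxx mulr0 subr0.
  have H : (fun h => h^-1 *: ((bump_term k \o shift 0) (h *: (1 : R)) - bump_term k 0))
      @ 0^' --> (0 : R).
    apply/cvgrPdist_le => e e0.
    have E0 : bump_term k 0 = 0 by rewrite /bump_term ltxx.
    near=> h; rewrite sub0r normrN /= addr0 E0 subr0 [h *: 1]mulr1.
    have [h0|h0] := leP h 0; first by rewrite /bump_term (le_gtF h0) scaler0 normr0 ltW.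
    have -> : h^-1 *: bump_term k h = bump_term k.+1 h.
      by rewrite !/bump_term h0 exprS /GRing.scale /= mulrA.
    apply: le_trans (bump_term_le _ _) _.
    have f0 : 0 < (k.+2)`!%:R :> R by rewrite ltr0n fact_gt0.
    rewrite mulrC -ler_pdivlMr//; near: h.
    apply: dnbhs0_le; rewrite divr_gt0//.
  split; first by apply/cvg_ex; exists 0.
  exact/cvg_lim.
Unshelve. all: by end_near. Qed.

Inductive bump_span : (R -> R) -> Prop :=
| bump_span_gen k : bump_span (bump_term k)
| bump_span_lin (a : R) (f g : R -> R) of bump_span f & bump_span g : bump_span (a *: f + g).

Lemma bump_span_stable : derivation_stable1 bump_span.
Proof.
move=> h; elim=> {h} [k|a f g _ [cf [f' Sf' df]] _ [cg [g' Sg' dg]]]; split.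
- move=> x; apply: differentiable_continuous; apply/derivable1_diffP.
  by have [] := bump_term_derive k x.
- exists ((- k%:R) *: bump_term k.+1 + bump_term k.+2).
    by apply: bump_span_lin; exact: bump_span_gen.
  move=> x; have := bump_term_derive k x => /is_derive_eq; apply.
  by rewrite !fctE /GRing.scale /= mulNr addrC.
- move=> x; apply: continuousD; last exact: cg.
  by apply: (continuousM (s := cst a)); [exact: cst_continuous|exact: cf].
- exists (a *: f' + g'); first exact: bump_span_lin.
  by move=> x; apply: is_deriveD.
Qed.

Lemma bump_term0_bound t : 0 <= bump_term 0 t <= 1.
Proof.
rewrite /bump_term; case: ifPn => [t0|_]; last by rewrite lexx ler01.
by rewrite expr0 mul1r expR_ge0 -expR0 ler_expR oppr_le0 invr_ge0 ltW.
Qed.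

Lemma bump_term0_eq0 t : t <= 0 -> bump_term 0 t = 0.
Proof. by move=> t0; rewrite /bump_term ltNge t0. Qed.

Lemma bump_term0_cvg t : 0 < t -> (fun n => bump_term 0 (n.+1%:R * t)) @ \oo --> (1 : R).
Proof.
move=> t0; rewrite (_ : (fun n => _) = fun n => expR (- (n.+1%:R^-1 * t^-1))).
  have h1 : (fun n => - (n.+1%:R^-1 * t^-1)) @ \oo --> - (0 * t^-1).
    by apply: cvgN; apply: cvgM; [exact: cvg_harmonic|exact: cvg_cst].
  have := @cvg_comp _ _ _ _ expR _ _ _ h1 (@continuous_expR R _).
  by rewrite mul0r oppr0 expR0.
apply/funext => n; rewrite /bump_term mulr_gt0// expr0 mul1r invfM//.
Qed.

End smooth1.

(** * Smooth functions and test functions *)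

Section smooth_functions.
Context {R : realType} {d : nat}.
Local Notation E := 'rV[R]_d.
Local Notation leb := (@lebesgue_rV R d).
Implicit Types (D U : set E) (f g u v w phi : E -> R).
Local Notation ei i := (delta_mx 0 i : E).

(** Smoothness in coinductive form: a member of such a set is smooth, which makes
    closure properties provable without computing iterated derivatives. *)
Definition derivation_stable (S : set (E -> R)) := forall f, S f ->
  continuous f /\
  forall i, exists2 g, S g & forall x, is_derive x (ei i) f (g x).

Lemma smooth_stable S f : derivation_stable S -> S f -> smooth f.
Proof.
move=> HS Sf.
have SP s : S (partials s f).
  elim: s => [//|i s IHs]; have [_ /(_ i) [g Sg dg]] := HS _ IHs.
  rewrite (_ : partials (i :: s) f = g)//.
  by apply/funext => x; exact: (derive_val (is_derive := dg x)).
move=> s; have [cs ds] := HS _ (SP s); split => // i x.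
by have [g Sg dg] := ds i; have [] := dg x.
Qed.

Lemma stable_smooth f : smooth f -> derivation_stable (fun g => exists s, g = partials s f).
Proof.
move=> sf _ [s ->]; have [cs ds] := sf s; split=> // i.
by exists (partials (i :: s) f); [exists (i :: s)|move=> x; exact/derivableP].
Qed.

Lemma smooth_continuous f : smooth f -> continuous f.
Proof. by move=> /(_ [::]) []. Qed.

Lemma smooth_derive f i x : smooth f -> is_derive x (ei i) f (partial i f x).
Proof. by move=> /(_ [::]) [_ /(_ i x)] /derivableP. Qed.

Lemma smooth_partial f i : smooth f -> smooth (partial i f).
Proof.
move=> /stable_smooth /smooth_stable; apply.
by exists [:: i].
Qed.

Lemma smooth_lin (a : R) f g : smooth f -> smooth g -> smooth (a *: f + g).
Proof.
move=> /stable_smooth; set F := (X in derivation_stable X) => sF.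
move=> /stable_smooth; set G := (X in derivation_stable X) => sG.
apply: (@smooth_stable [set h | exists f g, [/\ F f, G g & h = a *: f + g]]).
  move=> _ [f1 [g1 [Ff Gg ->]]]; have [cf df] := sF _ Ff; have [cg dg] := sG _ Gg.
  split.
    move=> x; apply: continuousD; last exact: cg.
    by apply: (continuousM (s := cst a)); [exact: cst_continuous|exact: cf].
  move=> i; have [f2 Ff2 df2] := df i; have [g2 Gg2 dg2] := dg i.
  by exists (a *: f2 + g2); [exists f2, g2|move=> x; apply: is_deriveD].
exists f, g; split => //; exists [::] => //.
Qed.

Inductive product_span (F G : set (E -> R)) : (E -> R) -> Prop :=
| product_span_gen f g of F f & G g : product_span F G (f * g)
| product_span_add f g of product_span F G f & product_span F G g :
    product_span F G (f + g).

Lemma smooth_mul f g : smooth f -> smooth g -> smooth (f * g).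
Proof.
move=> /stable_smooth; set F := (X in derivation_stable X) => sF.
move=> /stable_smooth; set G := (X in derivation_stable X) => sG.
apply: (@smooth_stable (product_span F G)); last first.
  by apply: product_span_gen; exists [::].
move=> h; elim=> {h} [f1 g1 Ff Gg|f1 g1 _ [cf df] _ [cg dg]].
  have [cf df] := sF _ Ff; have [cg dg] := sG _ Gg; split.
    by move=> x; apply: continuousM; [exact: cf|exact: cg].
  move=> i; have [f2 Ff2 df2] := df i; have [g2 Gg2 dg2] := dg i.
  exists (f1 * g2 + f2 * g1); first by apply: product_span_add; exact: product_span_gen.
  move=> x; have := is_deriveM (df2 x) (dg2 x).
  move=> /is_derive_eq; apply.
  by rewrite [RHS]addrC [in RHS]mulrC addrC.
split; first by move=> x; apply: continuousD; [exact: cf|exact: cg].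
move=> i; have [f2 Ff2 df2] := df i; have [g2 Gg2 dg2] := dg i.
by exists (f2 + g2); [exact: product_span_add|move=> x; apply: is_deriveD].
Qed.

Lemma smooth_cst (c : R) : smooth (cst c : E -> R).
Proof.
apply: (@smooth_stable [set h | exists c : R, h = cst c]); last by exists c.
move=> _ [k ->]; split; first by move=> x; exact: cst_continuous.
by move=> i; exists (cst 0); [exists 0|move=> x; exact: is_derive_cst].
Qed.

Lemma smooth_prod (I : Type) (r : seq I) (f : I -> E -> R) :
  (forall i, smooth (f i)) -> smooth (\prod_(i <- r) f i).
Proof.
move=> sf; elim: r => [|i r IHr]; first by rewrite big_nil; exact: (smooth_cst 1).
by rewrite big_cons; apply: smooth_mul.
Qed.

Lemma is_derive_line (x v : E) (f : E -> R) (df : R) :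
  is_derive (0 : R) 1 (fun t : R => f (t *: v + x)) df -> is_derive x v f df.
Proof.
move=> [dl <-]; split; first exact/derivable1P.
rewrite /derive; set g1 := fun h => h^-1 *: _; set g2 := fun h => h^-1 *: _.
suff -> : g1 = g2 by [].
by rewrite funeqE /g1 /g2 => h /=; rewrite addr0 scale0r add0r [_%:A]mulr1.
Qed.

(** The stable set in [d] variables consists of scalar multiples, which absorb the
    factors produced by the chain rule. *)
Lemma smooth_coord_comp (S : set (R -> R)) (h : R -> R) (i : 'I_d) (a b : R) :
  derivation_stable1 S -> S h -> smooth (fun x : E => h (a * x 0 i + b)).
Proof.
move=> HS Sh; apply: (@smooth_stable [set f | exists (c : R) (g : R -> R), S g /\
  f = fun x : E => c * g (a * x 0 i + b)]); last first.
  by exists 1, h; split => //; apply/funext => x; rewrite mul1r.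
move=> _ [c [g [Sg ->]]]; have [cg [g' Sg' dg]] := HS _ Sg; split.
  move=> x; apply: (continuousM (s := cst c)); first exact: cst_continuous.
  apply: (continuous_comp (f := fun x : E => a * x 0 i + b) (g := g)); last exact: cg.
  apply: continuousD; last exact: cst_continuous.
  by apply: (continuousM (s := cst a)); [exact: cst_continuous|exact: coord_continuous].
move=> k; exists (fun x => (c * (a * (k == i)%:R)) * g' (a * x 0 i + b)).
  by exists (c * (a * (k == i)%:R)), g'; split.
move=> x; apply: is_derive_line.
set al := a * (k == i)%:R.
rewrite (_ : (fun t : R => _) = c *: (g \o (fun t : R => al * t + (a * x 0 i + b)))).
  have d1 : is_derive (0 : R) 1 (fun t : R => al * t + (a * x 0 i + b)) al.
    have := is_deriveD (is_deriveZ al (is_derive_id (0 : R) 1))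
      (is_derive_cst (a * x 0 i + b) (0 : R) 1).
    by move=> /is_derive_eq; apply; rewrite addr0 [LHS]mulr1.
  have d2 : is_derive (al * 0 + (a * x 0 i + b)) 1 g (g' (a * x 0 i + b)).
    by rewrite mulr0 add0r.
  have := is_deriveZ c (@is_derive1_comp _ g (fun t : R => al * t + (a * x 0 i + b)) 0 _ _ d2 d1).
  by move=> /is_derive_eq; apply; rewrite /GRing.scale /=; ring.
apply/funext => t; rewrite !fctE /= !mxE eqxx /=; congr (c * g _).
by rewrite /al eq_sym; ring.
Qed.

Lemma smooth_coord (i : 'I_d) : smooth (fun x : E => x 0 i).
Proof.
pose S := [set f : R -> R | f = id \/ exists c : R, f = cst c].
have HS : derivation_stable1 S.
  move=> _ [->|[c ->]]; split.
  - by move=> x; exact: cvg_id.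
  - by exists (cst 1); [right; exists 1|move=> x; exact: is_derive_id].
  - by move=> x; exact: cvg_cst.
  - by exists (cst 0); [right; exists 0|move=> x; exact: is_derive_cst].
have := smooth_coord_comp i 1 0 HS (or_introl erefl).
rewrite (_ : (fun x : E => _) = (fun x : E => x 0 i))//.
by apply/funext => x /=; rewrite mul1r addr0.
Qed.

Lemma partial_lin (a : R) f g i : smooth f -> smooth g ->
  partial i (a *: f + g) = a *: partial i f + partial i g.
Proof.
move=> sf sg; apply/funext => x.
have := is_deriveD (is_deriveZ a (smooth_derive i x sf)) (smooth_derive i x sg).
by move=> H; exact: (derive_val (is_derive := H)).
Qed.

Lemma partial_coord_mul f i : smooth f ->
  partial i ((fun x : E => x 0 i) * f) = f + (fun x : E => x 0 i) * partial i f.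
Proof.
move=> sf; apply/funext => x.
have := is_deriveM (smooth_derive i x (smooth_coord i)) (smooth_derive i x sf).
move=> H; rewrite [LHS](derive_val (is_derive := H)) !fctE /GRing.scale /= addrC.
congr (_ + _); rewrite -[RHS]mulr1; congr (_ * _).
have d1 : is_derive x (ei i) (fun x : E => x 0 i) 1.
  apply: is_derive_line.
  rewrite (_ : (fun t : R => _) = (fun t : R => t + x 0 i)).
    exact: is_derive_shift.
  by apply/funext => t; rewrite !mxE !eqxx mulr1.
exact: (derive_val (is_derive := d1)).
Qed.

(** These functions take values in [[0, 1]] and converge pointwise to the indicator
    function of the open box, so that dominated convergence applies to them. *)
Definition box_bump (a b : E) (n : nat) : E -> R :=
  (\prod_i (fun x : E => bump_term 0 (n.+1%:R * x 0 i + n.+1%:R * - a 0 i)))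
  * (\prod_i (fun x : E => bump_term 0 (- n.+1%:R * x 0 i + n.+1%:R * b 0 i))).

Lemma prod_fctE (I : Type) (r : seq I) (f : I -> E -> R) x :
  (\prod_(i <- r) f i) x = \prod_(i <- r) f i x.
Proof.
elim: r => [|i r IHr]; first by rewrite !big_nil.
by rewrite !big_cons -IHr.
Qed.

Lemma box_bumpE a b n x : box_bump a b n x =
  (\prod_i bump_term 0 (n.+1%:R * (x 0 i - a 0 i)))
  * (\prod_i bump_term 0 (n.+1%:R * (b 0 i - x 0 i))).
Proof.
have -> : box_bump a b n x = (\prod_i (fun x : E => bump_term 0 (n.+1%:R * x 0 i + n.+1%:R * - a 0 i))) x *
  (\prod_i (fun x : E => bump_term 0 (- n.+1%:R * x 0 i + n.+1%:R * b 0 i))) x by [].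
rewrite !prod_fctE; congr (_ * _); apply: eq_bigr => i _; congr bump_term; ring.
Qed.

Lemma smooth_box_bump a b n : smooth (box_bump a b n).
Proof.
rewrite /box_bump; apply: smooth_mul; apply: smooth_prod => i;
  by apply: smooth_coord_comp bump_span_stable _; exact: bump_span_gen.
Qed.

Lemma box_bump_eq0 a b n x : ~ obox a b x -> box_bump a b n x = 0.
Proof.
move=> /existsNP [i]; move/negP; rewrite negb_and -!leNgt box_bumpE.
move=> /orP[h|h].
  rewrite (bigD1 i)//= (@bump_term0_eq0 R (_ * (x 0 i - a 0 i))) ?mul0r//.
  by rewrite pmulr_rle0// subr_le0.
rewrite [X in _ * X](bigD1 i)//= (@bump_term0_eq0 R (_ * (b 0 i - x 0 i))) ?mul0r ?mulr0//.
by rewrite pmulr_rle0// subr_le0.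
Qed.

Lemma box_bump_bound a b n x : `|box_bump a b n x| <= 1.
Proof.
rewrite box_bumpE normrM !normr_prod.
have H (f : 'I_d -> R) : \prod_i `|bump_term 0 (f i)| <= 1.
  apply: prodr_ile1 => i _.
  by have /andP[h0 h1] := bump_term0_bound (f i); rewrite normr_ge0 ger0_norm.
by rewrite mulr_ile1// prodr_ge0.
Qed.

Lemma box_bump_cvg a b x :
  (fun n => box_bump a b n x) @ \oo --> (\1_(obox a b) x : R).
Proof.
have [xab|nxab] := pselect (obox a b x).
  rewrite indicE mem_set//=.
  rewrite (_ : (fun n => _) = fun n => (\prod_i bump_term 0 (n.+1%:R * (x 0 i - a 0 i)))
  * (\prod_i bump_term 0 (n.+1%:R * (b 0 i - x 0 i)))).
    have H (f : 'I_d -> R) : (forall i, 0 < f i) ->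
        (fun n => \prod_i bump_term 0 (n.+1%:R * f i)) @ \oo --> (1 : R).
      move=> f0.
      elim: (index_enum _) => [|i r IHr].
        rewrite (_ : (fun n => _) = cst 1); first exact: cvg_cst.
        by apply/funext => n; rewrite big_nil.
      rewrite (_ : (fun n => _) = fun n => bump_term 0 (n.+1%:R * f i) *
        \prod_(j <- r) bump_term 0 (n.+1%:R * f j)).
        by have H := cvgM (bump_term0_cvg (f0 i)) IHr; rewrite mulr1 in H; exact: H.
      by apply/funext => n; rewrite big_cons.
    have h1 i : 0 < x 0 i - a 0 i by have /andP[] := xab i; rewrite subr_gt0.
    have h2 i : 0 < b 0 i - x 0 i by have /andP[] := xab i; rewrite subr_gt0.
    by have H' := cvgM (H _ h1) (H _ h2); rewrite mulr1 in H'; exact: H'.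
  by apply/funext => n; rewrite box_bumpE.
rewrite indicE memNset//= (_ : (fun n => _) = cst 0); first exact: cvg_cst.
by apply/funext => n; rewrite box_bump_eq0.
Qed.

Lemma closed_cbox (a b : E) : closed (cbox a b).
Proof.
rewrite (_ : cbox a b = \bigcap_(i in [set: 'I_d])
    ((fun x : E => x 0 i) @^-1` `[a 0 i, b 0 i]%classic)).
  apply: closed_bigI => i _; apply: closed_comp; last exact: interval_closed.
  by move=> x _; exact: coord_continuous.
by apply/seteqP; split => x /= H i; [move=> _|]; have := H i; rewrite /= in_itv//=; apply.
Qed.

Lemma compact_cbox (a b : E) : compact (cbox a b).
Proof.
rewrite (_ : cbox a b = [set v : 'rV[R]_d | forall i, `[a 0 i, b 0 i]%classic (v ord0 i)]).
  by apply: (@rV_compact _ _ (fun i => `[a 0 i, b 0 i]%classic)) => i; exact: segment_compact.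
by apply/seteqP; split => x /= H i; have := H i; rewrite /= in_itv.
Qed.

Lemma test_box_bump U (a b : E) n : cbox a b `<=` U -> test_function U (box_bump a b n).
Proof.
move=> abU.
have sub : closure [set x | box_bump a b n x != 0] `<=` cbox a b.
  have cE : cbox a b = closure (cbox a b) by apply/closure_id; exact: closed_cbox.
  rewrite [X in _ `<=` X]cE.
  apply: closure_subset => x /= /eqP h; apply: obox_cbox.
  by apply: contrapT => nx; apply: h; exact: box_bump_eq0.
split; [exact: smooth_box_bump| |exact: subset_trans abU].
by apply: subclosed_compact sub; [exact: closed_closure|exact: compact_cbox].
Qed.

Definition coord_bounded D := exists M : R, forall x, D x -> forall i, `|x 0 i| < M.

Lemma coord_bounded_finite D : measurable D -> coord_bounded D -> (leb D < +oo)%E.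
Proof. by move=> mD [M DM]; exact: bounded_finite_measure DM. Qed.

Lemma compact_coord_bounded D : compact D -> coord_bounded D.
Proof.
move=> /compact_bounded /ex_strict_bound_gt0 [M M0 DM]; exists M => x Dx i.
by apply: le_lt_trans (rV_norm_coord _ _) _; exact: DM.
Qed.

Lemma coord_boundedS D U : U `<=` D -> coord_bounded D -> coord_bounded U.
Proof. by move=> UD [M DM]; exists M => x /UD; exact: DM. Qed.

Lemma L2_cst D (c : R) : measurable D -> coord_bounded D -> L2 D (cst c).
Proof.
move=> mD bD; split; first by exists (cst c) => //; exact: ae_eq_on_refl.
rewrite (eq_integral (cst (c ^+ 2)%:E))//.
by rewrite integral_cst// lte_mul_pinfty// ?lee_fin ?sqr_ge0// coord_bounded_finite.
Qed.

Lemma continuous_L2 D f : measurable D -> coord_bounded D -> continuous f -> L2 D f.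
Proof.
move=> mD /[dup] bD [M DM] cf.
have : compact (f @` cbox (const_mx (- M)) (const_mx M)).
  apply: continuous_compact; last exact: compact_cbox.
  exact: continuous_subspaceT.
move=> /compact_bounded /ex_strict_bound_gt0 [N N0 fN].
apply: (L2_dominated mD _ (L2_cst N mD bD)).
  by exists f; [exact: continuous_measurable_rV|exact: ae_eq_on_refl].
apply: aeW => x Dx; rewrite (gtr0_norm N0); apply: ltW; apply: fN; exists x => // i.
by rewrite !mxE -ler_norml ltW// DM.
Qed.

Lemma test_lin U (a : R) f g :
  test_function U f -> test_function U g -> test_function U (a *: f + g).
Proof.
move=> [sf cf fU] [sg cg gU].
have sub : closure [set x | (a *: f + g) x != 0] `<=`
    closure [set x | f x != 0] `|` closure [set x | g x != 0].
  rewrite -closureU; apply: closure_subset => x /=; apply: contraPP.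
  move=> /not_orP [/negP + /negP]; rewrite !negbK => /eqP fx /eqP gx.
  have -> : (a *: f + g) x = a * f x + g x by [].
  by rewrite fx gx mulr0 addr0 eqxx.
split; first exact: smooth_lin.
- apply: subclosed_compact sub; first exact: closed_closure.
  exact: compactU.
- by apply: (subset_trans sub); rewrite subUset.
Qed.

Lemma test_coord_mul U i f :
  test_function U f -> test_function U ((fun x : E => x 0 i) * f).
Proof.
move=> [sf cf fU].
have sub : closure [set x | ((fun x : E => x 0 i) * f) x != 0] `<=`
    closure [set x | f x != 0].
  by apply: closure_subset => x /=; rewrite fctE mulf_eq0 negb_or => /andP[].
split; last exact: subset_trans fU.
  by apply: smooth_mul => //; exact: smooth_coord.
by apply: subclosed_compact sub => //; exact: closed_closure.
Qed.

Lemma test0 U : test_function U (0 : E -> R).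
Proof.
have -> : test_function U (0 : E -> R) = test_function U (cst 0) by [].
split; first exact: smooth_cst.
  rewrite (_ : [set x | _] = set0) ?closure0; first exact: compact0.
  by apply/seteqP; split => x //=; rewrite eqxx.
rewrite (_ : [set x | _] = set0) ?closure0//.
by apply/seteqP; split => x //=; rewrite eqxx.
Qed.

Lemma testS U V phi : U `<=` V -> test_function U phi -> test_function V phi.
Proof. by move=> UV [sf cf fU]; split=> //; exact: subset_trans UV. Qed.

Lemma test_partial_out U phi i x : test_function U phi -> ~ U x ->
  phi x = 0 /\ partial i phi x = 0.
Proof.
move=> [sf cf fU] nUx.
have nx : (~` closure [set x | phi x != 0]) x by move=> /fU.
have near0 : \near x, phi x = (cst 0 : E -> R) x.
  have : open (~` closure [set x | phi x != 0]) by apply: closed_openC; exact: closed_closure.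
  rewrite openE => /(_ _ nx); apply: filterS => y ny /=.
  apply: contrapT => /eqP h; apply: ny; exact: subset_closure.
split; first exact: (nbhs_singleton near0).
rewrite /partial (near_eq_derive (ei i) near0).
exact: derive_cst.
Qed.

(** * The fundamental lemma of the calculus of variations *)

Lemma L2_ae_integrable D g : measurable D -> coord_bounded D -> L2 D g -> ae_integrable D g.
Proof.
move=> mD bD Lg; have := L2_mul mD Lg (L2_cst 1 mD bD).
by apply: ae_integrable_ae; apply: ae_eq_on_eq => x _; rewrite fctE mulr1.
Qed.

(** Testing with bumps that approach the indicator function of a box shows that
    the integral of [g] over every box vanishes. *)
Lemma variational_eq0 U g : open U -> coord_bounded U -> L2 U g ->
  (forall phi, test_function U phi -> \int[leb]_(x in U) (g x * phi x) = 0) ->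
  ae_eq_on U g 0.
Proof.
move=> oU bU Lg g0; have mU := open_measurable_rV oU.
have [h [mh gh ih]] := L2_ae_integrable mU bU Lg.
apply: (ae_eq_on_trans gh); apply: obox_integral_eq0 => // a b abU.
set Q := obox a b; have mQ : measurable Q by exact: measurable_obox.
have QU : Q `<=` U by apply: subset_trans abU; exact: obox_cbox.
pose f_ n x := ((h x * box_bump a b n x)%:E : \bar R).
have mbump n : measurable_fun setT (box_bump a b n).
  by apply: continuous_measurable_rV; apply: smooth_continuous; exact: smooth_box_bump.
have mf_ n : measurable_fun U (f_ n).
  apply/measurable_EFinP; apply: (@measurable_funS _ _ _ _ setT) => //.
  exact: measurable_funM.
have mf : measurable_fun U (fun x => (h x * \1_Q x)%:E).
  apply/measurable_EFinP; apply: (@measurable_funS _ _ _ _ setT) => //.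
  apply: measurable_funM => //; exact: measurable_indic.
have f_f : {ae leb, forall x, U x -> f_ ^~ x @ \oo --> (h x * \1_Q x)%:E}.
  apply: aeW => x Ux; apply: cvg_EFin; first exact: nearW.
  by apply: cvgMr; exact: box_bump_cvg.
have f_g : {ae leb, forall x n, U x -> (`|f_ n x| <= (`|h x|)%:E)%E}.
  apply: aeW => x n Ux; rewrite lee_fin normrM -[leRHS]mulr1 ler_wpM2l//.
  exact: box_bump_bound.
have ig : leb.-integrable U (fun x => (`|h x|)%:E).
  exact: integrable_norm.
have [_ _] := dominated_convergence mU mf_ mf f_f ig f_g.
rewrite (_ : [sequence _]_n = cst 0%E); last first.
  apply/funext => n /=.
  have tphi : test_function U (box_bump a b n) by exact: test_box_bump.
  have := g0 _ tphi; rewrite (@Rintegral_ae _ _ _ _ (h * box_bump a b n)); last first.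
    by apply: filterS gh => x gh Ux; rewrite gh.
  rewrite /Rintegral => /(congr1 (@EFin R)); rewrite fineK//.
  apply: integrable_fin_num => //.
  apply: le_integrable ih => //; first exact: mf_.
  move=> x Ux /=; rewrite lee_fin normrM -[leRHS]mulr1 ler_wpM2l//.
  exact: box_bump_bound.
move=> H; have <- : (\int[leb]_(x in U) (h x * \1_Q x)%:E = 0)%E.
  by apply: (cvg_unique _ H); [exact: ereal_hausdorff|exact: cvg_cst].
rewrite -[in LHS](setIidr QU) integral_mkcondr.
apply: eq_integral => x _; rewrite /patch indicE.
by case: ifPn => _ /=; rewrite ?mulr1 ?mulr0.
Qed.

End smooth_functions.

(** * Polytopes and meshes *)

Section null_sets.
Context {R : realType} {d : nat}.
Local Notation E := 'rV[R]_d.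
Local Notation leb := (@lebesgue_rV R d).

Lemma ae_forall_fin (I : finType) (P : I -> E -> Prop) :
  (forall i, {ae leb, forall x, P i x}) -> {ae leb, forall x, forall i, P i x}.
Proof.
exact: filter_forall.
Qed.

Lemma negligible_finite_bigcup (I : choiceType) (A : set I) (F : I -> set E) :
  finite_set A -> (forall i, A i -> leb.-negligible (F i)) ->
  leb.-negligible (\bigcup_(i in A) F i).
Proof.
move=> /finite_seqP [s ->]; elim: s => [|i s IHs] H.
  by apply: negligibleS (negligible_set0 _) => x [].
rewrite (_ : \bigcup_(j in _) F j = F i `|` \bigcup_(j in [set` s]) F j).
  apply: negligibleU; first by apply: H; rewrite /= mem_head.
  by apply: IHs => j js; apply: H; rewrite /= in_cons [j \in s]js orbT.
apply/seteqP; split => x.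
  move=> [j /=]; rewrite in_cons => /orP[/eqP -> Fx|js Fx]; first by left.
  by right; exists j.
move=> [Fx|[j /= js Fx]]; first by exists i => //=; rewrite mem_head.
by exists j => //=; rewrite in_cons js orbT.
Qed.

(** A kernel vector of [M^T] is normal to a hyperplane that contains the affine
    hull. *)
Lemma low_dim_null (G : set E) l : (l < d)%N -> has_dim l G -> leb.-negligible G.
Proof.
move=> ld [_ [a [M [rM GM]]]].
have GA : G `<=` affine_hull G.
  move=> x Gx; exists 1%N, (fun=> x), (fun=> 1); split => //; first by rewrite big_ord1.
  by rewrite big_ord1 scale1r.
have : kermx M^T != 0.
  by rewrite -mxrank_eq0 mxrank_ker mxrank_tr rM subn_eq0 -ltnNge.
move=> /rowV0Pn [v /sub_kermxP vM v0].
have [i vi] : exists i, v 0 i != 0.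
  apply/not_existsP => H; move/eqP: v0; apply; apply/rowP => i; rewrite mxE.
  by apply/eqP; move: (H i) => /negP; rewrite negbK.
have hn : exists i, v 0 i != 0 by exists i.
apply: negligibleS (hyperplane_null (n := fun i => v 0 i)
  (\sum_i v 0 i * a 0 i) hn).
move=> x /GA; rewrite GM /= => /submxP [y xE].
apply/eqP; rewrite -subr_eq0 -sumrB.
have H : (x - a) *m v^T = 0 by rewrite xE -mulmxA -[M]trmxK -trmx_mul vM trmx0 mulmx0.
have := congr1 (fun B : 'M[R]_1 => B 0 0) H; rewrite [RHS]mxE mxE => H0.
apply/eqP; rewrite -[RHS]H0.
by apply: eq_bigr => k _; rewrite !mxE -mulrBr mulrC.
Qed.

End null_sets.

Section polytopes.
Context {R : realType} {d : nat}.
Local Notation E := 'rV[R]_d.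
Local Notation leb := (@lebesgue_rV R d).

Lemma continuous_sum_fin n (T : topologicalType) (f : 'I_n -> T -> R) :
  (forall i, continuous (f i)) -> continuous (fun x => \sum_i f i x).
Proof.
move=> cf; rewrite (_ : (fun x => _) = \sum_i f i); last first.
  by apply/funext => x; rewrite fct_sumE.
elim: (index_enum _) => [|i r IHr x]; first by rewrite big_nil; exact: cst_continuous.
by rewrite big_cons; apply: continuousD; [exact: cf|exact: IHr].
Qed.

Lemma compact_closed_rV (A : set E) : compact A -> closed A.
Proof. by apply: compact_closed; exact: norm_hausdorff. Qed.

Lemma continuous_rV (T : topologicalType) (f : T -> E) :
  (forall k, continuous (fun t => f t 0 k)) -> continuous f.
Proof.
move=> cf t A /nbhs_rVP [e e0 HA].
have : \forall s \near t, forall k, `|f s 0 k - f t 0 k| < e.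
  apply: filter_forall => k.
  have : nbhs (f t 0 k) (ball (f t 0 k) e) by exact: nbhsx_ballx.
  move=> /(cf k t) B; apply: (@filterS _ (nbhs t) _ _ _ _ B) => s.
  by rewrite /ball /= distrC.
by apply: filterS => s H; exact: HA.
Qed.

(** The hull is the image of the compact standard simplex. *)
Lemma compact_hull n (p : 'I_n -> E) : compact (hull p).
Proof.
pose S := cbox (const_mx 0 : 'rV[R]_n) (const_mx 1)
  `&` (fun t : 'rV[R]_n => \sum_i t 0 i) @^-1` [set 1].
have cS : compact S.
  apply: compact_closedI; first exact: compact_cbox.
  apply: closed_comp; last exact: closed_eq.
  move=> t _; apply: continuous_sum_fin => i; exact: coord_continuous.
pose f (t : 'rV[R]_n) : E := \sum_i t 0 i *: p i.
have cf : continuous f.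
  apply: continuous_rV => k.
  rewrite (_ : (fun t => f t 0 k) = fun t : 'rV[R]_n => \sum_i t 0 i * p i 0 k).
    apply: continuous_sum_fin => i x; apply: continuousM; last exact: cst_continuous.
    exact: coord_continuous.
  by apply/funext => s; rewrite /f summxE; apply: eq_bigr => i _; rewrite mxE.
rewrite (_ : hull p = f @` S).
  by apply: continuous_compact => //; exact: continuous_subspaceT.
apply/seteqP; split => [x [t [t0 t1 ->]]|_ [t [t01 t1] <-]].
  exists (\row_i t i).
    split=> [i|]; last by rewrite /=; under eq_bigr do rewrite mxE.
    rewrite !mxE t0 /= -t1 (bigD1 i)//= lerDl sumr_ge0//.
  by rewrite /f; apply: eq_bigr => i _; rewrite mxE.
exists (fun i => t 0 i); split => // i.
by have := t01 i; rewrite !mxE => /andP[].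
Qed.

Section polytope.
Variables (Omega : set E) (hO : convex_polytope Omega).

Lemma polytope_open : open Omega.
Proof. by case: hO => _ [n [p ->]]; exact: open_interior. Qed.

Lemma polytope_bounded : coord_bounded Omega.
Proof.
case: hO => _ [n [p ->]]; apply: coord_boundedS (@interior_subset _ _) _.
by apply: compact_coord_bounded; exact: compact_hull.
Qed.

Lemma polytope_measurable : measurable Omega.
Proof. exact: open_measurable_rV polytope_open. Qed.

(** The closure of the interior of a closed set stays in that set.  As a
    consequence the interior of a mesh cell, which is only known to lie in the
    closure of the domain, lies in the domain. *)
Lemma polytope_regular_open : (closure Omega)° = Omega.
Proof.
apply/seteqP; split; last first.
  rewrite -open_subsetE; last exact: polytope_open.
  exact: subset_closure.
case: hO => _ [n [p ->]]; apply: interiorS.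
have : closed (hull p) by apply: compact_closed_rV; exact: (@compact_hull n p).
move=> /closure_id cl; rewrite [X in _ `<=` X]cl.
by apply: closure_subset; exact: interior_subset.
Qed.

End polytope.

Lemma cell_compact (K : set E) faces : polytope_with_faces K faces -> compact K.
Proof. by move=> [fd _ H _ _]; have [] := H d K; rewrite ?fd. Qed.

(** The relative boundary of a cell is the finite union of its faces of dimension
    [d - 1], which are null, and the relative interior of a set of full dimension
    lies in its interior. *)
Lemma cell_boundary_null (K : set E) faces : (0 < d)%N ->
  polytope_with_faces K faces -> leb.-negligible (K `\` K°).
Proof.
move=> d0 [fd ff H _ _]; have [_ dimK _ bdK] : [/\ compact K, has_dim d K,
    K = closure (rel_interior K) & K `\` rel_interior K =
      \bigcup_(G in [set G | G `<=` K /\ exists2 l, d = l.+1 & faces l G]) G].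
  by apply: (H d K); rewrite fd.
have affT : affine_hull K = setT.
  have [_ [a [M [rM ->]]]] := dimK; apply/seteqP; split => // x _ /=.
  by apply: submx_full; rewrite /row_full rM.
have sub : rel_interior K `<=` K°.
  move=> x [Kx [e e0 xe]]; apply/nbhs_rVP.
  have d0' : 0 < d%:R :> R by rewrite ltr0n.
  pose r := Num.sqrt (e ^+ 2 / d%:R).
  have r0 : 0 < r by rewrite sqrtr_gt0 divr_gt0// exprn_gt0.
  exists r => // y yx; apply: xe; first by rewrite affT.
  rewrite /enorm -[ltRHS]gtr0_norm// -sqrtr_sqr ltr_sqrt ?exprn_gt0//.
  apply: (@lt_le_trans _ _ (\sum_(i < d) r ^+ 2)); last first.
    rewrite sumr_const card_ord sqr_sqrtr; last by rewrite divr_ge0 ?sqr_ge0// ler0n.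
    by rewrite -[_ *+ d]mulr_natr mulfVK// gt_eqF.
  apply: ltr_sum; first by apply/hasP; exists (Ordinal d0) => //; rewrite mem_index_enum.
  move=> i _; rewrite !mxE -(real_normK (num_real _)).
  by rewrite ltrXn2r ?nnegrE ?(ltW r0)// yx.
suff : leb.-negligible (K `\` rel_interior K).
  by apply: negligibleS => x [Kx nx]; split => // /sub.
rewrite bdK; apply: negligible_finite_bigcup.
  apply: (@sub_finite_set _ _ (faces d.-1)); last exact: ff.
  by move=> G [_ [l dl]]; rewrite dl.
move=> G [_ [l dl fG]]; have [_ dimG _ _] := H _ _ fG.
by apply: low_dim_null dimG; rewrite dl.
Qed.

Section mesh.
Variables (Omega : set E) (Kh : @mesh R d).
Hypotheses (d0 : (0 < d)%N) (hO : convex_polytope Omega)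
  (hK : polytopal_mesh Omega Kh).

Let mO := polytope_measurable hO.
Let bO := polytope_bounded hO.

Lemma cell_closed K : cells Kh K -> closed K.
Proof.
case: hK => _ H _ _ /H /cell_compact cK.
exact: compact_closed_rV.
Qed.

Lemma cell_boundary K : cells Kh K -> leb.-negligible (K `\` K°).
Proof. by case: hK => _ H _ _ /H; exact: cell_boundary_null. Qed.

Lemma cell_interior_sub K : cells Kh K -> K° `<=` Omega.
Proof.
case: hK => _ _ U _ KK; rewrite -(polytope_regular_open hO); apply: interiorS.
by rewrite -U => x Kx; exists K.
Qed.

Lemma cells_ae_disjoint K K' : cells Kh K -> cells Kh K' -> K <> K' ->
  leb.-negligible (K `&` K').
Proof.
case: hK => _ _ _ H cK cK' KK'.
apply: negligibleS (negligibleU (cell_boundary cK) (cell_boundary cK')).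
move=> x [Kx K'x]; have [xi|nx] := pselect (K° x); last by left.
right; split => // xi'.
by have : (K° `&` K'°) x by []; rewrite H.
Qed.

Lemma cells_enum : exists N (K : 'I_N -> set E),
  injective K /\ cells Kh = range K.
Proof.
case: hK => /finite_seqP [s sE] _ _ _.
have us : uniq (undup s) by exact: undup_uniq.
exists (size (undup s)), (fun i => nth set0 (undup s) i); split.
  by move=> i j /eqP; rewrite nth_uniq// => /eqP /val_inj.
rewrite sE; apply/seteqP; split => [K /=|_ [i _ <-] /=]; last first.
  by rewrite -(mem_undup s) mem_nth.
rewrite -(mem_undup s) => Ks; have Hi : (index K (undup s) < size (undup s))%N by rewrite index_mem.
by exists (Ordinal Hi) => //=; rewrite nth_index.
Qed.

Lemma ae_eq_cells (u v : E -> R) :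
  (forall K, cells Kh K -> ae_eq_on K° u v) -> ae_eq_on Omega u v.
Proof.
move=> H; have [N [K [Kinj KE]]] := cells_enum.
have cK i : cells Kh (K i) by rewrite KE; exists i.
have h1 : {ae leb, forall x, forall i, (K i)° x -> u x = v x}.
  by apply: ae_forall_fin => i; exact: H.
have h2 : {ae leb, forall x, forall i, ~ (K i `\` (K i)°) x}.
  apply: ae_forall_fin => i; apply: negligibleS (cell_boundary (cK i)).
  by move=> x /contrapT.
apply: filterS2 h1 h2 => x h1 h2 Ox.
have : closure Omega x by exact: subset_closure.
case: hK => _ _ <- _ [L]; rewrite KE => -[i _ <-] Kx.
apply: (h1 i); apply: contrapT => nx; exact: (h2 i).
Qed.

(** * Piecewise polynomials and the projection onto them *)

Definition monomial k (e : {ffun 'I_d -> 'I_k.+1}) (x : E) : R :=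
  \prod_i x 0 i ^+ e i.

Lemma poly_deg_le_lin k (a : R) p q :
  poly_deg_le k p -> poly_deg_le k q -> poly_deg_le k (a *: p + q : E -> R).
Proof.
move=> [b pE] [c qE]; exists (fun e => a * b e + c e) => x.
have -> : (a *: p + q) x = a * p x + q x by [].
rewrite pE qE big_distrr -big_split; apply: eq_bigr => e _ /=.
by rewrite mulrDl mulrA.
Qed.

Lemma poly_deg_le0 k : poly_deg_le k (0 : E -> R).
Proof. by exists (fun=> 0) => x; rewrite big1// => e _; rewrite mul0r. Qed.

Lemma poly_deg_le_monomial k (e : {ffun 'I_d -> 'I_k.+1}) :
  (\sum_i e i <= k)%N -> poly_deg_le k (monomial e).
Proof.
move=> ek; exists (fun e' => (e' == e)%:R) => x.
rewrite [RHS](bigD1 e)//= eqxx mul1r [X in _ + X]big1 ?addr0//.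
by move=> e' /andP[_ /negPf ->]; rewrite mul0r.
Qed.

Lemma poly_deg_le_sum k (I : finType) (P : pred I) (a : I -> R) (p : I -> E -> R) :
  (forall i, P i -> poly_deg_le k (p i)) ->
  poly_deg_le k (fun x => \sum_(i | P i) a i * p i x).
Proof.
move=> H.
rewrite (_ : (fun x => _) = \sum_(i | P i) a i *: p i).
  elim/big_rec : _ => [|i q Pi hq]; first exact: poly_deg_le0.
  by apply: poly_deg_le_lin => //; exact: H.
by apply/funext => x; rewrite fct_sumE.
Qed.

Lemma poly_deg_leW k k' (p : E -> R) : (k <= k')%N -> poly_deg_le k p -> poly_deg_le k' p.
Proof.
move=> kk' [a pE]; rewrite (_ : p = fun x => \sum_(e : {ffun 'I_d -> 'I_k.+1} |
    (\sum_i e i <= k)%N) a e * monomial e x); last exact/funext.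
apply: poly_deg_le_sum => e ek.
have kk : (k.+1 <= k'.+1)%N by [].
pose e' : {ffun 'I_d -> 'I_k'.+1} := [ffun i => widen_ord kk (e i)].
have -> : monomial e = monomial e'.
  by apply/funext => x; apply: eq_bigr => i _; rewrite ffunE.
apply: poly_deg_le_monomial; apply: leq_trans kk'.
by rewrite (eq_bigr (fun i => nat_of_ord (e i)))// => i _; rewrite ffunE.
Qed.

Lemma continuous_monomial k (e : {ffun 'I_d -> 'I_k.+1}) : continuous (monomial e).
Proof.
suff : smooth (monomial e) by exact: smooth_continuous.
rewrite (_ : monomial e = \prod_i ((fun x : E => x 0 i) ^+ e i)).
  apply: smooth_prod => i; elim: (nat_of_ord (e i)) => [|n IHn].
    by rewrite expr0; exact: (smooth_cst 1).
  by rewrite exprS; apply: smooth_mul => //; exact: smooth_coord.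
by apply/funext => x; rewrite prod_fctE; apply: eq_bigr => i _; rewrite exprfctE.
Qed.

Lemma pw_poly_lin k (a : R) p q :
  pw_poly Kh k p -> pw_poly Kh k q -> pw_poly Kh k (a *: p + q).
Proof.
move=> hp hq K cK; have [p' pp' pE] := hp _ cK; have [q' pq' qE] := hq _ cK.
exists (a *: p' + q'); [exact: poly_deg_le_lin|exact: ae_eq_on_lin].
Qed.

Lemma pw_poly0 k : pw_poly Kh k 0.
Proof. by move=> K _; exists 0; [exact: poly_deg_le0|exact: ae_eq_on_refl]. Qed.

Lemma pw_poly_subspace k : linear_subspace (pw_poly Kh k).
Proof. by split; [exact: pw_poly0|move=> *; exact: pw_poly_lin]. Qed.

Lemma pw_polyW k k' : (k <= k')%N -> pw_poly Kh k `<=` pw_poly Kh k'.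
Proof.
move=> kk' p hp K cK; have [q qk qE] := hp _ cK.
by exists q => //; exact: poly_deg_leW qk.
Qed.

Section pw_basis.
Variables (N : nat) (K : 'I_N -> set E) (k : nat).
Hypotheses (Kinj : injective K) (KE : cells Kh = range K).

Let I := ('I_N * {ffun 'I_d -> 'I_k.+1})%type.

(** Monomials truncated to one cell.  The degree is tested in the value, rather
    than in the index type, so that the indices form a product. *)
Definition pw_basis (i : I) : E -> R :=
  if (\sum_l i.2 l <= k)%N then \1_(K i.1) * monomial i.2 else 0.

Lemma pw_basis_poly i : pw_poly Kh k (pw_basis i).
Proof.
rewrite /pw_basis; case: ifPn => [ik|_]; last exact: pw_poly0.
have cK : cells Kh (K i.1) by rewrite KE; exists i.1.
move=> L cL; have [LK|LK] := pselect (L = K i.1).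
  exists (monomial i.2); first exact: poly_deg_le_monomial.
  by apply: ae_eq_on_eq => x Lx; rewrite mulrfctE indicE mem_set -?LK// mul1r.
exists 0; first exact: poly_deg_le0.
apply: negligibleS (cells_ae_disjoint cL cK LK) => x /= /not_implyP [Lx].
move=> H; split => //; apply: contrapT => nK; apply: H.
by rewrite mulrfctE indicE memNset// mul0r.
Qed.

Lemma pw_basis_L2 i : L2 Omega (pw_basis i).
Proof.
rewrite /pw_basis; case: ifPn => [ik|_]; last exact: L2_0.
have cK : cells Kh (K i.1) by rewrite KE; exists i.1.
have mK : measurable (K i.1) by apply: closed_measurable_rV; exact: cell_closed.
have Lm : L2 Omega (monomial i.2) by apply: continuous_L2 => //; exact: continuous_monomial.
have mm : measurable_fun setT (monomial i.2).
  by apply: continuous_measurable_rV; exact: continuous_monomial.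
apply: L2_dominated Lm _ => //.
  exists (\1_(K i.1) * monomial i.2); last exact: ae_eq_on_refl.
  by apply: measurable_funM => //; exact: measurable_indic.
apply: aeW => x _; rewrite mulrfctE indicE; case: (_ \in _) => /=.
  by rewrite mul1r.
by rewrite mul0r normr0.
Qed.

(** Two cells overlap on a null set only, so that the polynomials chosen on the
    cells can be added up. *)
Lemma pw_basis_span q : pw_poly Kh k q ->
  exists c : I -> R, ae_eq_on Omega q (\sum_i c i *: pw_basis i).
Proof.
move=> hq; have cK i : cells Kh (K i) by rewrite KE; exists i.
have /choice[a Ha] : forall i, exists a : {ffun 'I_d -> 'I_k.+1} -> R,
    ae_eq_on (K i) q (fun x => \sum_(e : {ffun 'I_d -> 'I_k.+1} |
      (\sum_l e l <= k)%N) a e * monomial e x).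
  move=> i; have [p [a pE] qp] := hq _ (cK i); exists a.
  by apply: ae_eq_on_trans qp _; apply: ae_eq_on_eq => x _; rewrite pE.
exists (fun i => a i.1 i.2).
have h1 : {ae leb, forall x, forall i, K i x -> q x = \sum_(e : {ffun 'I_d -> 'I_k.+1} |
      (\sum_l e l <= k)%N) a i e * monomial e x}.
  by apply: ae_forall_fin => i; exact: Ha.
have h2 : {ae leb, forall x, forall ij : 'I_N * 'I_N, ij.1 <> ij.2 -> ~ (K ij.1 `&` K ij.2) x}.
  apply: ae_forall_fin => -[i j] /=; have [->|ij] := eqVneq i j; first exact: aeW.
  have Kij : K i <> K j by move=> /Kinj /eqP; rewrite (negPf ij).
  apply: negligibleS (cells_ae_disjoint (cK i) (cK j) Kij) => x /=.
  by move=> /not_implyP [_ /contrapT].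
apply: filterS2 h1 h2 => x h1 h2 Ox.
have : closure Omega x by exact: subset_closure.
case: hK => _ _ <- _ [L]; rewrite KE => -[i _ <-] Kx.
rewrite (h1 _ Kx) fct_sumE.
rewrite -(pair_bigA _ (fun i e => (a i e *: pw_basis (i, e)) x)) /= (bigD1 i)//=.
rewrite [X in _ + X]big1 ?addr0.
  rewrite big_mkcond; apply: eq_bigr => e _; rewrite /pw_basis /=.
  case: ifPn => _; last by rewrite scaler0.
  have -> : (a i e *: (\1_(K i) * monomial e)) x = a i e * (\1_(K i) x * monomial e x) by [].
  by rewrite indicE mem_set// mul1r.
move=> j ji; apply: big1 => e _; rewrite /pw_basis /=; case: ifPn => _; last by rewrite scaler0.
have -> : (a j e *: (\1_(K j) * monomial e)) x = a j e * (\1_(K j) x * monomial e x) by [].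
rewrite indicE memNset ?mul0r ?mulr0// => Kjx.
by apply: (h2 (i, j)) => //= ij; rewrite ij eqxx in ji.
Qed.

End pw_basis.

Lemma pw_poly_L2 k q : pw_poly Kh k q -> L2 Omega q.
Proof.
have [N [K [Kinj KE]]] := cells_enum => /(pw_basis_span Kinj KE) [c qE].
apply: (L2_ae (ae_eq_on_sym qE)); elim/big_rec : _ => [|i f _ Lf]; first exact: L2_0.
by apply: L2_lin => //; exact: pw_basis_L2.
Qed.

(** The span as the intersection of the subspaces that contain the family: a span
    is then contained in L2 and in [pw_poly] by mere instantiation. *)
Definition lspan (I : eqType) (s : seq I) (b : I -> E -> R) : set (E -> R) :=
  [set p | forall V, linear_subspace V -> (forall i, i \in s -> V (b i)) -> V p].

(** Gram-Schmidt: the new vector is replaced with its component orthogonal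
    to the previous ones, which is either null or normalizable. *)
Lemma orthogonal_projection (I : eqType) (s : seq I) (b : I -> E -> R) v :
  (forall i, L2 Omega (b i)) -> L2 Omega v ->
  exists p, lspan s b p /\ forall i, i \in s -> ip Omega (v - p) (b i) = 0.
Proof.
move=> Lb; elim: s v => [|i s IHs] v Lv.
  by exists 0; split=> // V [].
have LV : linear_subspace (L2 Omega).
  by split; [exact: L2_0|move=> *; exact: L2_lin].
have Lspan p : lspan s b p -> L2 Omega p by apply.
have orth w p : L2 Omega w -> (forall j, j \in s -> ip Omega w (b j) = 0) ->
    lspan s b p -> ip Omega w p = 0.
  move=> Lw H sp; suff [] : L2 Omega p /\ ip Omega w p = 0 by [].
  apply: (sp [set p | L2 Omega p /\ ip Omega w p = 0]); last by move=> j js; split=> //; exact: H.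
  split; first by split; [exact: L2_0|rewrite ipC ip0].
  move=> a f g [Lf f0] [Lg g0]; split; first exact: L2_lin.
  by rewrite ip_linr// f0 g0 mulr0 addr0.
have [pv [spv Hpv]] := IHs _ Lv; have [pb [spb Hpb]] := IHs _ (Lb i).
have Lpv := Lspan _ spv; have Lpb := Lspan _ spb.
have Lr : L2 Omega (b i - pb) by exact: L2_sub.
have Lvp : L2 Omega (v - pv) by exact: L2_sub.
have spanW p : lspan s b p -> lspan (i :: s) b p.
  by move=> sp V HV Vb; apply: sp => // j js; apply: Vb; rewrite in_cons js orbT.
set r := b i - pb in Lr.
have bE : b i = 1 *: r + pb by rewrite scale1r subrK.
have [n0|n0] := eqVneq (ip Omega r r) 0.
  exists pv; split; first exact: spanW.
  move=> j; rewrite in_cons => /orP[/eqP ->|]; last exact: Hpv.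
  rewrite bE ip_linr// (orth _ _ Lvp Hpv spb) addr0 mul1r.
  have r0 : ae_eq_on Omega r 0 by apply: norm0_sq_eq0 => //; rewrite norm0_sqE.
  by rewrite (ip_ae (ae_eq_on_refl _ _) r0) ipC ip0.
pose t := ip Omega (v - pv) r / ip Omega r r.
have vE : v - (t *: r + pv) = (- t) *: r + (v - pv).
  by rewrite scaleNr opprD addrCA.
exists (t *: r + pv); split.
  move=> V HV Vb; have [_ VL] := HV; apply: VL; last exact: (spanW _ spv).
  rewrite /r addrC -scaleN1r; apply: HV.2; first exact: (spanW _ spb).
  by apply: Vb; rewrite mem_head.
have Ltr : L2 Omega ((- t) *: r) by exact: L2_scale.
move=> j; rewrite vE in_cons => /orP[/eqP ->|js]; last first.
  by rewrite ip_lin// Hpv// Hpb// mulr0 addr0.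
rewrite ip_lin// bE !ip_linr// (orth _ _ Lr Hpb spb) (orth _ _ Lvp Hpv spb).
rewrite !mul1r !addr0 /t mulNr mulfVK//; first by rewrite addrC subrr.
Qed.

Local Notation Pi := (L2_proj Omega Kh).

Lemma L2_proj_spec k v : L2 Omega v -> pw_poly Kh k (Pi k v) /\
  forall q, pw_poly Kh k q -> ip Omega (v - Pi k v) q = 0.
Proof.
move=> Lv; have [N [K [Kinj KE]]] := cells_enum.
pose I := ('I_N * {ffun 'I_d -> 'I_k.+1})%type.
have [p [sp Hp]] := orthogonal_projection (enum {: I}) (@pw_basis_L2 _ _ k KE) Lv.
have pp : pw_poly Kh k p.
  by apply: sp; [exact: pw_poly_subspace|move=> i _; exact: pw_basis_poly].
have : exists p, pw_poly Kh k p /\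
    forall q, pw_poly Kh k q -> \int[leb]_(x in Omega) ((v x - p x) * q x) = 0.
  exists p; split=> // q /(pw_basis_span Kinj KE) [c qE].
  have Lvp : L2 Omega (v - p) by apply: L2_sub => //; exact: pw_poly_L2 pp.
  change (ip Omega (v - p) q = 0); rewrite (ip_ae (ae_eq_on_refl _ _) qE).
  suff [] : L2 Omega (\sum_i c i *: pw_basis K i) /\
    ip Omega (v - p) (\sum_i c i *: pw_basis K i) = 0 by [].
  elim/big_rec : _ => [|i f _ [Lf f0]]; first by split; [exact: L2_0|rewrite ipC ip0].
  have Lb := @pw_basis_L2 _ _ k KE i; split; first exact: L2_lin.
  by rewrite ip_linr// f0 Hp ?mem_enum// mulr0 addr0.
by move=> /(xgetPex (fun=> 0)).
Qed.

Lemma L2_proj_L2 k v : L2 Omega v -> L2 Omega (Pi k v).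
Proof. by move=> Lv; have [] := L2_proj_spec k Lv => /pw_poly_L2. Qed.

Lemma L2_proj_unique k v p : L2 Omega v -> pw_poly Kh k p ->
  (forall q, pw_poly Kh k q -> ip Omega (v - p) q = 0) ->
  ae_eq_on Omega (Pi k v) p.
Proof.
move=> Lv pp Hp; have [pP HP] := L2_proj_spec k Lv.
have Lp := pw_poly_L2 pp; have LP := pw_poly_L2 pP.
set z := (-1) *: p + Pi k v.
have zp : pw_poly Kh k z by exact: pw_poly_lin.
have Lz := pw_poly_L2 zp.
have z0 : ae_eq_on Omega z 0.
  apply: norm0_sq_eq0 => //; rewrite norm0_sqE.
  have -> : z = (-1) *: (v - Pi k v) + (v - p).
    by apply/funext => x; rewrite /z !fctE /GRing.scale/=; ring.
  rewrite -/z ip_lin//; [|exact: L2_sub|exact: L2_sub|].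
    by rewrite -/z HP ?Hp// ?mulr0 ?addr0//; rewrite (_ : _ + _ = z)//;
      apply/funext => x; rewrite /z !fctE /GRing.scale/=; ring.
  by rewrite (_ : _ + _ = z)//; apply/funext => x; rewrite /z !fctE /GRing.scale/=; ring.
apply: filterS z0 => x + Ox => /(_ Ox).
by rewrite /z !fctE /GRing.scale/= mulN1r addrC => /eqP; rewrite subr_eq0 => /eqP.
Qed.

Lemma L2_proj_ae k u v : ae_eq_on Omega u v -> Pi k u = Pi k v.
Proof.
move=> uv; rewrite /L2_proj; congr (xget _ _); apply/seteqP; split => p [pp H];
  split => // q pq; rewrite -[RHS](H _ pq); apply: Rintegral_ae;
  by apply: filterS uv => x uv Ox; rewrite uv.
Qed.

Lemma L2_proj_lin k (a : R) u v : L2 Omega u -> L2 Omega v ->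
  ae_eq_on Omega (Pi k (a *: u + v)) (a *: Pi k u + Pi k v).
Proof.
move=> Lu Lv; have [pu Hu] := L2_proj_spec k Lu; have [pv Hv] := L2_proj_spec k Lv.
have Lpu := pw_poly_L2 pu; have Lpv := pw_poly_L2 pv.
apply: L2_proj_unique; [exact: L2_lin|exact: pw_poly_lin|] => q pq.
have -> : a *: u + v - (a *: Pi k u + Pi k v) = a *: (u - Pi k u) + (v - Pi k v).
  by apply/funext => x; rewrite !fctE /GRing.scale/=; ring.
have Lq := pw_poly_L2 pq.
by rewrite ip_lin//; [rewrite Hu// Hv// mulr0 addr0|exact: L2_sub|exact: L2_sub].
Qed.

End mesh.
End polytopes.

(** * Weak derivatives *)

Section weak_derivatives.
Context {R : realType} {d : nat}.
Local Notation E := 'rV[R]_d.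
Local Notation leb := (@lebesgue_rV R d).
Implicit Types (D U : set E) (f g h u v w phi : E -> R).

Lemma Rintegral_support (A B : set E) f : A `<=` B ->
  (forall x, B x -> ~ A x -> f x = 0) ->
  \int[leb]_(x in A) f x = \int[leb]_(x in B) f x.
Proof.
move=> AB f0; rewrite Rintegral_mkcond [RHS]Rintegral_mkcond; apply: eq_Rintegral => x _.
rewrite /patch; case: ifPn => [/set_mem Ax|/negP Ax].
  by rewrite mem_set//; exact: AB.
case: ifPn => // /set_mem Bx; rewrite f0// => Ax'; apply: Ax; exact: mem_set.
Qed.

Lemma is_weak_partial_ae U i u v g h : ae_eq_on U u v -> ae_eq_on U g h ->
  is_weak_partial U i u g -> is_weak_partial U i v h.
Proof.
move=> uv gh H phi tphi.
have E1 : \int[leb]_(x in U) (u x * partial i phi x) =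
    \int[leb]_(x in U) (v x * partial i phi x).
  by apply: Rintegral_ae; apply: filterS uv => x uv Ux; rewrite uv.
have E2 : \int[leb]_(x in U) (g x * phi x) = \int[leb]_(x in U) (h x * phi x).
  by apply: Rintegral_ae; apply: filterS gh => x gh Ux; rewrite gh.
by rewrite -E1 -E2; exact: H.
Qed.

(** A test function of [U] vanishes outside [U] together with its derivatives, so
    that it may be integrated over the larger set. *)
Lemma is_weak_partialS U V i v g : U `<=` V ->
  is_weak_partial V i v g -> is_weak_partial U i v g.
Proof.
move=> UV H phi tphi; have := H _ (testS UV tphi).
rewrite -(@Rintegral_support U V)//; last first.
  by move=> x _ nUx; have [_ ->] := test_partial_out i tphi nUx; rewrite mulr0.
rewrite -(@Rintegral_support U V)//.
by move=> x _ nUx; have [-> _] := test_partial_out i tphi nUx; rewrite mulr0.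
Qed.

(** The operators of the scheme are linear on classes of functions modulo
    almost everywhere equality, but not on functions, because weak derivatives
    and projections are chosen in their class. *)
Definition L2_linear D (V : set (E -> R)) (T : (E -> R) -> E -> R) :=
  [/\ forall v, V v -> L2 D (T v),
      forall u v, V u -> V v -> ae_eq_on D u v -> ae_eq_on D (T u) (T v)
    & forall (a : R) u v, V u -> V v ->
        ae_eq_on D (T (a *: u + v)) (a *: T u + T v)].

Section open_domain.
Variables (U : set E) (oU : open U) (bU : coord_bounded U).
Let mU := open_measurable_rV oU.

Lemma test_L2 phi : test_function U phi -> L2 U phi.
Proof. by move=> [/smooth_continuous c _ _]; exact: continuous_L2. Qed.

Lemma test_partial_L2 phi i : test_function U phi -> L2 U (partial i phi).
Proof.
move=> [sphi _ _]; apply: continuous_L2 => //; apply: smooth_continuous.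
exact: smooth_partial.
Qed.

(** By the fundamental lemma of the calculus of variations. *)
Lemma is_weak_partial_unique i v g h : L2 U g -> L2 U h ->
  is_weak_partial U i v g -> is_weak_partial U i v h -> ae_eq_on U g h.
Proof.
move=> Lg Lh Hg Hh.
have : ae_eq_on U ((-1) *: h + g) 0.
  apply: variational_eq0 => //; first exact: L2_lin.
  move=> phi tphi; have Lphi := test_L2 tphi.
  change (ip U ((-1) *: h + g) phi = 0); rewrite ip_lin//.
  have := Hg _ tphi; rewrite Hh// => /oppr_inj E.
  by rewrite [ip U g phi](esym E) mulN1r addrC subrr.
apply: filterS => x H Ux; have := H Ux.
rewrite (_ : (_ + _) x = - 1 * h x + g x)// mulN1r addrC => /eqP.
by rewrite subr_eq0 => /eqP.
Qed.

Lemma is_weak_partial_lin i (a : R) u v g h :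
  L2 U u -> L2 U v -> L2 U g -> L2 U h ->
  is_weak_partial U i u g -> is_weak_partial U i v h ->
  is_weak_partial U i (a *: u + v) (a *: g + h).
Proof.
move=> Lu Lv Lg Lh ug vh phi tphi.
have Lphi := test_L2 tphi; have Lp := test_partial_L2 i tphi.
change (ip U (a *: u + v) (partial i phi) = - ip U (a *: g + h) phi).
rewrite !ip_lin// [ip U u _](ug _ tphi) [ip U v _](vh _ tphi).
by rewrite mulrN opprD.
Qed.

Lemma weak_partial_ae i u v : ae_eq_on U u v ->
  weak_partial U i u = weak_partial U i v.
Proof.
move=> uv; congr (xget _ _); apply/seteqP; split => g [Lg Hg]; split => //.
  exact: is_weak_partial_ae uv (ae_eq_on_refl _ _) Hg.
exact: is_weak_partial_ae (ae_eq_on_sym uv) (ae_eq_on_refl _ _) Hg.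
Qed.

Lemma weak_partialP i v g : L2 U g -> is_weak_partial U i v g ->
  [/\ L2 U (weak_partial U i v), is_weak_partial U i v (weak_partial U i v)
    & ae_eq_on U (weak_partial U i v) g].
Proof.
move=> Lg Hg.
have : exists g, L2 U g /\ is_weak_partial U i v g by exists g.
move=> /(xgetPex (fun=> 0)); rewrite -/(weak_partial U i v) => -[L H]; split=> //.
exact: is_weak_partial_unique H Hg.
Qed.

Lemma H1_L2 v : H1 U v -> L2 U v.
Proof. by case. Qed.

Lemma weak_partial_H1 i v : H1 U v ->
  L2 U (weak_partial U i v) /\ is_weak_partial U i v (weak_partial U i v).
Proof. by move=> [_ /(_ i)] [g Lg Hg]; have [] := weak_partialP Lg Hg. Qed.

Lemma H1_ae u v : ae_eq_on U u v -> H1 U u -> H1 U v.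
Proof.
move=> uv [Lu H]; split; first exact: L2_ae uv Lu.
move=> i; have [g Lg Hg] := H i; exists g => //.
exact: is_weak_partial_ae uv (ae_eq_on_refl _ _) Hg.
Qed.

Lemma H1_lin (a : R) u v : H1 U u -> H1 U v -> H1 U (a *: u + v).
Proof.
move=> [Lu Hu] [Lv Hv]; split; first exact: L2_lin.
move=> i; have [g Lg Hg] := Hu i; have [h Lh Hh] := Hv i.
by exists (a *: g + h); [exact: L2_lin|exact: is_weak_partial_lin].
Qed.

Lemma H2_H1 v : H2 U v -> H1 U v.
Proof. by move=> [L H]; split => // i; have [g [Lg _] Hg] := H i; exists g. Qed.

Lemma weak_partial_H2 i v : H2 U v -> H1 U (weak_partial U i v).
Proof.
move=> [L H]; have [g Hg wg] := H i; have [_ _] := weak_partialP (H1_L2 Hg) wg.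
by move=> /ae_eq_on_sym gE; exact: H1_ae gE Hg.
Qed.

Lemma weak_partial_linear i : L2_linear U (H1 U) (weak_partial U i).
Proof.
split=> [v Hv|u v _ _ uv|a u v Hu Hv].
  by have [] := weak_partial_H1 i Hv.
  by rewrite (weak_partial_ae i uv); exact: ae_eq_on_refl.
have [Lu Wu] := weak_partial_H1 i Hu; have [Lv Wv] := weak_partial_H1 i Hv.
have [_ _] := weak_partialP (L2_lin mU a Lu Lv) (is_weak_partial_lin a (H1_L2 Hu) (H1_L2 Hv) Lu Lv Wu Wv).
by [].
Qed.

Lemma weak_partial2_linear i k :
  L2_linear U (H2 U) (fun v => weak_partial U i (weak_partial U k v)).
Proof.
have [_ _ lin1] := weak_partial_linear k; have [L2' ae2 lin2] := weak_partial_linear i.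
split=> [v Hv|u v _ _ uv|a u v Hu Hv].
- by apply: L2'; exact: weak_partial_H2.
- by rewrite (weak_partial_ae k uv); exact: ae_eq_on_refl.
- have H1u := weak_partial_H2 k Hu; have H1v := weak_partial_H2 k Hv.
  rewrite (weak_partial_ae i (lin1 a _ _ (H2_H1 Hu) (H2_H1 Hv))).
  exact: lin2.
Qed.

Lemma cvg_comb0 (c c' : R) (s s' : nat -> R) :
  s @ \oo --> (0 : R) -> s' @ \oo --> (0 : R) ->
  (fun n => c * s n + c' * s' n) @ \oo --> (0 : R).
Proof.
move=> s0 s0'.
have h1 : (fun n => c * s n) @ \oo --> c * 0 by apply: cvgM => //; exact: cvg_cst.
have h2 : (fun n => c' * s' n) @ \oo --> c' * 0 by apply: cvgM => //; exact: cvg_cst.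
by have h := cvgD h1 h2; rewrite !mulr0 addr0 in h; exact: h.
Qed.

Lemma cvg0_eq0 (t c c' : R) (s s' : nat -> R) :
  s @ \oo --> (0 : R) -> s' @ \oo --> (0 : R) ->
  (forall n, t ^+ 2 <= c * s n + c' * s' n) -> t = 0.
Proof.
move=> s0 s0' H; apply/eqP; rewrite -sqrf_eq0 eq_le sqr_ge0 andbT.
have h : (fun n => c * s n + c' * s' n) @ \oo --> (0 : R) by exact: cvg_comb0.
have c1 : (fun n : nat => t ^+ 2) @ \oo --> t ^+ 2 by exact: cvg_cst.
by apply: (ler_cvg_to c1 h); near=> n; exact: H.
Unshelve. all: by end_near. Qed.

Lemma H1_0_lin (a : R) u v : H1_0 U u -> H1_0 U v -> H1_0 U (a *: u + v).
Proof.
move=> [Hu [phi [tphi phiu dphiu]]] [Hv [psi [tpsi psiv dpsiv]]].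
split; first exact: H1_lin.
exists (fun n => a *: phi n + psi n); split.
- by move=> n; exact: test_lin.
- apply: (@squeeze_cvgr _ _ _ _ (cst 0) (fun n => (2 * a ^+ 2) * norm0_sq U (u - phi n)
     + 2 * norm0_sq U (v - psi n))).
  + near=> n; rewrite norm0_sq_ge0 /=.
    have -> : a *: u + v - (a *: phi n + psi n) = a *: (u - phi n) + (v - psi n).
      by rewrite scalerBr opprD addrACA.
    have L1 : L2 U (u - phi n) by apply: L2_sub => //; [exact: H1_L2|exact: test_L2].
    have L2' : L2 U (v - psi n) by apply: L2_sub => //; [exact: H1_L2|exact: test_L2].
    by rewrite -mulrA -norm0_sqZ//; apply: norm0_sq_add => //; exact: L2_scale.
  + exact: cvg_cst.
  + exact: cvg_comb0.
- move=> i; apply: (@squeeze_cvgr _ _ _ _ (cst 0)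
     (fun n => (2 * a ^+ 2) * norm0_sq U (weak_partial U i u - partial i (phi n))
     + 2 * norm0_sq U (weak_partial U i v - partial i (psi n)))).
  + near=> n; rewrite norm0_sq_ge0 /=.
    have [_ _ lin] := weak_partial_linear i.
    have [sphi _ _] := tphi n; have [spsi _ _] := tpsi n.
    rewrite (@norm0_sq_ae _ _ _ _ (a *: (weak_partial U i u - partial i (phi n)) +
      (weak_partial U i v - partial i (psi n)))); last first.
      apply: filterS (lin a _ _ Hu Hv) => x H Ux.
      rewrite partial_lin// (_ : (_ - _) x = weak_partial U i (a *: u + v) x -
        (a *: partial i (phi n) + partial i (psi n)) x)// H//.
      by rewrite !fctE /GRing.scale /=; ring.
    have L1 : L2 U (weak_partial U i u - partial i (phi n)).
      by apply: L2_sub => //; [have [] := weak_partial_H1 i Hu|exact: test_partial_L2].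
    have L2' : L2 U (weak_partial U i v - partial i (psi n)).
      by apply: L2_sub => //; [have [] := weak_partial_H1 i Hv|exact: test_partial_L2].
    by rewrite -mulrA -norm0_sqZ//; apply: norm0_sq_add => //; exact: L2_scale.
  + exact: cvg_cst.
  + exact: cvg_comb0.
Unshelve. all: by end_near. Qed.

Lemma H1_0_zero : H1_0 U (0 : E -> R).
Proof.
have wp i : is_weak_partial U i (0 : E -> R) (0 : E -> R).
  move=> phi _; have z q : \int[leb]_(x in U) ((0 : E -> R) x * q x) = 0.
    exact: (ip0 mU q).
  by rewrite (z (partial i phi)) (z phi) oppr0.
split; first by split=> [|i]; [exact: L2_0|exists 0 => //; exact: L2_0].
have n0 : norm0_sq U (0 : E -> R) = 0 by rewrite norm0_sqE (ip0 mU).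
exists (fun=> 0); split => [n||i]; first exact: test0.
  by under eq_fun do rewrite subr0 n0; exact: cvg_cst.
have p0 : partial i (0 : E -> R) = 0 by apply/funext => x; exact: derive_cst.
have [_ _ w0] := weak_partialP (@L2_0 _ _ U) (wp i).
under eq_fun do rewrite p0 subr0 (norm0_sq_ae w0) n0.
exact: cvg_cst.
Qed.

Lemma coord_mul_L2 i v : L2 U v -> L2 U ((fun x : E => x 0 i) * v).
Proof.
move=> Lv; have [M UM] := bU; apply: (L2_dominated mU _ (L2_scale mU M Lv)).
  apply: (@leb_measurable2 _ _ U *%R (fun x : E => x 0 i) v).
  - by apply: measurable_funM; [exact: measurable_fst|exact: measurable_snd].
  - by exists (fun x : E => x 0 i); [exact: measurable_coord|exact: ae_eq_on_refl].
  - by case: Lv.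
apply: aeW => x Ux; rewrite (_ : (_ * v) x = x 0 i * v x)//.
rewrite (_ : (M *: v) x = M * v x)// !normrM ler_wpM2r//.
by apply: le_trans (ler_norm M); exact: ltW (UM _ Ux i).
Qed.

(** Integration by parts in H^1_0 turns vanishing second derivatives into a
    vanishing gradient, [|D_i v|^2 = - (D_i D_i v, v)]; a vanishing derivative
    gives [v = 0] by testing [D_i v = 0] with [x_i v], since
    [D_i (x_i v) = v + x_i D_i v]. *)
Lemma H1_0_hessian_eq0 v (i : 'I_d) : H2 U v -> H1_0 U v ->
  ae_eq_on U (weak_partial U i (weak_partial U i v)) 0 -> ae_eq_on U v 0.
Proof.
move=> H2v [H1v [phi [tphi phiv dphiv]]] vii.
have [Lg Wg] := weak_partial_H1 i H1v; set g := weak_partial U i v in Lg Wg vii.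
have [_ Wgi] := weak_partial_H1 i (weak_partial_H2 i H2v); rewrite -/g in Wgi.
have Lv := H1_L2 H1v.
have Lphi n : L2 U (phi n) by exact: test_L2.
have Ldphi n : L2 U (partial i (phi n)) by exact: test_partial_L2.
have g0 : ae_eq_on U g 0.
  apply: norm0_sq_eq0 => //.
  apply: (@cvg0_eq0 (norm0_sq U g) (norm0_sq U g) 0 _ _ (dphiv i) (dphiv i)) => n.
  rewrite mul0r addr0.
  have E : ip U (weak_partial U i g) (phi n) = 0.
    by rewrite (ip_ae vii (ae_eq_on_refl _ _)) ip0.
  have E2 : ip U g (partial i (phi n)) = 0.
    by rewrite [LHS](Wgi _ (tphi n)) -[X in - X]/(ip U _ _) E oppr0.
  have := ip_CauchySchwarz mU Lg (L2_sub mU Lg (Ldphi n)).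
  by rewrite ipC ip_subl// [ip U (partial _ _) _]ipC E2 subr0 -norm0_sqE.
apply: norm0_sq_eq0 => //.
apply: (@cvg0_eq0 (norm0_sq U v) (2 * norm0_sq U v) (2 * norm0_sq U ((fun x : E => x 0 i) * v)) _ _
  phiv (dphiv i)) => n.
have [sphi _ _] := tphi n.
have Lxv := coord_mul_L2 i Lv; have Lxdphi := coord_mul_L2 i (Ldphi n).
have key : ip U v (phi n) = - ip U ((fun x : E => x 0 i) * v) (partial i (phi n)).
  have E1 : ip U g ((fun x : E => x 0 i) * phi n) = 0.
    by rewrite (ip_ae g0 (ae_eq_on_refl _ _)) ip0.
  have : ip U v (partial i ((fun x : E => x 0 i) * phi n)) = 0.
    by rewrite [LHS](Wg _ (test_coord_mul i (tphi n))) -[X in - X]/(ip U _ _) E1 oppr0.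
  rewrite partial_coord_mul// -{1}[phi n]scale1r ip_linr// mul1r => /eqP.
  rewrite addr_eq0 => /eqP ->; congr (- _); apply: eq_Rintegral => x _ /=.
  by rewrite !fctE; ring.
rewrite [X in X ^+ 2](_ : _ = ip U v (v - phi n) - ip U ((fun x : E => x 0 i) * v) (partial i (phi n))); last first.
  by rewrite ipC ip_subl// norm0_sqE (ipC _ (phi n)) key opprK addrK.
have c1 := ip_CauchySchwarz mU Lv (L2_sub mU Lv (Lphi n)).
have c2 := ip_CauchySchwarz mU Lxv (Ldphi n).
rewrite (_ : norm0_sq U (g - partial i (phi n)) = norm0_sq U (partial i (phi n))); last first.
  apply: Rintegral_ae; apply: filterS g0 => x gx Ux.
  by rewrite (_ : (_ - _) x = g x - partial i (phi n) x)// gx// sub0r sqrrN.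
move: c1 c2; set A := ip U v _; set B := ip U (_ * v) _; move=> c1 c2.
have := sqr_ge0 (A + B); lra.
Qed.

End open_domain.

(** For [lambda = 0] only the Hessian is controlled; on H^1_0 this is enough, and
    the other two terms are nonnegative. *)
Lemma norm_star_eq0 Omega (lambda : R) v : open Omega -> coord_bounded Omega ->
  (0 < d)%N -> 0 <= lambda -> H2 Omega v -> H1_0 Omega v ->
  norm_star_sq Omega lambda v <= 0 -> ae_eq_on Omega v 0.
Proof.
move=> oO bO d0 l0 H2v H10v N0; pose i := Ordinal d0.
have mO := open_measurable_rV oO.
suff h : ae_eq_on Omega (weak_partial Omega i (weak_partial Omega i v)) 0.
  exact: (H1_0_hessian_eq0 oO bO H2v H10v h).
have n1 : 0 <= norm1_sq Omega v by apply: sumr_ge0 => k _; exact: norm0_sq_ge0.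
have n2 k : 0 <= \sum_l norm0_sq Omega (weak_partial Omega k (weak_partial Omega l v)).
  by apply: sumr_ge0 => l _; exact: norm0_sq_ge0.
have : norm2_sq Omega v <= 0.
  apply: le_trans N0; rewrite /norm_star_sq -addrA lerDl addr_ge0//.
    by rewrite !mulr_ge0.
  by rewrite mulr_ge0 ?sqr_ge0 ?norm0_sq_ge0.
rewrite /norm2_sq (bigD1 i isT) => H.
have [L _ _] := weak_partial2_linear oO bO i i.
apply: norm0_sq_eq0 => //; first exact: L.
apply/eqP; rewrite eq_le norm0_sq_ge0 andbT; apply: le_trans H.
apply: (@le_trans _ _ (\sum_l norm0_sq Omega (weak_partial Omega i (weak_partial Omega l v)))).
  rewrite (bigD1 i isT) lerDl; apply: sumr_ge0 => k _; exact: norm0_sq_ge0.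
by rewrite lerDl; apply: sumr_ge0 => k _; exact: n2.
Qed.

End weak_derivatives.

(** * Broken derivatives and projections on the discrete space *)

Section broken_derivatives.
Context {R : realType} {d : nat}.
Local Notation E := 'rV[R]_d.
Local Notation leb := (@lebesgue_rV R d).
Variables (Omega : set E) (Kh : @mesh R d).
Hypotheses (d0 : (0 < d)%N) (hO : convex_polytope Omega)
  (hK : polytopal_mesh Omega Kh).
Local Notation D := (broken_partial Omega Kh).
Local Notation Pi := (L2_proj Omega Kh).
Let mO := polytope_measurable hO.
Let bO := polytope_bounded hO.
Let oO := polytope_open hO.

Lemma broken_partial_ae i (u v : E -> R) : ae_eq_on Omega u v -> D i u = D i v.
Proof.
move=> uv; congr (xget _ _); apply/seteqP; split => g [Lg Hg]; split => // K cK.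
  apply: is_weak_partial_ae (Hg _ cK); last exact: ae_eq_on_refl.
  by apply: ae_eq_on_sub uv; exact: (cell_interior_sub hO hK cK).
apply: is_weak_partial_ae (Hg _ cK); last exact: ae_eq_on_refl.
by apply: ae_eq_on_sym; apply: ae_eq_on_sub uv; exact: (cell_interior_sub hO hK cK).
Qed.

Lemma L2S (A B : set E) (u : E -> R) : measurable A -> measurable B -> A `<=` B -> L2 B u -> L2 A u.
Proof.
move=> mA mB AB /(L2_repr) [g [mg ug Lg]]; apply: (L2_intro mg); first exact: ae_eq_on_sub ug.
have i1 : leb.-integrable B (fun x => (g x ^+ 2)%:E) by apply: L2_sq_integrable.
exact: (integrableS mB mA AB i1).
Qed.

(** Both restrict on each cell to the weak derivative, which is unique there, and
    the interiors of the cells exhaust the domain up to a null set. *)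
Lemma broken_partial_H1 i (v : E -> R) : H1 Omega v ->
  ae_eq_on Omega (D i v) (weak_partial Omega i v).
Proof.
move=> Hv; have [Lg Wg] := weak_partial_H1 oO bO i Hv.
have : exists g, L2 Omega g /\ forall K, cells Kh K -> is_weak_partial K° i v g.
  exists (weak_partial Omega i v); split => // K cK.
  by apply: is_weak_partialS Wg; exact: (cell_interior_sub hO hK cK).
move=> /(xgetPex (fun=> 0)); rewrite -/(D i v) => -[LD WD].
apply: (ae_eq_cells d0 hK) => K cK; have KO := cell_interior_sub hO hK cK.
have oK : open K° by exact: open_interior.
have mK := open_measurable_rV oK.
apply: (is_weak_partial_unique oK (coord_boundedS KO bO) (i := i) (v := v)).
- exact: L2S mK mO KO LD.
- exact: L2S mK mO KO Lg.
- exact: WD.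
- exact: is_weak_partialS Wg.
Qed.

Lemma broken_partial_linear i : L2_linear Omega (H1 Omega) (D i).
Proof.
have [L ae lin] := weak_partial_linear oO bO i; split=> [v Hv|u v _ _ uv|a u v Hu Hv].
- exact: L2_ae (ae_eq_on_sym (broken_partial_H1 i Hv)) (L _ Hv).
- by rewrite (broken_partial_ae i uv); exact: ae_eq_on_refl.
- apply: ae_eq_on_trans (broken_partial_H1 i (H1_lin oO bO a Hu Hv)) _.
  apply: ae_eq_on_trans (lin a _ _ Hu Hv) _; apply: ae_eq_on_sym.
  by apply: ae_eq_on_lin; exact: broken_partial_H1.
Qed.

Lemma broken_partial2_H2 i k (v : E -> R) : H2 Omega v ->
  ae_eq_on Omega (D i (D k v)) (weak_partial Omega i (weak_partial Omega k v)).
Proof.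
move=> Hv; rewrite (broken_partial_ae i (broken_partial_H1 k (H2_H1 Hv))).
by apply: broken_partial_H1; exact: weak_partial_H2.
Qed.

Lemma broken_partial2_linear i k : L2_linear Omega (H2 Omega) (fun v => D i (D k v)).
Proof.
have [L ae lin] := weak_partial2_linear oO bO i k.
have H2lin (a : R) u v : H2 Omega u -> H2 Omega v -> H2 Omega (a *: u + v).
  move=> Hu Hv; split; first by apply: L2_lin => //; [case: Hu|case: Hv].
  move=> l; exists (a *: weak_partial Omega l u + weak_partial Omega l v).
    by apply: H1_lin => //; exact: weak_partial_H2.
  have [Lu Wu] := weak_partial_H1 oO bO l (H2_H1 Hu).
  have [Lv Wv] := weak_partial_H1 oO bO l (H2_H1 Hv).
  by apply: is_weak_partial_lin => //; [case: Hu|case: Hv].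
split=> [v Hv|u v _ _ uv|a u v Hu Hv].
- exact: L2_ae (ae_eq_on_sym (broken_partial2_H2 i k Hv)) (L _ Hv).
- by rewrite (broken_partial_ae k uv); exact: ae_eq_on_refl.
- apply: ae_eq_on_trans (broken_partial2_H2 i k (H2lin a _ _ Hu Hv)) _.
  apply: ae_eq_on_trans (lin a _ _ Hu Hv) _; apply: ae_eq_on_sym.
  by apply: ae_eq_on_lin; exact: broken_partial2_H2.
Qed.

Section operator_algebra.
Variable V : set (E -> R).

Lemma L2_linearS (W : set (E -> R)) T : V `<=` W -> L2_linear Omega W T -> L2_linear Omega V T.
Proof.
move=> VW [L ae lin]; split=> [v /VW|u v /VW Wu /VW|a u v /VW Wu /VW].
- exact: L.
- exact: ae.
- exact: lin.
Qed.

Lemma L2_linear_id : V `<=` L2 Omega -> L2_linear Omega V id.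
Proof. by move=> VL; split=> // a u v _ _; exact: ae_eq_on_refl. Qed.

Lemma L2_linear_proj k T : L2_linear Omega V T -> L2_linear Omega V (fun v => Pi k (T v)).
Proof.
move=> [L ae lin]; split=> [v Vv|u v Vu Vv uv|a u v Vu Vv].
- by apply: (L2_proj_L2 d0 hO hK); exact: L.
- by rewrite (L2_proj_ae _ _ (ae _ _ Vu Vv uv)); exact: ae_eq_on_refl.
- rewrite (L2_proj_ae _ _ (lin a _ _ Vu Vv)).
  by apply: (L2_proj_lin d0 hO hK); exact: L.
Qed.

Lemma L2_linear_comb (c : R) S T : L2_linear Omega V S -> L2_linear Omega V T ->
  L2_linear Omega V (fun v => c *: S v + T v).
Proof.
move=> [L ae lin] [L' ae' lin']; split=> [v Vv|u v Vu Vv uv|a u v Vu Vv].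
- by apply: L2_lin => //; [exact: L|exact: L'].
- by apply: ae_eq_on_lin; [exact: ae|exact: ae'].
- apply: ae_eq_on_trans (ae_eq_on_lin c (lin a _ _ Vu Vv) (lin' a _ _ Vu Vv)) _.
  by apply: ae_eq_on_eq => x _; rewrite !fctE /GRing.scale /=; ring.
Qed.

Lemma L2_linear0 : L2_linear Omega V (fun=> 0).
Proof.
split=> *; [exact: L2_0|exact: ae_eq_on_refl|].
by apply: ae_eq_on_eq => x _; rewrite scaler0 addr0.
Qed.

Lemma L2_linear_sum n (T : 'I_n -> (E -> R) -> E -> R) :
  (forall i, L2_linear Omega V (T i)) -> L2_linear Omega V (fun v => \sum_i T i v).
Proof.
move=> H; elim: (index_enum _) => [|i r IHr].
  rewrite (_ : (fun v => _) = fun=> 0); first exact: L2_linear0.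
  by apply/funext => v; rewrite big_nil.
rewrite (_ : (fun v => _) = fun v => 1 *: T i v + \sum_(j <- r) T j v).
  exact: L2_linear_comb.
by apply/funext => v; rewrite big_cons scale1r.
Qed.

End operator_algebra.

End broken_derivatives.

(** * The inf-sup of a Caratheodory function *)

Section inf_sup.
Context {R : realType}.

(** Finite nets of radius [1 / (k + 1)], for all [k], enumerated together. *)
Lemma compact_dense_sequence (T : metricType R) : compact [set: T] ->
  [set: T] !=set0 ->
  exists a : nat -> T, forall (y : T) (A : set T), nbhs y A -> exists n, A (a n).
Proof.
move=> cT [x0 _].
have /choice[D HD] : forall k : nat, exists D : seq T,
    forall y, exists2 x, x \in D & ball x k.+1%:R^-1 y.
  move=> k; pose F := filter_from [set: seq T]
    (fun s0 => [set s : seq T | {subset s0 <= s}]).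
  have FF : Filter F.
    apply: filter_fromT_filter; first by exists [::].
    move=> s t; exists (s ++ t) => u H; split=> x xs; apply: H;
      by rewrite mem_cat xs ?orbT.
  have := cT => /compact_near_coveringP/(_ _ F
    (fun s y => exists2 x, x \in s & ball x k.+1%:R^-1 y)) [].
    move=> y _; exists (ball y k.+1%:R^-1, [set s : seq T | {subset [:: y] <= s}]) => /=.
      split; last by exists [:: y].
      by apply: nbhsx_ballx; rewrite invr_gt0 ltr0n.
    by move=> -[z s] /= [yz sub]; exists y => //; apply: sub; rewrite mem_head.
  by move=> s _ H; exists s => y; apply: (H s).
exists (fun n => if unpickle n is Some (k, i) then nth x0 (D k) i else x0) => y A.
move=> /nbhs_ballP [e e0 yA].
have [k ke] : exists k : nat, k.+1%:R^-1 < e.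
  exists (Num.truncn e^-1); rewrite invf_plt ?posrE//; exact: truncnS_gt.
have [x xD xy] := HD k y.
exists (pickle (k, index x (D k))); rewrite pickleK nth_index//.
by apply: yA; apply: ball_sym; apply: le_ball xy; exact: ltW.
Qed.

Variables (T1 T2 : metricType R).
Hypotheses (c1 : compact [set: T1]) (c2 : compact [set: T2])
  (n1 : [set: T1] !=set0) (n2 : [set: T2] !=set0).

Definition inf_sup (g : T1 -> T2 -> R) : R :=
  inf (range (fun al => sup (range (fun be => g al be)))).

Lemma sup_range_bounds (I : Type) (F : I -> R) (B C : R) : [set: I] !=set0 ->
  (forall i, B <= F i <= C) -> B <= sup (range F) <= C.
Proof.
move=> [i0 _] H; apply/andP; split.
  apply: le_trans (_ : F i0 <= _); first by have /andP[] := H i0.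
  apply: ub_le_sup; last by exists i0.
  by exists C => _ [i _ <-]; have /andP[] := H i.
apply: ge_sup; first by exists (F i0), i0.
by move=> _ [i _ <-]; have /andP[] := H i.
Qed.

Lemma inf_sup_le (g h : T1 -> T2 -> R) (e B : R) :
  (forall al be, `|g al be| <= B) -> (forall al be, `|h al be| <= B) ->
  (forall al be, g al be <= h al be + e) -> inf_sup g <= inf_sup h + e.
Proof.
move=> gB hB gh; rewrite -lerBlDr; apply: lb_le_inf.
  by case: n1 => al _; exists (sup (range (fun be => h al be))), al.
move=> _ [al _ <-]; rewrite lerBlDr.
have b (k : T1 -> T2 -> R) : (forall al be, `|k al be| <= B) ->
    forall al, - B <= sup (range (fun be => k al be)) <= B.
  by move=> kB a; apply: sup_range_bounds => // be; rewrite -ler_norml.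
apply: (@le_trans _ _ (sup (range (fun be => g al be)))).
  apply: ge_inf; last by exists al.
  by exists (- B) => _ [a _ <-]; have /andP[] := b g gB a.
apply: ge_sup; first by case: n2 => be _; exists (g al be), be.
move=> _ [be _ <-]; apply: le_trans (gh _ _) _; rewrite lerD2r.
apply: ub_le_sup; last by exists be.
by exists B => _ [be' _ <-]; apply: le_trans (ler_norm _) (hB _ _).
Qed.

Lemma inf_sup_lipschitz (g h : T1 -> T2 -> R) (e B : R) :
  (forall al be, `|g al be| <= B) -> (forall al be, `|h al be| <= B) ->
  (forall al be, `|g al be - h al be| <= e) -> `|inf_sup g - inf_sup h| <= e.
Proof.
move=> gB hB gh; have h1 : inf_sup h <= inf_sup g + e.
  apply: inf_sup_le hB gB _ => al be.
  by have := gh al be; rewrite ler_norml => /andP[h1 _]; lra.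
have h2 : inf_sup g <= inf_sup h + e.
  apply: inf_sup_le gB hB _ => al be.
  by have := gh al be; rewrite ler_norml => /andP[_ h2]; lra.
by rewrite ler_norml; apply/andP; split; lra.
Qed.

Lemma inf_sup_bound (g : T1 -> T2 -> R) (B : R) :
  (forall al be, `|g al be| <= B) -> `|inf_sup g| <= B.
Proof.
move=> gB; have [a0 _] := n1; have [b0 _] := n2.
have B0 : 0 <= B by apply: le_trans (gB a0 b0).
have E : inf_sup (fun _ _ => 0) = 0.
  have H F : inf (range (fun _ : T1 => F : R)) = F.
    rewrite (_ : range _ = [set F]) ?inf1//.
    by apply/seteqP; split => [_ [_ _ <-]//|_ ->]; exists a0.
  have H' : sup (range (fun _ : T2 => 0 : R)) = 0.
    rewrite (_ : range _ = [set 0]) ?sup1//.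
    by apply/seteqP; split => [_ [_ _ <-]//|_ ->]; exists b0.
  by rewrite /inf_sup H' H.
rewrite -[inf_sup g]subr0 -{1}E; apply: (@inf_sup_lipschitz _ _ _ B) => // al be.
  by rewrite normr0.
by rewrite subr0.
Qed.

Lemma continuous_pair_bounded (h : T1 * T2 -> R) : continuous h ->
  exists B, forall p, `|h p| <= B.
Proof.
move=> ch; have : compact (h @` setT).
  apply: continuous_compact; first exact: continuous_subspaceT.
  by rewrite -setXTT; apply: compact_setX.
move=> /compact_bounded /ex_strict_bound_gt0 [M M0 HM]; exists M => p.
by apply: ltW; apply: HM; exists p.
Qed.

(** For a continuous payoff on compact spaces the infimum and the supremum may
    be taken over dense sequences; the infimum needs the supremum in the second
    variable to be upper semicontinuous in the first, which is where the second
    space has to be compact. *)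
Lemma inf_sup_dense (h : T1 * T2 -> R) (a : nat -> T1) (b : nat -> T2) :
  continuous h ->
  (forall (y : T1) (A : set T1), nbhs y A -> exists n, A (a n)) ->
  (forall (y : T2) (A : set T2), nbhs y A -> exists n, A (b n)) ->
  inf_sup (fun al be => h (al, be)) =
  inf (range (fun n => sup (range (fun k => h (a n, b k))))).
Proof.
move=> ch da db; have [B hB] := continuous_pair_bounded ch.
have hBl p : - B <= h p <= B by rewrite -ler_norml.
have nN : [set: nat] !=set0 by exists 0%N.
pose S al := sup (range (fun be => h (al, be))).
have SE al : S al = sup (range (fun k => h (al, b k))).
  apply/eqP; rewrite eq_le; apply/andP; split; last first.
    apply: ge_sup; first by exists (h (al, b 0%N)), 0%N.
    move=> _ [k _ <-]; apply: ub_le_sup; last by exists (b k).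
    by exists B => _ [be _ <-]; have /andP[] := hBl (al, be).
  apply: ge_sup; first by case: n2 => be _; exists (h (al, be)), be.
  move=> _ [be _ <-]; apply/ler_addgt0Pr => e e0.
  have : nbhs be (fun be' => ball (h (al, be)) e (h (al, be'))).
    have cb : {for be, continuous (fun be' => h (al, be'))}.
      apply: (continuous_comp (f := fun be' => (al, be')) (g := h)); last exact: ch.
      by apply: cvg_pair; [exact: cvg_cst|exact: cvg_id].
    by apply: cb; exact: nbhsx_ballx.
  move=> /db [k]; rewrite /ball /= ltr_norml => /andP[_ h1].
  apply: (@le_trans _ _ (h (al, b k) + e)); first by lra.
  rewrite lerD2r; apply: ub_le_sup; last by exists k.
  by exists B => _ [k' _ <-]; have /andP[] := hBl (al, b k').
rewrite /inf_sup -/S (_ : (fun n => _) = S \o a); last by apply/funext => n /=; rewrite SE.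
have Sb al : - B <= S al <= B by apply: sup_range_bounds.
apply/eqP; rewrite eq_le; apply/andP; split.
  apply: lb_le_inf; first by exists (S (a 0%N)), 0%N.
  move=> _ [n _ <-]; apply: ge_inf; last by exists (a n).
  by exists (- B) => _ [al _ <-]; have /andP[] := Sb al.
apply: lb_le_inf; first by case: n1 => al _; exists (S al), al.
move=> _ [al _ <-]; apply/ler_addgt0Pr => e e0.
have : \forall al' \near al, [set: T2] `<=` (fun be => h (al', be) <= S al + e).
  move: c2 => /compact_near_coveringP/(_ _ (nbhs al) (fun al' be => h (al', be) <= S al + e)).
  apply => be _.
  have : nbhs (al, be) (fun p => ball (h (al, be)) e (h p)).
    by apply: ch; exact: nbhsx_ballx.
  move=> [[A C] /= [nA nC] AC]; exists (C, A) => //= -[be' al'] /= [Cb Aa].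
  have := AC (al', be') (conj Aa Cb); rewrite /ball /= ltr_norml => /andP[h1 h2].
  have : h (al, be) <= S al.
    apply: ub_le_sup; last by exists be.
    by exists B => _ [be2 _ <-]; have /andP[] := hBl (al, be2).
  by lra.
move=> /da [n Hn]; apply: (@le_trans _ _ (S (a n))).
  apply: ge_inf; last by exists n.
  by exists (- B) => _ [k _ <-]; have /andP[] := Sb (a k).
apply: ge_sup; first by case: n2 => be _; exists (h (a n, be)), be.
by move=> _ [be _ <-]; exact: Hn.
Qed.

Section caratheodory_functions.
Context {d : nat}.
Local Notation E := 'rV[R]_d.
Local Notation leb := (@lebesgue_rV R d).
Variables (Omega : set E) (mO : measurable Omega).
Implicit Types g h : T1 -> T2 -> E -> R.

Lemma caratheodory_add g h : caratheodory Omega g -> caratheodory Omega h ->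
  caratheodory Omega (fun al be x => g al be x + h al be x).
Proof.
move=> [mg cg] [mh ch]; split=> [al be|].
  apply: (leb_measurable2 (op := +%R)) => //.
  by apply: measurable_funD; [exact: measurable_fst|exact: measurable_snd].
apply: filterS2 cg ch => x cg ch Ox ab.
by apply: continuousD; [exact: cg|exact: ch].
Qed.

Lemma caratheodory_mul g h : caratheodory Omega g -> caratheodory Omega h ->
  caratheodory Omega (fun al be x => g al be x * h al be x).
Proof.
move=> [mg cg] [mh ch]; split=> [al be|].
  apply: (leb_measurable2 (op := *%R)) => //.
  by apply: measurable_funM; [exact: measurable_fst|exact: measurable_snd].
apply: filterS2 cg ch => x cg ch Ox ab.
by apply: continuousM; [exact: cg|exact: ch].
Qed.

Lemma caratheodory_cst (u : E -> R) : leb_measurable Omega u ->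
  caratheodory Omega (fun (_ : T1) (_ : T2) => u).
Proof. by move=> mu; split=> //; apply: aeW => x _ ab; exact: cst_continuous. Qed.

Lemma caratheodory_sum n (g : 'I_n -> T1 -> T2 -> E -> R) :
  (forall i, caratheodory Omega (g i)) ->
  caratheodory Omega (fun al be x => \sum_i g i al be x).
Proof.
move=> H; elim: (index_enum _) => [|i r IHr].
  rewrite (_ : (fun _ _ _ => _) = fun _ _ => cst 0).
    by apply: caratheodory_cst; exists (cst 0) => //; exact: ae_eq_on_refl.
  by apply/funext => al; apply/funext => be; apply/funext => x; rewrite big_nil.
rewrite (_ : (fun _ _ _ => _) = fun al be x => g i al be x + \sum_(j <- r) g j al be x).
  exact: caratheodory_add.
by apply/funext => al; apply/funext => be; apply/funext => x; rewrite big_cons.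
Qed.

Lemma caratheodory_bounded g : caratheodory Omega g ->
  {ae leb, forall x, Omega x -> exists B, forall al be, `|g al be x| <= B}.
Proof.
move=> [_ cg]; apply: filterS cg => x cg /cg /continuous_pair_bounded [B HB].
by exists B => al be; exact: (HB (al, be)).
Qed.

(** By [inf_sup_dense] only countably many controls matter.  Their payoffs are
    replaced with Borel representatives and set to zero outside a Borel set of
    full measure on which all representatives agree with the payoffs and the
    payoff is continuous; there remain a countable infimum and supremum. *)
Lemma inf_sup_measurable g : caratheodory Omega g ->
  leb_measurable Omega (fun x => inf_sup (fun al be => g al be x)).
Proof.
move=> [mg cg].
have [a da] := compact_dense_sequence c1 n1.
have [b db] := compact_dense_sequence c2 n2.
have /choice[G HG] : forall nk : nat * nat, exists h : E -> R,
    measurable_fun setT h /\ ae_eq_on Omega (g (a nk.1) (b nk.2)) h.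
  by move=> [n k]; have [h mh gh] := mg (a n) (b k); exists h.
have : {ae leb, forall x, forall nk : nat * nat, Omega x ->
    g (a nk.1) (b nk.2) x = G nk x}.
  have : forall i : nat, \forall x \ae leb, forall nk : nat * nat, unpickle i = Some nk ->
      Omega x -> g (a nk.1) (b nk.2) x = G nk x.
    move=> i; case: unpickle => [nk|]; last exact: aeW.
    by apply: filterS (HG nk).2 => x H _ [<-].
  move/ae_foralln; apply: filterS => x H nk; apply: (H (pickle nk)); exact: pickleK.
move=> gG.
have [N [mN N0 subN]] := filterI cg gG.
pose M := Omega `\` N; have mM : measurable M by exact: measurableD.
pose G' n k x := \1_M x * G (n, k) x.
have mG' n k : measurable_fun setT (G' n k).
  by apply: measurable_funM; [exact: measurable_indic|exact: (HG _).1].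
have GM x : M x -> continuous (fun ab : T1 * T2 => g ab.1 ab.2 x) /\
    forall n k, G' n k x = g (a n) (b k) x.
  move=> [Ox Nx]; have : (fun x => (Omega x -> continuous (fun ab : T1 * T2 => g ab.1 ab.2 x)) /\
    forall nk : nat * nat, Omega x -> g (a nk.1) (b nk.2) x = G nk x) x.
    by apply: contrapT => H; apply: Nx; apply: subN.
  move=> [/(_ Ox) h1 h2]; split=> // n k.
  by rewrite /G' indicE mem_set ?mul1r ?(h2 (n, k))//; split.
have bG' x : exists B, forall n k, - B <= G' n k x <= B.
  have [Mx|Mx] := pselect (M x).
    have [h1 h2] := GM _ Mx; have [B HB] := continuous_pair_bounded h1.
    by exists B => n k; rewrite h2 -ler_norml; exact: (HB (a n, b k)).
  by exists 0 => n k; rewrite /G' indicE memNset// mul0r oppr0 lexx.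
have nN : [set: nat] !=set0 by exists 0%N.
have infsE (u : nat -> R) : inf (range u) = infs u 0%N.
  by congr inf; apply/seteqP; split => _ [k _ <-]; exists k.
have supsE (u : nat -> R) : sup (range u) = sups u 0%N.
  by congr sup; apply/seteqP; split => _ [k _ <-]; exists k.
exists (fun x => inf (range (fun n => sup (range (fun k => G' n k x))))).
  rewrite (_ : (fun x => _) = fun x => infs (fun n => sups (fun k => G' n k x) 0%N) 0%N).
    apply: (measurable_fun_infs (h := fun n x => sups (fun k => G' n k x) 0%N)) => [x _|n].
      have [B HB] := bG' x; exists (- B) => _ [n _ <-]; rewrite -supsE.
      by have /andP[] := sup_range_bounds (F := fun k => G' n k x) nN (HB n).
    apply: (measurable_fun_sups (h := G' n)) => // x _.
    by have [B HB] := bG' x; exists B => _ [k _ <-]; have /andP[] := HB n k.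
  by apply/funext => x; rewrite infsE; under eq_fun do rewrite supsE.
exists N; split => // x /= /not_implyP [Ox H]; apply: contrapT => Nx; apply: H.
have [h1 h2] := GM x (conj Ox Nx).
have := inf_sup_dense h1 da db; rewrite /= => ->.
congr (inf _); apply: eq_imagel => n _; congr (sup _); apply: eq_imagel => k _.
by rewrite h2.
Qed.

End caratheodory_functions.
End inf_sup.

(** * Linear operators and forms on classes of functions *)

Section linear_mod_ae.
Context {R : realType} {d : nat}.
Local Notation E := 'rV[R]_d.
Local Notation leb := (@lebesgue_rV R d).
Implicit Types (D : set E) (V X : set (E -> R)).

Lemma subspace_comb V n (c : 'I_n -> R) (e : 'I_n -> E -> R) :
  linear_subspace V -> (forall i, V (e i)) -> V (\sum_i c i *: e i).
Proof.
move=> [V0 VL] Ve; elim: (index_enum _) => [|i r IHr]; first by rewrite big_nil.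
by rewrite big_cons; exact: VL.
Qed.

Lemma subspace_sub V u v : linear_subspace V -> V u -> V v -> V (u - v).
Proof. by move=> [_ VL] Vu Vv; rewrite addrC -scaleN1r; exact: VL. Qed.

Lemma set_sum_subspace V X : linear_subspace V -> linear_subspace X ->
  linear_subspace (set_sum V X).
Proof.
move=> [V0 VL] [X0 XL]; split; first by exists 0, 0; split=> //; rewrite addr0.
move=> a _ _ [v [w [Vv Xw ->]]] [v' [w' [Vv' Xw' ->]]].
exists (a *: v + v'), (a *: w + w'); split; [exact: VL|exact: XL|].
by rewrite scalerDr addrACA.
Qed.

Lemma L2_linear_comb_ae D V T n (c : 'I_n -> R) (e : 'I_n -> E -> R) z :
  linear_subspace V -> L2_linear D V T -> (forall i, V (e i)) -> V z ->
  ae_eq_on D z (\sum_i c i *: e i) ->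
  ae_eq_on D (T z) (\sum_i c i *: T (e i)).
Proof.
move=> VS [_ ae lin] Ve Vz zE; have [V0 VL] := VS.
apply: ae_eq_on_trans (ae _ _ Vz (subspace_comb _ VS Ve) zE) _.
have Vr (r : seq 'I_n) : V (\sum_(i <- r) c i *: e i).
  by elim: r => [|i r IHr]; [rewrite big_nil|rewrite big_cons; exact: VL].
elim: (index_enum _) => [|i r IHr].
  rewrite !big_nil; have := lin (-1) 0 0 V0 V0.
  rewrite scaler0 addr0; apply: filterS => x H Dx; rewrite H//.
  by rewrite (_ : (_ + _) x = - 1 * T 0 x + T 0 x)// mulN1r addrC subrr.
rewrite !big_cons; apply: ae_eq_on_trans (lin _ _ _ (Ve i) (Vr r)) _.
by apply: ae_eq_on_lin => //; exact: ae_eq_on_refl.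
Qed.

Lemma L2_linear_sub D V T u v : linear_subspace V -> L2_linear D V T -> V u -> V v ->
  ae_eq_on D (T (u - v)) (T u - T v).
Proof.
move=> VS [_ ae lin] Vu Vv; rewrite addrC -scaleN1r.
apply: ae_eq_on_trans (lin _ _ _ Vv Vu) _.
by apply: ae_eq_on_eq => x _; rewrite scaleN1r addrC.
Qed.

(** The equation is required for every representative [w] of the combination, which
    includes the invariance of [l] under almost everywhere equality. *)
Definition ae_linear_form D V (l : (E -> R) -> R) :=
  forall (a : R) u v w, V u -> V v -> V w -> ae_eq_on D w (a *: u + v) ->
    l w = a * l u + l v.

Lemma ae_linear_form_comb D V l n (c : 'I_n -> R) (e : 'I_n -> E -> R) z :
  linear_subspace V -> ae_linear_form D V l -> (forall i, V (e i)) -> V z ->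
  ae_eq_on D z (\sum_i c i *: e i) -> l z = \sum_i c i * l (e i).
Proof.
move=> VS lin Ve Vz zE; have [V0 VL] := VS.
have l0 : l 0 = 0.
  have := lin (-1) 0 0 0 V0 V0 V0; rewrite scaler0 addr0.
  by move=> /(_ (ae_eq_on_refl _ _)) ->; rewrite mulN1r addrC subrr.
have Vr (r : seq 'I_n) : V (\sum_(i <- r) c i *: e i).
  by elim: r => [|i r IHr]; [rewrite big_nil|rewrite big_cons; exact: VL].
rewrite (lin 1 (\sum_i c i *: e i) 0 z) ?mul1r ?l0 ?addr0//; last by rewrite scale1r.
elim: (index_enum _) => [|i r IHr]; first by rewrite !big_nil.
rewrite !big_cons -IHr; apply: lin => //; last exact: ae_eq_on_refl.
by have := Vr (i :: r); rewrite big_cons.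
Qed.

Lemma ae_linear_formD D V (a : R) l l' :
  ae_linear_form D V l -> ae_linear_form D V l' ->
  ae_linear_form D V (fun v => l v + a * l' v).
Proof.
move=> lin lin' b u v w Vu Vv Vw wE.
by rewrite (lin b u v w)// (lin' b u v w)//; ring.
Qed.

Lemma L2_linearE D V T (a : R) u v w : linear_subspace V -> L2_linear D V T ->
  V u -> V v -> V w -> ae_eq_on D w (a *: u + v) ->
  ae_eq_on D (T w) (a *: T u + T v).
Proof.
move=> [_ VL] [L ae lin] Vu Vv Vw wE.
apply: ae_eq_on_trans (lin a _ _ Vu Vv); apply: ae => //; exact: VL.
Qed.

Lemma ip_linear_form D V T u : measurable D -> linear_subspace V -> L2 D u ->
  L2_linear D V T -> ae_linear_form D V (fun v => ip D u (T v)).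
Proof.
move=> mD VS Lu lT a v w z Vv Vw Vz zE; have [L _ _] := lT.
have TE := L2_linearE VS lT Vv Vw Vz zE.
rewrite (ip_ae (ae_eq_on_refl _ _) TE) ip_linr//; exact: L.
Qed.

Lemma bilinear_formr D X s (p : E -> R) : linear_subspace X ->
  symmetric_bilinear_on D X s -> X p -> ae_linear_form D X (s p).
Proof.
move=> [_ XL] [ae sym lin] Xp a u v w Xu Xv Xw wE.
rewrite sym// (ae w (a *: u + v))//; last exact: XL.
by rewrite lin// (sym u)// (sym v).
Qed.

Lemma bilinear_forml D X s (p : E -> R) : linear_subspace X ->
  symmetric_bilinear_on D X s -> X p -> ae_linear_form D X (s^~ p).
Proof.
move=> XS /[dup] [[_ sym _]] H Xp a u v w Xu Xv Xw wE.
by rewrite !(sym _ p)//; apply: (bilinear_formr XS H Xp).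
Qed.

Lemma ae_linear_form_comp D V X l T : linear_subspace V -> ae_linear_form D X l ->
  L2_linear D V T -> (forall v, V v -> X (T v)) ->
  ae_linear_form D V (fun v => l (T v)).
Proof.
move=> VS lin lT VX a u v w Vu Vv Vw wE; apply: lin; try exact: VX.
exact: (L2_linearE VS lT Vu Vv Vw wE).
Qed.

Lemma L2_abs D u : measurable D -> L2 D u -> L2 D (fun x => `|u x|).
Proof.
move=> mD Lu; have [[g mg ug] _] := Lu; apply: (L2_dominated mD _ Lu).
  exists (fun x => `|g x|); first exact: measurableT_comp.
  by apply: filterS ug => x ug Dx; rewrite ug.
by apply: aeW => x _; rewrite normr_id.
Qed.

Lemma Rintegral_dominated D u w : measurable D -> ae_integrable D u ->
  ae_integrable D w -> {ae leb, forall x, D x -> `|u x| <= w x} ->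
  `|\int[leb]_(x in D) u x| <= \int[leb]_(x in D) w x.
Proof.
move=> mD [g [mg ug ig]] [h [mh wh ih]] uw.
rewrite (Rintegral_ae ug) (Rintegral_ae wh).
apply: le_trans (le_normr_Rintegral mD ig) _.
have E : ae_eq_on D h (fun x => Num.max `|g x| (h x)).
  apply: filterS3 ug wh uw => x ug wh uw Dx.
  by apply/esym/max_idPr; rewrite -ug// -wh//; exact: uw.
rewrite (Rintegral_ae E); apply: le_Rintegral => //.
- exact: integrable_norm.
- apply: (le_integrable mD) (integrableD mD (integrable_norm ig) (integrable_norm ih)).
    apply/measurable_EFinP; apply: (@measurable_funS _ _ _ _ setT) => //.
    by apply: measurable_maxr => //; exact: measurableT_comp.
  move=> x Dx /=; rewrite lee_fin (ger0_norm (addr_ge0 _ _))//.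
  by rewrite /Num.max; case: ifP => _; rewrite ?normr_id ?lerDl ?lerDr.
- by move=> x _; rewrite le_max lexx.
Qed.

End linear_mod_ae.

(** * The discrete operator *)

Section discrete_operator.
Context {R : realType} {d : nat} {Lam1 Lam2 : metricType R}.
Local Notation E := 'rV[R]_d.
Local Notation leb := (@lebesgue_rV R d).
Variables (Omega : set E) (m j : nat).
Hypotheses (d0 : (0 < d)%N) (hO : convex_polytope Omega).
Hypotheses (cLam1 : compact [set: Lam1]) (cLam2 : compact [set: Lam2])
  (nLam1 : [set: Lam1] !=set0) (nLam2 : [set: Lam2] !=set0).
Variables (A : Lam1 -> Lam2 -> E -> 'M[R]_d) (b : Lam1 -> Lam2 -> E -> E)
  (c f gamma : Lam1 -> Lam2 -> E -> R) (lambda kappa : R).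
Hypotheses (hdata : isaacs_data Omega A b c f)
  (hcordes : cordes Omega A b c gamma lambda kappa)
  (hf : source_in_L2 Omega f gamma).
Variable Kh : @mesh R d.
Hypothesis hK : polytopal_mesh Omega Kh.
Variable Vh : set (E -> R).
Hypothesis hVh : fe_space Omega Vh.
Variables s0 s2 : (E -> R) -> (E -> R) -> R.
Let X := set_sum Vh (pw_poly Kh m).
Hypotheses (hs0 : symmetric_bilinear_on Omega X s0)
  (hs2 : symmetric_bilinear_on Omega X s2).
Variable eta : R.

Local Notation Pi := (L2_proj Omega Kh).
Local Notation D := (broken_partial Omega Kh).
Local Notation F := (Fgammah Omega A b c f gamma Kh m j).
Local Notation Lop := (Llambdah Omega lambda Kh m j).
Local Notation Aop := (Ah Omega A b c f gamma lambda Kh m j s0 s2 eta).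

Let mO := polytope_measurable hO.
Let oO := polytope_open hO.
Let bO := polytope_bounded hO.

Lemma Vh_subspace : linear_subspace Vh. Proof. by case: hVh. Qed.
Lemma Vh_H2 : Vh `<=` H2 Omega. Proof. by case: hVh. Qed.
Lemma Vh_H1 : Vh `<=` H1 Omega. Proof. by move=> v /Vh_H2 /H2_H1. Qed.
Lemma Vh_L2 : Vh `<=` L2 Omega. Proof. by move=> v /Vh_H1 /H1_L2. Qed.

Let P2 i k v := Pi (m - j) (D i (D k v)).
Let P1 i v := Pi (m - j) (D i v).
Let P0 v := Pi (m - j) v.

Let P2_lin i k : L2_linear Omega Vh (P2 i k).
Proof.
apply: (L2_linear_proj d0 hO hK); apply: L2_linearS Vh_H2 _.
exact: broken_partial2_linear.
Qed.

Let P1_lin i : L2_linear Omega Vh (P1 i).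
Proof.
apply: (L2_linear_proj d0 hO hK); apply: L2_linearS Vh_H1 _.
exact: broken_partial_linear.
Qed.

Let P0_lin : L2_linear Omega Vh P0.
Proof. by apply: (L2_linear_proj d0 hO hK); exact: L2_linear_id Vh_L2. Qed.

Lemma Llambdah_linear : L2_linear Omega Vh Lop.
Proof.
apply: (L2_linear_proj d0 hO hK).
rewrite (_ : (fun v => _) = fun v => (- lambda) *: id v + \sum_i D i (D i v)).
  apply: (L2_linear_comb hO); first exact: L2_linear_id Vh_L2.
  apply: (L2_linear_sum hO) => i; apply: L2_linearS Vh_H2 _.
  exact: broken_partial2_linear.
by apply/funext => v; rewrite scaleNr addrC.
Qed.

Lemma projection_error_linear k : L2_linear Omega Vh (fun v => v - Pi k v).
Proof.
rewrite (_ : (fun v => _) = fun v => (-1) *: Pi k v + id v).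
  apply: (L2_linear_comb hO); last exact: L2_linear_id Vh_L2.
  by apply: (L2_linear_proj d0 hO hK); exact: L2_linear_id Vh_L2.
by apply/funext => v; rewrite scaleN1r addrC.
Qed.

Lemma projection_error_sum k v : (k <= m)%N -> Vh v -> X (v - Pi k v).
Proof.
move=> km Vv; exists v, (- Pi k v); split => //.
have [pp _] := L2_proj_spec d0 hO hK k (Vh_L2 Vv).
have [P0' PL] : linear_subspace (pw_poly Kh k) by exact: pw_poly_subspace.
by have := PL (-1) _ _ pp P0'; rewrite addr0 scaleN1r; exact: pw_polyW.
Qed.

Lemma X_subspace : linear_subspace X.
Proof. by apply: set_sum_subspace; [exact: Vh_subspace|exact: pw_poly_subspace]. Qed.

(** The Cordes condition bounds the rescaled coefficients, uniformly in the
    controls and the point; this is what makes the nonlinearity Lipschitz. *)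
Lemma cordes_bound : exists2 M : R, 0 <= M & forall al be x, Omega x ->
  [/\ forall i k, `|gamma al be x * A al be x i k| <= M,
      forall i, `|gamma al be x * b al be x 0 i| <= M
    & `|gamma al be x * c al be x| <= M].
Proof.
have [l0 /andP[k0 k1] _ _ H] := hcordes; exists (2 * lambda + 2); first by lra.
have frob_entry (N : 'M[R]_d) i k : N i k ^+ 2 <= frob N N.
  rewrite /frob (bigD1 i isT) /= (bigD1 k isT) /= -expr2 -addrA lerDl.
  apply: addr_ge0; first by apply: sumr_ge0 => l _; rewrite -expr2 sqr_ge0.
  by apply: sumr_ge0 => l _; apply: sumr_ge0 => l' _; rewrite -expr2 sqr_ge0.
have kk : (1 - kappa) ^+ 2 <= 1 by nra.
have entry (N : 'M[R]_d) i k : sq_dist_id N <= (1 - kappa) ^+ 2 -> `|N i k| <= 2.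
  move=> h; have : (N - 1%:M) i k ^+ 2 <= 1.
    by apply: le_trans (frob_entry _ _ _) _; apply: le_trans h kk.
  rewrite !mxE => h1; have : `|N i k - (i == k)%:R| <= 1.
    by rewrite -(@ler_pXn2r _ 2) ?nnegrE// expr1n real_normK ?num_real.
  rewrite ler_norml => /andP[h2 h3]; rewrite ler_norml.
  have : 0 <= ((i == k)%:R : R) <= 1 by case: (i == k); rewrite ?lexx ?ler01.
  by move=> /andP[h4 h5]; apply/andP; split; lra.
move=> al be x Ox; have [h hl0] := H al be x Ox.
have vec (y : E) i : y 0 i ^+ 2 <= enorm y ^+ 2.
  rewrite /enorm sqr_sqrtr; last by apply: sumr_ge0 => k _; exact: sqr_ge0.
  rewrite (bigD1 i isT) lerDl; apply: sumr_ge0 => k _; exact: sqr_ge0.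
have [lz|lnz] := eqVneq lambda 0.
  have [hA hb hc] := hl0 lz; split=> [i k|i|].
  - have -> : gamma al be x * A al be x i k = (gamma al be x *: A al be x) i k by rewrite mxE.
    by apply: le_trans (entry _ _ _ hA) _; lra.
  - by rewrite hb mxE mulr0 normr0; lra.
  - by rewrite hc mulr0 normr0; lra.
have lp : 0 < lambda by rewrite lt_def lnz.
have l2 : 0 < lambda ^+ 2 by rewrite exprn_gt0.
have sA : 0 <= sq_dist_id (gamma al be x *: A al be x).
  by apply: sumr_ge0 => i _; apply: sumr_ge0 => k _; rewrite -expr2 sqr_ge0.
have sb := sqr_ge0 (enorm (gamma al be x *: b al be x)).
have sc := sqr_ge0 `|gamma al be x * c al be x - lambda|.
have lb : 0 <= lambda / 2 * enorm (gamma al be x *: b al be x) ^+ 2.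
  by rewrite mulr_ge0// divr_ge0.
have lA : 0 <= lambda ^+ 2 * sq_dist_id (gamma al be x *: A al be x).
  by rewrite mulr_ge0// ltW.
have lk : lambda ^+ 2 * (1 - kappa) ^+ 2 <= lambda ^+ 2.
  by rewrite -[leRHS]mulr1 ler_pM2l.
split=> [i k|i|].
- have -> : gamma al be x * A al be x i k = (gamma al be x *: A al be x) i k by rewrite mxE.
  apply: (@le_trans _ _ 2); last by lra.
  by apply: entry; rewrite -(ler_pM2l l2); lra.
- have -> : gamma al be x * b al be x 0 i = (gamma al be x *: b al be x) 0 i by rewrite mxE.
  have h2 : enorm (gamma al be x *: b al be x) ^+ 2 <= 2 * lambda.
    have : lambda / 2 * enorm (gamma al be x *: b al be x) ^+ 2 <= lambda / 2 * (2 * lambda).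
      by rewrite (_ : lambda / 2 * (2 * lambda) = lambda ^+ 2); [lra|field].
    by rewrite ler_pM2l// divr_gt0.
  have h3 := le_trans (vec _ i) h2.
  rewrite -(@ler_pXn2r _ 2) ?nnegrE//; last by lra.
  by rewrite real_normK ?num_real//; nra.
- have h2 : `|gamma al be x * c al be x - lambda| <= lambda.
    by rewrite -(@ler_pXn2r _ 2) ?nnegrE//; lra.
  by move: h2; rewrite !ler_norml => /andP[h2 h3]; apply/andP; split; lra.
Qed.

Let amplitude (p : 'I_d -> 'I_d -> R) (q : 'I_d -> R) (r : R) : R :=
  \sum_i \sum_k `|p i k| + \sum_i `|q i| + `|r|.

(** Isolates the dependence on the Hessian, the gradient and the value, in which
    the payoff is affine. *)
Let linear_part al be x (p : 'I_d -> 'I_d -> R) (q : 'I_d -> R) (r : R) : R :=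
  \sum_i \sum_k A al be x i k * p i k + \sum_i b al be x 0 i * q i - c al be x * r.

Let LhE al be v x : Lh Omega A b c Kh m j al be v x =
  linear_part al be x (fun i k => P2 i k v x) (fun i => P1 i v x) (P0 v x).
Proof.
congr (_ + _ - _); apply: eq_bigr => i _; apply: eq_bigr => k _.
by rewrite mxE.
Qed.

Let linear_part_bound M al be x p q r :
  [/\ forall i k, `|gamma al be x * A al be x i k| <= M,
      forall i, `|gamma al be x * b al be x 0 i| <= M
    & `|gamma al be x * c al be x| <= M] ->
  `|gamma al be x * linear_part al be x p q r| <= M * amplitude p q r.
Proof.
move=> [hA hb hc]; rewrite /linear_part /amplitude mulrBr !mulrDr mulr_sumr.
apply: le_trans (ler_normB _ _) _; apply: lerD; last first.
  by rewrite mulrA normrM ler_wpM2r.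
apply: le_trans (ler_normD _ _) _; apply: lerD.
  rewrite mulr_sumr; apply: le_trans (ler_norm_sum _ _ _) _.
  apply: ler_sum => i _; rewrite !mulr_sumr; apply: le_trans (ler_norm_sum _ _ _) _.
  by apply: ler_sum => k _; rewrite mulrA normrM ler_wpM2r.
rewrite !mulr_sumr; apply: le_trans (ler_norm_sum _ _ _) _.
by apply: ler_sum => i _; rewrite mulrA normrM ler_wpM2r.
Qed.

Let payoff v al be x := gamma al be x * (Lh Omega A b c Kh m j al be v x - f al be x).

Let FE v x : F v x = inf_sup (fun al be => payoff v al be x).
Proof. by []. Qed.

Let leb_measurable_L2 (u : E -> R) : L2 Omega u -> leb_measurable Omega u.
Proof. by case. Qed.

Let payoff_caratheodory v : Vh v -> caratheodory Omega (payoff v).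
Proof.
move=> Vv; have [cA cb [cc cf] _ _] := hdata; have [_ _ cg _ _] := hcordes.
have cP2 i k : caratheodory Omega (fun (_ : Lam1) (_ : Lam2) => P2 i k v).
  by apply: caratheodory_cst; apply: leb_measurable_L2; have [L _ _] := P2_lin i k; exact: L.
have cP1 i : caratheodory Omega (fun (_ : Lam1) (_ : Lam2) => P1 i v).
  by apply: caratheodory_cst; apply: leb_measurable_L2; have [L _ _] := P1_lin i; exact: L.
have cP0 : caratheodory Omega (fun (_ : Lam1) (_ : Lam2) => P0 v).
  by apply: caratheodory_cst; apply: leb_measurable_L2; have [L _ _] := P0_lin; exact: L.
have cN : caratheodory Omega (fun (_ : Lam1) (_ : Lam2) => cst (- 1) : E -> R).
  by apply: caratheodory_cst; exists (cst (- 1)) => //; exact: ae_eq_on_refl.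
rewrite (_ : payoff v = fun al be x => gamma al be x *
  ((\sum_i \sum_k A al be x i k * P2 i k v x + \sum_i b al be x 0 i * P1 i v x)
   + cst (- 1) x * (c al be x * P0 v x) + cst (- 1) x * f al be x)).
  apply: caratheodory_mul => //; apply: caratheodory_add; last exact: caratheodory_mul.
  apply: caratheodory_add; last by apply: caratheodory_mul => //; exact: caratheodory_mul.
  apply: caratheodory_add.
    apply: caratheodory_sum => i; apply: caratheodory_sum => k.
    exact: caratheodory_mul (cA i k) (cP2 i k).
  apply: caratheodory_sum => i; exact: caratheodory_mul (cb i) (cP1 i).
apply/funext => al; apply/funext => be; apply/funext => x.
by rewrite /payoff LhE /linear_part /= !mulN1r.
Qed.

Let Amp v x := amplitude (fun i k => P2 i k v x) (fun i => P1 i v x) (P0 v x).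

Let amplitude_L2 (p : 'I_d -> 'I_d -> E -> R) (q : 'I_d -> E -> R) (r : E -> R) :
  (forall i k, L2 Omega (p i k)) -> (forall i, L2 Omega (q i)) -> L2 Omega r ->
  L2 Omega (fun x => amplitude (fun i k => p i k x) (fun i => q i x) (r x)).
Proof.
move=> Lp Lq Lr.
rewrite (_ : (fun x => _) = \sum_i \sum_k (fun x => `|p i k x|) +
  \sum_i (fun x => `|q i x|) + (fun x => `|r x|)).
  apply: L2_add => //; last exact: L2_abs.
  apply: L2_add => //.
    by apply: L2_sum => // i; apply: L2_sum => // k; exact: L2_abs.
  by apply: L2_sum => // i; exact: L2_abs.
apply/funext => x; rewrite /amplitude.
have sumE n (u : 'I_n -> E -> R) y : (\sum_i u i) y = \sum_i u i y by rewrite fct_sumE.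
transitivity ((\sum_i \sum_k (fun x => `|p i k x|)) x +
  (\sum_i (fun x => `|q i x|)) x + `|r x|); last by [].
rewrite !sumE; congr (_ + _ + _).
by apply: eq_bigr => i _; rewrite sumE.
Qed.

Let Amp_L2 v : Vh v -> L2 Omega (Amp v).
Proof.
move=> Vv; apply: amplitude_L2 => [i k|i|].
- by have [L _ _] := P2_lin i k; exact: L.
- by have [L _ _] := P1_lin i; exact: L.
- by have [L _ _] := P0_lin; exact: L.
Qed.

Let payoff_bounded v : Vh v ->
  {ae leb, forall x, Omega x -> exists B, forall al be, `|payoff v al be x| <= B}.
Proof. by move=> /payoff_caratheodory /caratheodory_bounded; apply. Qed.

(** The linear part of the payoff is at most a multiple of the projected
    derivatives of [v], uniformly in the controls, and the source is dominated by
    its supremum, which is in L2. *)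
Lemma Fgammah_L2 v : Vh v -> L2 Omega (F v).
Proof.
move=> Vv; have [M M0 HM] := cordes_bound.
have [_ _ [_ cf] _ _] := hdata; have [_ _ cg g0 _] := hcordes.
have Lw := L2_lin mO M (Amp_L2 Vv) hf.
apply: (L2_dominated mO _ Lw).
  by have := inf_sup_measurable cLam1 cLam2 nLam1 nLam2 mO (payoff_caratheodory Vv).
have bf := caratheodory_bounded cLam1 cLam2 (caratheodory_mul cg cf).
apply: filterS bf => x bf Ox; have [B HB] := bf Ox.
rewrite FE; apply: le_trans (ler_norm _).
apply: inf_sup_bound => // al be.
rewrite (_ : (_ + _) x = M * Amp v x + sup (range (fun ab : Lam1 * Lam2 =>
    gamma ab.1 ab.2 x * `|f ab.1 ab.2 x|)))//.
rewrite /payoff mulrBr; apply: le_trans (ler_normB _ _) _; apply: lerD.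
  by rewrite LhE; apply: linear_part_bound; exact: HM.
apply: ub_le_sup; last by exists (al, be) => //=; rewrite normrM gtr0_norm// g0.
exists B => _ [[al' be'] _ <-] /=.
by rewrite -[X in X * _]gtr0_norm ?g0// -normrM.
Qed.

Let Amp_diff u v al be x :
  payoff u al be x - payoff v al be x = gamma al be x *
    linear_part al be x (fun i k => P2 i k u x - P2 i k v x)
      (fun i => P1 i u x - P1 i v x) (P0 u x - P0 v x).
Proof.
rewrite /payoff !LhE -mulrBr; congr (_ * _); rewrite /linear_part.
have -> : \sum_i \sum_k A al be x i k * (P2 i k u x - P2 i k v x) =
  \sum_i \sum_k A al be x i k * P2 i k u x - \sum_i \sum_k A al be x i k * P2 i k v x.
  rewrite -sumrB; apply: eq_bigr => i _; rewrite -sumrB; apply: eq_bigr => k _.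
  exact: mulrBr.
have -> : \sum_i b al be x 0 i * (P1 i u x - P1 i v x) =
  \sum_i b al be x 0 i * P1 i u x - \sum_i b al be x 0 i * P1 i v x.
  by rewrite -sumrB; apply: eq_bigr => i _; exact: mulrBr.
have arith (s s' t t' k p p' g : R) : s + t - k * p - g - (s' + t' - k * p' - g) =
    s - s' + (t - t') - k * (p - p') by ring.
exact: arith.
Qed.

(** An inf-sup is nonexpansive for the uniform norm on payoffs, and the difference
    of two payoffs is the linear part applied to the derivatives of [u - v]; these
    are linear in the coordinates [t] of [u - v]. *)
Lemma Fgammah_lipschitz n (e : 'I_n -> E -> R) : (forall k, Vh (e k)) ->
  exists2 H : 'I_n -> E -> R, (forall k, L2 Omega (H k) /\ forall x, 0 <= H k x) &
    forall (t : 'I_n -> R) u v, Vh u -> Vh v ->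
      ae_eq_on Omega (u - v) (\sum_k t k *: e k) ->
      {ae leb, forall x, Omega x -> `|F u x - F v x| <= \sum_k `|t k| * H k x}.
Proof.
move=> Ve; have [M M0 HM] := cordes_bound.
exists (fun k => M *: Amp (e k)).
  move=> k; split; first by apply: L2_scale => //; exact: Amp_L2.
  move=> x; rewrite (_ : (_ *: _) x = M * Amp (e k) x)// mulr_ge0// /Amp /amplitude.
  rewrite !addr_ge0//; last by apply: sumr_ge0.
  by apply: sumr_ge0 => i _; apply: sumr_ge0.
move=> t u v Vu Vv uvE.
have Vuv : Vh (u - v) by apply: subspace_sub => //; exact: Vh_subspace.
have E T : L2_linear Omega Vh T ->
    {ae leb, forall x, Omega x -> T u x - T v x = \sum_k t k * T (e k) x}.
  move=> lT; have h1 := L2_linear_sub Vh_subspace lT Vu Vv.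
  have h2 := L2_linear_comb_ae Vh_subspace lT Ve Vuv uvE.
  apply: filterS2 h1 h2 => x h1 h2 Ox.
  rewrite -[LHS]/((T u - T v) x) -h1// h2// fct_sumE; exact: eq_bigr.
have E2 : {ae leb, forall x, forall ik : 'I_d * 'I_d, Omega x ->
    P2 ik.1 ik.2 u x - P2 ik.1 ik.2 v x = \sum_k t k * P2 ik.1 ik.2 (e k) x}.
  by apply: ae_forall_fin => -[i k]; exact: E.
have E1 : {ae leb, forall x, forall i, Omega x ->
    P1 i u x - P1 i v x = \sum_k t k * P1 i (e k) x}.
  by apply: ae_forall_fin => i; exact: E.
have E0 := E _ P0_lin.
have {E2 E1}Eall : {ae leb, forall x, Omega x ->
    [/\ forall i k, P2 i k u x - P2 i k v x = \sum_l t l * P2 i k (e l) x,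
        forall i, P1 i u x - P1 i v x = \sum_l t l * P1 i (e l) x
      & P0 u x - P0 v x = \sum_l t l * P0 (e l) x]}.
  apply: filterS3 E2 E1 E0 => x e2 e1 e0 Ox; split=> [i k|i|].
  - exact: (e2 (i, k) Ox).
  - exact: e1.
  - exact: e0.
apply: filterS3 (payoff_bounded Vu) (payoff_bounded Vv) Eall => x bu bv Eall Ox.
have [E2 E1 {}E0] := Eall Ox.
have [Bu HBu] := bu Ox; have [Bv HBv] := bv Ox.
rewrite !FE; apply: (@inf_sup_lipschitz _ _ _ nLam1 nLam2 _ _ _ (Num.max Bu Bv)).
- by move=> al be; rewrite le_max HBu.
- by move=> al be; rewrite le_max HBv orbT.
move=> al be; rewrite Amp_diff.
apply: le_trans (linear_part_bound _ _ _ (HM al be x Ox)) _.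
have tri (T : 'I_n -> R) (a : R) : a = \sum_k t k * T k -> `|a| <= \sum_k `|t k| * `|T k|.
  by move=> ->; apply: le_trans (ler_norm_sum _ _ _) _; apply: ler_sum => k _; rewrite normrM.
have -> : \sum_k `|t k| * (M *: Amp (e k)) x = M * \sum_k `|t k| * Amp (e k) x.
  by rewrite mulr_sumr; apply: eq_bigr => k _; rewrite mulrCA.
apply: ler_wpM2l => //; rewrite /Amp /amplitude.
have -> : \sum_k `|t k| * (\sum_i \sum_k0 `|P2 i k0 (e k) x| + \sum_i `|P1 i (e k) x|
    + `|P0 (e k) x|) =
  \sum_i \sum_k0 \sum_k `|t k| * `|P2 i k0 (e k) x| + \sum_i \sum_k `|t k| * `|P1 i (e k) x|
    + \sum_k `|t k| * `|P0 (e k) x|.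
  under eq_bigr do rewrite !mulrDr.
  rewrite !big_split /=; congr (_ + _ + _).
    under eq_bigr do rewrite mulr_sumr; rewrite exchange_big /=; apply: eq_bigr => i _.
    by under eq_bigr do rewrite mulr_sumr; rewrite exchange_big.
  by under eq_bigr do rewrite mulr_sumr; rewrite exchange_big.
apply: lerD; last exact: tri E0.
apply: lerD.
  by apply: ler_sum => i _; apply: ler_sum => k _; exact: tri (E2 i k).
by apply: ler_sum => i _; exact: tri (E1 i).
Qed.

Lemma Ah_linear_form v : Vh v -> ae_linear_form Omega Vh (Aop v).
Proof.
move=> Vv; have XS := X_subspace; have VS := Vh_subspace.
have l1 := ip_linear_form mO VS (Fgammah_L2 Vv) Llambdah_linear.
have l2 := ae_linear_form_comp VS (bilinear_formr XS hs2 (projection_error_sum (leqnn m) Vv))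
  (projection_error_linear m) (fun w Vw => projection_error_sum (leqnn m) Vw).
have l3 := ae_linear_form_comp VS (bilinear_formr XS hs0 (projection_error_sum (leq_subr j m) Vv))
  (projection_error_linear (m - j)) (fun w Vw => projection_error_sum (leq_subr j m) Vw).
exact: (ae_linear_formD eta l1 (ae_linear_formD (lambda ^+ 2) l2 l3)).
Qed.

(** Together with linearity in [w], this makes the discrete equations a Lipschitz
    system in the coordinates of the unknown. *)
Lemma Ah_lipschitz n (e : 'I_n -> E -> R) w : (forall k, Vh (e k)) -> Vh w ->
  exists2 K : R, 0 <= K & forall (t : 'I_n -> R) u v, Vh u -> Vh v ->
    ae_eq_on Omega (u - v) (\sum_k t k *: e k) ->
    `|Aop u w - Aop v w| <= K * \sum_k `|t k|.
Proof.
move=> Ve Vw.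
have arith (p p' r r' : R) :
    p + eta * r - (p' + eta * r') = p - p' + eta * (- 1 * r' + r) by ring.
have XS := X_subspace; have VS := Vh_subspace.
have [H HL Hlip] := Fgammah_lipschitz Ve.
have Lw : L2 Omega (Lop w) by have [L _ _] := Llambdah_linear; exact: L.
pose q x := `|Lop w x|; have Lq : L2 Omega q by exact: L2_abs.
have q0 x : 0 <= q x by exact: normr_ge0.
pose K1 := \sum_k ip Omega (H k) q.
have ipH k : 0 <= ip Omega (H k) q.
  by apply: Rintegral_ge0 => x _; apply: mulr_ge0 => //; exact: (HL k).2.
pose l u := s2 (u - Pi m u) (w - Pi m w)
  + lambda ^+ 2 * s0 (u - Pi (m - j) u) (w - Pi (m - j) w).
have l2 := ae_linear_form_comp VS (bilinear_forml XS hs2 (projection_error_sum (leqnn m) Vw))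
  (projection_error_linear m) (fun w Vw => projection_error_sum (leqnn m) Vw).
have l3 := ae_linear_form_comp VS (bilinear_forml XS hs0 (projection_error_sum (leq_subr j m) Vw))
  (projection_error_linear (m - j)) (fun w Vw => projection_error_sum (leq_subr j m) Vw).
have ll : ae_linear_form Omega Vh l := ae_linear_formD (lambda ^+ 2) l2 l3.
pose K2 := `|eta| * \sum_k `|l (e k)|.
have sum_le (T : 'I_n -> R) (t : 'I_n -> R) : (forall k, 0 <= T k) ->
    \sum_k `|t k| * T k <= (\sum_k T k) * \sum_k `|t k|.
  move=> T0; rewrite mulr_sumr; apply: ler_sum => k _; rewrite mulrC ler_wpM2r//.
  by rewrite (bigD1 k isT) lerDl; apply: sumr_ge0 => i _.
exists (K1 + K2).
  by rewrite addr_ge0 ?sumr_ge0// mulr_ge0// sumr_ge0.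
move=> t u v Vu Vv uvE; have LFu := Fgammah_L2 Vu; have LFv := Fgammah_L2 Vv.
have Vuv : Vh (u - v) by exact: subspace_sub.
have -> : Aop u w - Aop v w = ip Omega (F u - F v) (Lop w) + eta * l (u - v).
  rewrite ip_subl// (ll (-1) v u (u - v))//; last first.
    by rewrite scaleN1r addrC; exact: ae_eq_on_refl.
  rewrite -[Aop u w]/(ip Omega (F u) (Lop w) + eta * l u).
  rewrite -[Aop v w]/(ip Omega (F v) (Lop w) + eta * l v).
  exact: arith.
apply: le_trans (ler_normD _ _) _; rewrite mulrDl; apply: lerD; last first.
  rewrite (ae_linear_form_comb VS ll Ve Vuv uvE) normrM -mulrA ler_wpM2l//.
  apply: le_trans (ler_norm_sum _ _ _) _.
  under eq_bigr do rewrite normrM.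
  exact: sum_le.
apply: le_trans (sum_le _ t ipH).
have -> : \sum_k `|t k| * ip Omega (H k) q = ip Omega (\sum_k `|t k| *: H k) q.
  by rewrite ip_suml// => k; exact: (HL k).1.
apply: Rintegral_dominated => //.
- by apply: L2_mul => //; exact: L2_sub.
- by apply: L2_mul => //; apply: L2_sum => // k; apply: L2_scale => //; exact: (HL k).1.
apply: filterS (Hlip t u v Vu Vv uvE) => x hx Ox.
rewrite normrM ler_wpM2r// fct_sumE; exact: hx.
Qed.

End discrete_operator.

(** * Zeros of strongly monotone maps of R^n *)

Section strongly_monotone.
Context {R : realType} {n : nat}.
Local Notation W := 'rV[R]_n.
Implicit Types x y z : W.

Definition dot x y : R := \sum_i x 0 i * y 0 i.

Lemma dotC x y : dot x y = dot y x.
Proof. by apply: eq_bigr => i _; rewrite mulrC. Qed.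

Lemma dot_linl (a : R) x y z : dot (a *: x + y) z = a * dot x z + dot y z.
Proof.
rewrite /dot mulr_sumr -big_split; apply: eq_bigr => i _ /=.
by rewrite !mxE mulrDl mulrA.
Qed.

Lemma dot_linr (a : R) x y z : dot z (a *: x + y) = a * dot z x + dot z y.
Proof. by rewrite dotC dot_linl !(dotC z). Qed.

Lemma dot_subl x y z : dot (x - y) z = dot x z - dot y z.
Proof. by rewrite -[x - y]addrC -scaleN1r dot_linl mulN1r addrC. Qed.

Lemma dot_ge0 x : 0 <= dot x x.
Proof. by apply: sumr_ge0 => i _; rewrite -expr2 sqr_ge0. Qed.

Lemma dot_coord x i : x 0 i ^+ 2 <= dot x x.
Proof.
rewrite /dot (bigD1 i isT) /= -expr2 lerDl; apply: sumr_ge0 => k _.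
by rewrite -expr2 sqr_ge0.
Qed.

Lemma dot_eq0 x : dot x x = 0 -> x = 0.
Proof.
move=> x0; apply/rowP => i; rewrite mxE; apply/eqP; rewrite -sqrf_eq0 eq_le sqr_ge0 andbT.
by rewrite -x0 dot_coord.
Qed.

Lemma dot0 : dot 0 0 = 0.
Proof. by apply: big1 => i _; rewrite mxE mul0r. Qed.

Lemma continuous_dot (f g : W -> W) : (forall i, continuous (fun x => f x 0 i)) ->
  (forall i, continuous (fun x => g x 0 i)) -> continuous (fun x => dot (f x) (g x)).
Proof.
move=> cf cg; apply: continuous_sum_fin => i x.
by apply: continuousM; [exact: cf|exact: cg].
Qed.

Lemma compact_dot_ball (r : R) : compact [set x | dot x x <= r].
Proof.
apply: (subclosed_compact _ (@compact_cbox _ _ (const_mx (- (`|r| + 1))) (const_mx (`|r| + 1)))).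
  rewrite (_ : [set x | _] = (fun x => dot x x) @^-1` [set y | y <= r])//.
  apply: closed_comp; last exact: closed_le.
  by move=> x _; apply: continuous_dot => i; exact: coord_continuous.
move=> x /= xr i; rewrite !mxE -ler_norml.
have h : x 0 i ^+ 2 <= `|r| by apply: le_trans (dot_coord x i) (le_trans xr (ler_norm _)).
have r0 : 0 <= `|r| by [].
rewrite -(@ler_pXn2r _ 2) ?nnegrE ?addr_ge0// real_normK ?num_real//.
by apply: le_trans h _; rewrite sqrrD; nra.
Qed.

Variables (beta : 'I_n -> 'I_n -> R).
Definition quad x : R := \sum_k \sum_l x 0 k * x 0 l * beta k l.

Lemma quadZ (a : R) x : quad (a *: x) = a ^+ 2 * quad x.
Proof.
rewrite /quad mulr_sumr; apply: eq_bigr => k _; rewrite mulr_sumr; apply: eq_bigr => l _.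
by rewrite !mxE; ring.
Qed.

Lemma quad_continuous : continuous quad.
Proof.
apply: continuous_sum_fin => k; apply: continuous_sum_fin => l x.
apply: (@continuousM _ _ (fun x => x 0 k * x 0 l) (fun=> beta k l)); last exact: cst_continuous.
by apply: (@continuousM _ _ (fun x : W => x 0 k) (fun x : W => x 0 l)); exact: coord_continuous.
Qed.

(** By homogeneity, the minimum of the form on the unit sphere is a coercivity
    constant. *)
Lemma quad_coercive : (forall x, x != 0 -> 0 < quad x) ->
  exists2 mu : R, 0 < mu & forall x, mu * dot x x <= quad x.
Proof.
move=> q0; have [x0|nx0] := pselect (exists x, x != 0); last first.
  exists 1 => // x; have [->|xn0] := eqVneq x 0; last by case: nx0; exists x.
  by rewrite dot0 -(scale0r (0 : W)) quadZ expr0n /= mul0r mulr0.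
pose S := [set x | dot x x <= 1] `&` (fun x => dot x x) @^-1` [set 1].
have cd : continuous (fun x => dot x x).
  by apply: continuous_dot => i; exact: coord_continuous.
have cS : compact S.
  apply: compact_closedI; first exact: compact_dot_ball.
  by apply: closed_comp; [move=> x _; exact: cd|exact: closed_eq].
have normalize x : x != 0 -> S ((Num.sqrt (dot x x))^-1 *: x).
  move=> xn0; have d0 : 0 < dot x x.
    rewrite lt_def dot_ge0 andbT; apply: contra xn0 => /eqP /dot_eq0 ->//.
  set s := Num.sqrt _; have sE : s ^+ 2 = dot x x by rewrite sqr_sqrtr ?ltW.
  have s0 : s != 0 by rewrite gt_eqF// sqrtr_gt0.
  have E : dot (s^-1 *: x) (s^-1 *: x) = 1.
    rewrite -[_ *: x]addr0 dot_linl dot_linr -sE.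
    rewrite (_ : dot x 0 = 0); last by apply: big1 => i _; rewrite mxE mulr0.
    rewrite (_ : dot 0 _ = 0); last by apply: big1 => i _; rewrite mxE mul0r.
    by field.
  by split; rewrite /= E.
have S0 : S !=set0 by have [x xn0] := x0; exists ((Num.sqrt (dot x x))^-1 *: x); exact: normalize.
have [y /set_mem yS ymin] := EVT_min_rV S0 cS (continuous_subspaceT quad_continuous).
have yn0 : y != 0.
  apply/eqP => y0; have := yS.2; rewrite /= y0 /dot big1 => [/eqP|i _].
    by rewrite eq_sym oner_eq0.
  by rewrite mxE mul0r.
exists (quad y); first exact: q0.
move=> x; have [->|xn0] := eqVneq x 0.
  by rewrite dot0 -(scale0r (0 : W)) quadZ expr0n /= mul0r mulr0.
have d0 : 0 < dot x x.
  rewrite lt_def dot_ge0 andbT; apply: contra xn0 => /eqP /dot_eq0 ->//.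
have := ymin _ (mem_set (normalize x xn0)).
by rewrite quadZ exprVn sqr_sqrtr ?(ltW d0)// [leRHS]mulrC ler_pdivlMr.
Qed.

Variables (G : W -> W) (K : R).
Hypothesis lipG : forall x y i,
  `|G x 0 i - G y 0 i| <= K * \sum_k `|x 0 k - y 0 k|.
Hypothesis quad_gt0 : forall x, x != 0 -> 0 < quad x.
Hypothesis monG : forall x y, quad (x - y) <= dot (G x - G y) (x - y).

Lemma lipschitz_dot : exists2 L : R, 0 <= L & forall x y,
  dot (G x - G y) (G x - G y) <= L * dot (x - y) (x - y).
Proof.
exists (n%:R * (K * n%:R) ^+ 2); first by rewrite mulr_ge0// sqr_ge0.
move=> x y; set r := Num.sqrt (dot (x - y) (x - y)).
have rE : r ^+ 2 = dot (x - y) (x - y) by rewrite sqr_sqrtr// dot_ge0.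
have r0 : 0 <= r by exact: sqrtr_ge0.
have h k : `|x 0 k - y 0 k| <= r.
  rewrite -(@ler_pXn2r _ 2) ?nnegrE// real_normK ?num_real// rE.
  by have := dot_coord (x - y) k; rewrite !mxE.
have hs : \sum_k `|x 0 k - y 0 k| <= n%:R * r.
  apply: le_trans (_ : \sum_(k < n) r <= _); first exact: ler_sum.
  by rewrite sumr_const card_ord mulr_natl.
rewrite -rE -mulrA -exprMn /dot.
apply: le_trans (_ : \sum_(i < n) (K * n%:R * r) ^+ 2 <= _); last first.
  by rewrite sumr_const card_ord mulr_natl.
apply: ler_sum => i _; rewrite -expr2 !mxE -(real_normK (num_real _)).
have s0 : 0 <= \sum_k `|x 0 k - y 0 k| by apply: sumr_ge0.
have [K0|K0] := leP 0 K.
  have g := le_trans (lipG x y i) (ler_wpM2l K0 hs).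
  rewrite lerXn2r ?nnegrE//; first by rewrite !mulr_ge0.
  by rewrite -mulrA.
have : `|G x 0 i - G y 0 i| <= 0.
  by apply: le_trans (lipG x y i) _; rewrite nmulr_rle0.
rewrite normr_le0 => /eqP ->; rewrite normr0 expr0n /=; exact: sqr_ge0.
Qed.

Lemma continuous_lipschitz i : continuous (fun x => G x 0 i).
Proof.
move=> x A /nbhs_ballP [e e0 eA]; apply/nbhs_rVP.
have k0 : 0 < `|K| * n%:R + 1 by rewrite ltr_wpDl// mulr_ge0.
exists (e / (`|K| * n%:R + 1)); first by rewrite divr_gt0.
move=> y yx; apply: eA; rewrite /ball /=; apply: le_lt_trans (lipG x y i) _.
have h : \sum_k `|x 0 k - y 0 k| <= n%:R * (e / (`|K| * n%:R + 1)).
  apply: le_trans (_ : \sum_(k < n) (e / (`|K| * n%:R + 1)) <= _).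
    by apply: ler_sum => k _; rewrite distrC ltW.
  by rewrite sumr_const card_ord mulr_natl.
apply: le_lt_trans (_ : `|K| * (n%:R * (e / (`|K| * n%:R + 1))) < _).
  apply: le_trans (_ : `|K| * \sum_k `|x 0 k - y 0 k| <= _); last exact: ler_wpM2l.
  by apply: ler_wpM2r; [exact: sumr_ge0|exact: ler_norm].
by rewrite !mulrA ltr_pdivrMr// mulrC ltr_pM2l// ltrDl.
Qed.

(** A continuous strongly monotone map has a zero: strong monotonicity makes
    [|G|^2] coercive, hence minimal somewhere, and a small step along [- G]
    decreases it wherever [G] does not vanish. *)
Lemma strongly_monotone_zero : exists x, G x = 0.
Proof.
have [mu mu0 Hmu] := quad_coercive quad_gt0.
have [L L0 HL] := lipschitz_dot.
have mon x y : mu * dot (x - y) (x - y) <= dot (G x - G y) (x - y).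
  exact: le_trans (Hmu _) (monG _ _).
(* strong monotonicity between [x] and [0] makes [|G|^2] coercive *)
have coer x : mu ^+ 2 * dot x x <= 2 * dot (G x) (G x) + 2 * dot (G 0) (G 0).
  have h1 := mon x 0; rewrite subr0 in h1.
  set z := G x - G 0 in h1.
  have h2 : 0 <= dot (z - mu *: x) (z - mu *: x) by exact: dot_ge0.
  have h3 : dot (z - mu *: x) (z - mu *: x) =
      dot z z - 2 * mu * dot z x + mu ^+ 2 * dot x x.
    rewrite (_ : z - mu *: x = (- mu) *: x + z); last by rewrite scaleNr addrC.
    by rewrite dot_linl !dot_linr (dotC x z); ring.
  have h4 : dot z z <= 2 * dot (G x) (G x) + 2 * dot (G 0) (G 0).
    have : 0 <= dot (1 *: G x + G 0) (1 *: G x + G 0) by exact: dot_ge0.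
    rewrite dot_linl !dot_linr (dotC (G 0) (G x)) => h.
    rewrite /z (_ : G x - G 0 = (- 1) *: G 0 + G x); last by rewrite scaleN1r addrC.
    by rewrite dot_linl !dot_linr (dotC (G 0) (G x)); lra.
  have h5 : mu * (mu * dot x x) <= mu * dot z x by rewrite ler_pM2l.
  have h6 : mu ^+ 2 * dot x x = mu * (mu * dot x x) by ring.
  by lra.
pose phi x := dot (G x) (G x).
(* outside the ball of squared radius [r], [|G|^2] exceeds its value at [0], so
   that a minimum on the ball is a global one *)
pose r := 4 * phi 0 / mu ^+ 2 + 1.
have mu2 : 0 < mu ^+ 2 by rewrite exprn_gt0.
have phi0 x : 0 <= phi x by exact: dot_ge0.
have r0 : 0 <= r by rewrite addr_ge0// mulr_ge0 ?invr_ge0 ?mulr_ge0// ltW.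
have B0 : [set x | dot x x <= r] (0 : W).
  by rewrite /= /dot big1// => i _; rewrite mxE mul0r.
have cphi : continuous phi.
  by apply: continuous_dot => i; exact: continuous_lipschitz.
have [x /set_mem xr xmin] := EVT_min_rV (ex_intro _ _ B0) (@compact_dot_ball r)
  (continuous_subspaceT cphi).
have gmin y : phi x <= phi y.
  have [yr|yr] := leP (dot y y) r; first by apply: xmin; exact: mem_set.
  apply: le_trans (xmin 0 (mem_set B0)) _.
  have h := coer y; rewrite -/(phi y) -/(phi 0) in h.
  have : mu ^+ 2 * r <= mu ^+ 2 * dot y y by rewrite ler_pM2l// ltW.
  have -> : mu ^+ 2 * r = 4 * phi 0 + mu ^+ 2 by rewrite /r; field; rewrite gt_eqF.
  by lra.
exists x; apply: dot_eq0; set g := G x.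
have L1 : 0 < L + 1 by rewrite ltr_wpDl.
(* with this step the quadratic term [L tau^2 |g|^2] is at most half of the
   gain [2 mu tau |g|^2] *)
pose tau := mu / (L + 1); have tau0 : 0 < tau by rewrite divr_gt0.
pose y := x - tau *: g; pose h := G y - g.
have yx : y - x = - tau *: g by rewrite /y addrC addKr scaleNr.
have dZ (a b : R) (u v : W) : dot (a *: u) (b *: v) = a * b * dot u v.
  by rewrite /dot mulr_sumr; apply: eq_bigr => i _; rewrite !mxE; ring.
have h1 : mu * tau * dot g g <= - dot h g.
  have := mon y x; rewrite yx dZ -[G y - G x]/h -[h]scale1r dZ scale1r.
  rewrite (_ : mu * _ = tau * (mu * tau * dot g g)); last by ring.
  rewrite (_ : 1 * _ * _ = tau * - dot h g); last by ring.
  by rewrite ler_pM2l.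
have h2 : dot h h <= L * (tau ^+ 2 * dot g g).
  have := HL y x; rewrite yx dZ -[G y - G x]/h.
  by rewrite (_ : - tau * - tau = tau ^+ 2)//; ring.
have h3 : phi y = dot g g + 2 * dot h g + dot h h.
  rewrite /phi (_ : G y = 1 *: h + g); last by rewrite scale1r /h subrK.
  by rewrite dot_linl !dot_linr (dotC g h); ring.
have h4 := gmin y; rewrite h3 -[phi x]/(dot g g) in h4.
have h5 : L * tau <= mu.
  rewrite /tau mulrA ler_pdivrMr//; nra.
have g0 : 0 <= dot g g by exact: dot_ge0.
have h6 : L * (tau ^+ 2 * dot g g) <= mu * tau * dot g g.
  rewrite (_ : L * _ = (L * tau) * (tau * dot g g)); last by ring.
  by rewrite -[leRHS]mulrA; apply: ler_wpM2r => //; rewrite mulr_ge0// ltW.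
have h7 : mu * tau * dot g g <= 0 by lra.
apply/eqP; rewrite eq_le g0 andbT.
by rewrite -(pmulr_rle0 (dot g g) (mulr_gt0 mu0 tau0)).
Qed.

End strongly_monotone.

(** * Bases modulo almost everywhere equality *)

Section basis_mod_ae.
Context {R : realType} {d : nat}.
Local Notation E := 'rV[R]_d.
Variable D : set E.
Implicit Types V : set (E -> R).

Definition ae_free n (e : 'I_n -> E -> R) := forall c : 'I_n -> R,
  ae_eq_on D (\sum_i c i *: e i) 0 -> forall i, c i = 0.

(** If [n > N], the [n] rows of coefficients are dependent, and a left kernel
    vector of their matrix gives a vanishing combination of the [e i]. *)
Lemma ae_free_le N (b : 'I_N -> E -> R) n (e : 'I_n -> E -> R) :
  (forall i, exists c : 'I_N -> R, ae_eq_on D (e i) (\sum_j c j *: b j)) ->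
  ae_free e -> (n <= N)%N.
Proof.
move=> /choice[c eE] free_e; rewrite leqNgt; apply/negP => Nn.
pose M : 'M[R]_(n, N) := \matrix_(i, j) c i j.
have : kermx M != 0.
  by rewrite -mxrank_eq0 mxrank_ker subn_eq0 -ltnNge (leq_ltn_trans (rank_leq_col M)).
move=> /rowV0Pn [v /sub_kermxP vM v0]; move/eqP : v0; apply.
apply/rowP => i; rewrite mxE; apply: (free_e (fun i => v 0 i)).
have : ae_eq_on D (\sum_i v 0 i *: e i) (\sum_i v 0 i *: \sum_j c i j *: b j).
  apply: ae_eq_on_sum => k; rewrite -[v 0 k *: e k]addr0 -[v 0 k *: \sum_j _]addr0.
  by apply: ae_eq_on_lin; [exact: eE|exact: ae_eq_on_refl].
move=> /ae_eq_on_trans; apply.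
rewrite (_ : \sum_i _ = 0); first exact: ae_eq_on_refl.
under eq_bigr do rewrite scaler_sumr.
rewrite exchange_big /=; apply: big1 => j _.
under eq_bigr do rewrite scalerA; rewrite -scaler_suml.
have := congr1 (fun z : 'rV_N => z 0 j) vM; rewrite !mxE => vM0.
rewrite (_ : \sum_(_ < n) _ = 0) ?scale0r// -[RHS]vM0.
by apply: eq_bigr => k _; rewrite mxE.
Qed.

(** A free family of maximal length in [V] spans it: a vector outside of its span
    could be added. *)
Lemma ae_basis V N (b : 'I_N -> E -> R) : linear_subspace V ->
  (forall v, V v -> exists c : 'I_N -> R, ae_eq_on D v (\sum_j c j *: b j)) ->
  exists n (e : 'I_n -> E -> R), [/\ forall i, V (e i), ae_free e &
    forall v, V v -> exists c : 'I_n -> R, ae_eq_on D v (\sum_j c j *: e j)].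
Proof.
move=> VS span.
pose P n := `[< exists e : 'I_n -> E -> R, (forall i, V (e i)) /\ ae_free e >].
have P0 : exists n, P n.
  by exists 0%N; apply/asboolP; exists (fun=> 0); split=> [[]//|c _ []].
have PN n : P n -> (n <= N)%N.
  move=> /asboolP [e [Ve fe]]; apply: ae_free_le fe => i; exact: span (Ve i).
have [n /asboolP [e [Ve fe]] nmax] := ex_maxnP P0 PN.
exists n, e; split => // v Vv; apply: contrapT => nspan.
suff : P n.+1 by move=> /nmax; rewrite ltnn.
apply/asboolP; exists (fun i => oapp e v (unlift ord0 i)); split.
  by move=> i; case: unlift => [k|] /=.
move=> c; rewrite big_ord_recl unlift_none /=.
rewrite (eq_bigr (fun i => c (lift ord0 i) *: e i)); last by move=> i _; rewrite liftK.
move=> H; have c0 : c ord0 = 0.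
  apply/eqP; apply: contrapT => /negP c0; apply: nspan.
  exists (fun i => - (c ord0)^-1 * c (lift ord0 i)).
  apply: filterS H => x H Dx; have := H Dx.
  rewrite -[LHS]/(c ord0 * v x + (\sum_i c (lift ord0 i) *: e i) x) !fct_sumE.
  rewrite -[RHS]/(0 : R).
  move=> /eqP; rewrite addr_eq0 => /eqP h.
  have -> : v x = (c ord0)^-1 * (c ord0 * v x) by rewrite mulKf.
  rewrite h mulrN -mulNr mulr_sumr; apply: eq_bigr => i _.
  by rewrite mulrA.
have cl : forall i, c (lift ord0 i) = 0.
  by apply: fe; move: H; rewrite c0 scale0r add0r.
by move=> i; case: (unliftP ord0 i) => [k ->|->].
Qed.

End basis_mod_ae.


(** * The discrete norm as a quadratic form of the coordinates *)

Lemma norm0_sq_quad (R : realType) (d : nat) (D : set 'rV[R]_d)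
    (V : set ('rV[R]_d -> R)) T n (e : 'I_n -> 'rV[R]_d -> R) (c : 'rV[R]_n) v :
  measurable D -> linear_subspace V -> L2_linear D V T ->
  (forall i, V (e i)) -> V v -> ae_eq_on D v (\sum_k c 0 k *: e k) ->
  norm0_sq D (T v) = quad (fun k l => ip D (T (e k)) (T (e l))) c.
Proof.
move=> mD VS lT Ve Vv vE; have [LT _ _] := lT.
have L i : L2 D (T (e i)) by exact: LT.
have E := L2_linear_comb_ae VS lT Ve Vv vE.
have LS : L2 D (\sum_k c 0 k *: T (e k)) by apply: L2_sum => // k; exact: L2_scale.
rewrite norm0_sqE (ip_ae E E) ip_suml// /quad; apply: eq_bigr => k _.
rewrite ipC ip_suml// mulr_sumr; apply: eq_bigr => l _.
by rewrite mulrA (ipC _ (T (e l))).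
Qed.

Lemma quad_scale (R : realType) n (a : R) (B : 'I_n -> 'I_n -> R) (x : 'rV[R]_n) :
  quad (fun k l => a * B k l) x = a * quad B x.
Proof.
rewrite /quad mulr_sumr; apply: eq_bigr => k _; rewrite mulr_sumr.
by apply: eq_bigr => l _; rewrite mulrCA.
Qed.

Lemma quad_lin (R : realType) n (a : R) (B B' : 'I_n -> 'I_n -> R) (x : 'rV[R]_n) :
  quad (fun k l => a * B k l + B' k l) x = a * quad B x + quad B' x.
Proof.
rewrite /quad mulr_sumr -big_split; apply: eq_bigr => k _ /=.
rewrite mulr_sumr -big_split; apply: eq_bigr => l _ /=; ring.
Qed.

Lemma quad_sum (R : realType) n p (B : 'I_p -> 'I_n -> 'I_n -> R) (x : 'rV[R]_n) :
  quad (fun k l => \sum_i B i k l) x = \sum_i quad (B i) x.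
Proof.
rewrite /quad [RHS]exchange_big; apply: eq_bigr => k _ /=.
by rewrite [RHS]exchange_big; apply: eq_bigr => l _ /=; rewrite mulr_sumr.
Qed.

(** The squared norm is a combination of squares [norm0_sq (T v)] with operators
    [T] that are linear modulo almost everywhere equality. *)
Lemma norm_star_sq_quad (R : realType) (d : nat) (Omega : set 'rV[R]_d)
    (lambda : R) (V : set ('rV[R]_d -> R)) n (e : 'I_n -> 'rV[R]_d -> R) :
  open Omega -> coord_bounded Omega -> linear_subspace V -> V `<=` H2 Omega ->
  (forall i, V (e i)) ->
  exists B : 'I_n -> 'I_n -> R, forall (c : 'rV[R]_n) v, V v ->
    ae_eq_on Omega v (\sum_k c 0 k *: e k) ->
    norm_star_sq Omega lambda v = quad B c.
Proof.
move=> oO bO VS V2 Ve; have mO := open_measurable_rV oO.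
pose T2 i k v := weak_partial Omega i (weak_partial Omega k v).
pose T1 i v := weak_partial Omega i v.
have l2 i k : L2_linear Omega V (T2 i k).
  by apply: L2_linearS V2 _; exact: weak_partial2_linear.
have l1 i : L2_linear Omega V (T1 i).
  by apply: L2_linearS (weak_partial_linear oO bO i) => v /V2 /H2_H1.
have l0 : L2_linear Omega V id by apply: L2_linear_id => v /V2 /H2_H1 /H1_L2.
pose form (T : ('rV[R]_d -> R) -> 'rV[R]_d -> R) k l :=
  ip Omega (T (e k)) (T (e l)).
exists (fun k l => lambda ^+ 2 * form id k l
  + (2 * lambda * (\sum_i form (T1 i) k l) + \sum_i \sum_i' form (T2 i i') k l)).
move=> c v Vv vE; rewrite !quad_lin !quad_sum /norm_star_sq addrC.
rewrite (norm0_sq_quad mO VS l0 Ve Vv vE); congr (_ + _).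
rewrite addrC; congr (_ * _ + _).
  by apply: eq_bigr => i _; exact: (norm0_sq_quad mO VS (l1 i) Ve Vv vE).
apply: eq_bigr => i _; rewrite quad_sum; apply: eq_bigr => k _.
exact: (norm0_sq_quad mO VS (l2 i k) Ve Vv vE).
Qed.

(** * Existence and uniqueness *)

(* C and Ceta are the constants of the equivalences for s0, s2 and of the
   equivalence eta_star ~ 1; they are chosen before all data other than
   d, Omega, m, rho. *)
Theorem theorem5p5
  (R : realType) (d : nat) (Omega : set 'rV[R]_d) (m : nat) (rho : R)
  (C Ceta : R)
  (hd : (0 < d)%N)
  (hOmega : convex_polytope Omega)
  (hm : (2 <= m)%N)
  (hrho : 0 < rho < 1)
  (hC : 0 < C) (hCeta : 0 < Ceta)
  (Lam1 Lam2 : metricType R)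
  (cLam1 : compact [set: Lam1]) (cLam2 : compact [set: Lam2])
  (nLam1 : [set: Lam1] !=set0) (nLam2 : [set: Lam2] !=set0)
  (A : Lam1 -> Lam2 -> 'rV[R]_d -> 'M[R]_d)
  (b : Lam1 -> Lam2 -> 'rV[R]_d -> 'rV[R]_d)
  (c f gamma : Lam1 -> Lam2 -> 'rV[R]_d -> R)
  (lambda kappa : R)
  (hdata : isaacs_data Omega A b c f)
  (hcordes : cordes Omega A b c gamma lambda kappa)
  (hf : source_in_L2 Omega f gamma)
  (Kh : @mesh R d)
  (hmesh : polytopal_mesh Omega Kh)
  (hreg : shape_regular rho Kh)
  (j : nat) (hj : (j <= 2)%N)
  (Vh : set ('rV[R]_d -> R))
  (hVh : fe_space Omega Vh)
  (gI : 'rV[R]_d -> R) (hgI : Vh gI)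
  (s0 s2 : ('rV[R]_d -> R) -> ('rV[R]_d -> R) -> R)
  (hs0 : symmetric_bilinear_on Omega (set_sum Vh (pw_poly Kh m)) s0)
  (hs2 : symmetric_bilinear_on Omega (set_sum Vh (pw_poly Kh m)) s2)
  (hs0_equiv : forall v, set_sum Vh (pw_poly Kh m) v ->
     C^-1 * norm0_sq Omega v <= s0 v v <= C * norm0_sq Omega v)
  (hs2_equiv : forall v, set_sum Vh (pw_poly Kh m) v ->
     ae_eq_on Omega (L2_proj Omega Kh 1 v) 0 ->
     C^-1 * broken_norm2_sq Omega Kh v <= s2 v v
       <= C * broken_norm2_sq Omega Kh v)
  (eta_star : R)
  (heta_star : Ceta^-1 <= eta_star <= Ceta)
  (hthreshold : forall eta, eta_star <= eta -> forall v1 v2,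
     Vh_affine Omega Vh gI v1 -> Vh_affine Omega Vh gI v2 ->
     kappa * norm_star_sq Omega lambda (v1 - v2)
       <= Ah Omega A b c f gamma lambda Kh m j s0 s2 eta v1 (v1 - v2)
          - Ah Omega A b c f gamma lambda Kh m j s0 s2 eta v2 (v1 - v2))
  (eta : R) (heta : eta_star <= eta) :
  exists u, [/\ Vh_affine Omega Vh gI u,
    forall v, Vh_zero Omega Vh v ->
      Ah Omega A b c f gamma lambda Kh m j s0 s2 eta u v = 0
  & forall u', Vh_affine Omega Vh gI u' ->
      (forall v, Vh_zero Omega Vh v ->
        Ah Omega A b c f gamma lambda Kh m j s0 s2 eta u' v = 0) ->
      ae_eq_on Omega u u'].
Proof.
pose Aop := Ah Omega A b c f gamma lambda Kh m j s0 s2 eta.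
have oO := polytope_open hOmega; have bO := polytope_bounded hOmega.
have [VhS [N [bas [bas_in bas_span]]] VhH2] := hVh.
have [lambda0 /andP[kappa0 _] _ _ _] := hcordes.
have VS : linear_subspace (Vh_zero Omega Vh).
  have [Vh0 VhL] := VhS; split.
    by split => //; exact: H1_0_zero.
  by move=> a u v [Vu Hu] [Vv Hv]; split; [exact: VhL|exact: H1_0_lin].
have ZV : Vh_zero Omega Vh `<=` Vh by move=> v [].
have affV v : Vh_affine Omega Vh gI v -> Vh v.
  by move=> [w [Vw _] <-]; rewrite -[gI]scale1r; apply VhS.2.
have affB v v' : Vh_affine Omega Vh gI v -> Vh_affine Omega Vh gI v' ->
    Vh_zero Omega Vh (v - v').
  move=> [w Vw <-] [w' Vw' <-]; rewrite opprD addrACA subrr add0r.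
  exact: subspace_sub.
have linA u (Vu : Vh u) : ae_linear_form Omega Vh (Aop u) :=
  Ah_linear_form j hd hOmega cLam1 cLam2 nLam1 nLam2 hdata hcordes hf hmesh hVh
    hs0 hs2 eta Vu.
have definite w : Vh_zero Omega Vh w -> norm_star_sq Omega lambda w <= 0 ->
    ae_eq_on Omega w 0.
  by move=> [Vw Hw]; apply: norm_star_eq0 => //; exact: VhH2.
have [n [e [eV efree espan]]] := @ae_basis _ _ Omega _ N bas VS
  (fun v Vv => bas_span v (ZV v Vv)).
have eVh i : Vh (e i) by exact: ZV.
pose w (x : 'rV[R]_n) : 'rV[R]_d -> R := \sum_k x 0 k *: e k.
have wV (x : 'rV[R]_n) : Vh_zero Omega Vh (w x) by exact: subspace_comb.
have uV x : Vh_affine Omega Vh gI (gI + w x) by exists (w x).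
have wB x y : (gI + w x) - (gI + w y) = w (x - y).
  rewrite opprD addrACA subrr add0r /w -sumrB; apply: eq_bigr => k _.
  by rewrite !mxE scalerBl.
have [B HB] := norm_star_sq_quad lambda oO bO VhS VhH2 eVh.
have HBw x : norm_star_sq Omega lambda (w x) = quad B x.
  by apply: HB; [exact: ZV|exact: ae_eq_on_refl].
pose G (x : 'rV[R]_n) : 'rV[R]_n := \row_i Aop (gI + w x) (e i).
have Gi x i : G x 0 i = Aop (gI + w x) (e i) by exact: mxE.
have lip i : {K : R | 0 <= K & forall x y, `|G x 0 i - G y 0 i| <=
    K * \sum_k `|x 0 k - y 0 k|}.
  apply: cid2.
  have [K K0 HK] := Ah_lipschitz j hd hOmega cLam1 cLam2 nLam1 nLam2 hdata hcordes
    hf hmesh hVh hs0 hs2 eta eVh (eVh i).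
  exists K => // x y; rewrite (Gi x i) (Gi y i).
  apply: (HK (fun k => x 0 k - y 0 k) _ _ (affV _ (uV x)) (affV _ (uV y))).
  rewrite wB (_ : w _ = \sum_k (x 0 k - y 0 k) *: e k); first exact: ae_eq_on_refl.
  by apply: eq_bigr => k _; rewrite !mxE.
have lipG x y i : `|G x 0 i - G y 0 i| <=
    (\sum_i s2val (lip i)) * \sum_k `|x 0 k - y 0 k|.
  apply: le_trans (s2valP' (lip i) x y) _; apply: ler_wpM2r; first exact: sumr_ge0.
  rewrite (bigD1 i isT) lerDl; apply: sumr_ge0 => k _; exact: s2valP (lip k).
have quad_gt0 x : x != 0 -> 0 < quad (fun k l => kappa * B k l) x.
  move=> x0; rewrite quad_scale -HBw mulr_gt0// ltNge; apply/negP => h; move/eqP: x0; apply.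
  apply/rowP => i; rewrite mxE; exact: (efree (fun k => x 0 k) (definite _ (wV x) h)).
have dotG x z : dot (G x) z = Aop (gI + w x) (w z).
  rewrite (ae_linear_form_comb VhS (linA _ (affV _ (uV x))) eVh (ZV _ (wV z))
    (ae_eq_on_refl _ _)) dotC; apply: eq_bigr => i _.
  by rewrite Gi.
have monG x y : quad (fun k l => kappa * B k l) (x - y) <= dot (G x - G y) (x - y).
  rewrite quad_scale -HBw dot_subl !dotG -wB.
  exact: (hthreshold eta heta).
have [x Gx] := strongly_monotone_zero lipG quad_gt0 monG.
have zero v : Vh_zero Omega Vh v -> Aop (gI + w x) v = 0.
  move=> Vv; have [a va] := espan v Vv.
  rewrite (ae_linear_form_comb VhS (linA _ (affV _ (uV x))) eVh (ZV _ Vv) va).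
  apply: big1 => i _.
  by rewrite -Gi Gx mxE mulr0.
exists (gI + w x); split => // u' u'V u'0.
have Vd : Vh_zero Omega Vh (gI + w x - u') by exact: affB.
have N0 : norm_star_sq Omega lambda (gI + w x - u') <= 0.
  rewrite -(pmulr_rle0 _ kappa0); apply: le_trans (hthreshold _ heta _ _ (uV x) u'V) _.
  by rewrite -/(Aop _ _) (zero _ Vd) (u'0 _ Vd) subrr.
apply: filterS (definite _ Vd N0) => y h Oy; apply/eqP; rewrite -subr_eq0.
by apply/eqP; exact: h.
Qed.
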